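(* Let $\lambda\ge1$ and let $\Omega\subset\mathbb{C}^n$ be a hyperbolic domain which is hyperbolic at $p\in\partial\Omega$. Then $p$ is a $\lambda$-visible point for $\Omega$ if and only if for every $D\in[\Omega]_p$, $p$ is a $\lambda$-visible point for $D$.
   Context: Neighbourhoods are open subsets of $\mathbb{C}^n$; $A\subset\subset B$ means that the closure of $A$ is compact and contained in $B$. $\Delta\subset\mathbb{C}$ is the open unit disc. For a domain $\Omega\subset\mathbb{C}^n$, $z,w\in\Omega$, $v\in\mathbb{C}^n$: $\tilde l_\Omega(z,w)=\inf\{|\alpha|:\exists\,\varphi:\Delta\to\Omega \text{ holomorphic},\ \varphi(0)=z,\ \varphi(\alpha)=w\}$; the Lempert function is $l_\Omega(z,w)=\tanh^{-1}\tilde l_\Omega(z,w)$; the Kobayashi pseudodistance $k_\Omega$ is the largest pseudodistance on $\Omega$ not exceeding $l_\Omega$; the Kobayashi-Royden pseudometric is $\kappa_\Omega(z;v)=\inf\{|\alpha|:\exists\,\varphi:\Delta\to\Omega \text{ holomorphic},\ \varphi(0)=z,\ \alpha\varphi'(0)=v\}$. For an absolutely continuous curve $\gamma:I\to\Omega$ ($I$ a compact interval), its Kobayashi-Royden length is $l^\kappa_\Omega(\gamma)=\int_I\kappa_\Omega(\gamma(t);\gamma'(t))\,dt$. $\Omega$ is hyperbolic if $k_\Omega$ is a distance. For $p\in\partial\Omega$, $\Omega$ is said to be hyperbolic at $p$ if either $\Omega$ is bounded, or $\Omega$ is unbounded and $\liminf_{z\to p,\,w\to\infty} l_\Omega(z,w)>0$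 (with $z,w\in\Omega$). For $\lambda\ge1$, $\epsilon\ge0$, an absolutely continuous curve $\gamma:I\to\Omega$ is a $(\lambda,\epsilon)$-geodesic for $\Omega$ if $l^\kappa_\Omega(\gamma|_{[t_1,t_2]})\le\lambda k_\Omega(\gamma(t_1),\gamma(t_2))+\epsilon$ for all $t_1\le t_2$ in $I$. A point $p\in\partial\Omega$ is a $(\lambda,\epsilon)$-visible point for $\Omega$ if for any bounded neighbourhood $U$ of $p$ there exist a neighbourhood $V\subset\subset U$ of $p$ and a compact set $K_{\lambda,\epsilon}\subset\Omega$ such that every $(\lambda,\epsilon)$-geodesic $\gamma:I\to\Omega$ for $\Omega$ joining a point of $\Omega\cap V$ to a point of $\Omega\setminus U$ satisfies $\gamma(I)\cap K_{\lambda,\epsilon}\ne\emptyset$. It is a $\lambda$-visible point for $\Omega$ if it is $(\lambda,\epsilon)$-visible for $\Omega$ for all $\epsilon\ge0$. Let $\Omega,D$ be hyperbolic domains in $\mathbb{C}^n$ with a common boundary point $p$, both hyperbolic at $p$. $\Omega$ is equivalent to $D$ at $p$ if there is a bounded neighbourhood $U\subset\mathbb{C}^n$ of $p$ with $U\cap\Omega=U\cap D$. This is an equivalence relation, and $[\Omega]_p$ denotes the equivalence class of $\Omega$ (so its members are hyperbolic domains that have $p$ as boundary point and are hyperbolic at $p$). *)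

(* Defs.v *)
From mathcomp Require Import all_boot all_order all_algebra.
From mathcomp Require Import all_classical all_reals all_analysis.
From mathcomp Require Import complex.

Set Implicit Arguments.
Unset Strict Implicit.
Unset Printing Implicit Defensive.

Import Order.TTheory GRing.Theory Num.Theory.
Import numFieldNormedType.Exports.

Local Open Scope classical_set_scope.
Local Open Scope complex_scope.
Local Open Scope ring_scope.

(* Topology and norm are inferred from the numClosedFieldType structure.  The
   norm of a row vector over Cplx R is the sup of the moduli of its entries, with
   values in Cplx R; its topology is the usual one of C^n, and boundedness and
   absolute continuity do not depend on the choice among equivalent norms. *)
Definition Cplx (R : realType) : numClosedFieldType := R[i].

Section Definitions.
Context {R : realType} {n : nat}.
Local Notation C := (Cplx R).
Local Notation Cn := 'rV[Cplx R]_n.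
Implicit Types (Omega D U V A : set Cn) (p z w u v : Cn).

Definition domain Omega := [/\ Omega !=set0, open Omega & connected Omega].

Definition boundary A : set Cn := closure A `\` interior A.

Definition relatively_compact_in A U :=
  compact (closure A) /\ closure A `<=` U.

Definition unit_disc : set C := [set zeta | `|zeta| < 1].

Definition modulus (alpha : C) : R := complex.Re `|alpha|.

(* phi is total, but only its values on the (open) unit disc matter;
   derivability is with respect to the field C, i.e. complex. *)
Definition holomorphic_disc Omega (phi : C -> Cn) :=
  forall zeta, unit_disc zeta -> derivable phi zeta 1 /\ Omega (phi zeta).

Local Open Scope ereal_scope.

Definition lempert_tilde Omega z w : \bar R :=
  ereal_inf [set (modulus alpha)%:E | alpha in
    [set alpha | unit_disc alpha /\ exists phi : C -> Cn,
      [/\ holomorphic_disc Omega phi, phi 0%R = z & phi alpha = w]]].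

Definition artanh (x : R) : R := (ln ((1 + x) / (1 - x)) / 2)%R.

(* The value at +oo, the infimum of the empty set, is +oo;
   lempert_tilde never takes the value -oo. *)
Definition artanhe (x : \bar R) : \bar R :=
  if x is r%:E then if (r < 1)%R then (artanh r)%:E else +oo else +oo.

Definition lempert Omega z w : \bar R := artanhe (lempert_tilde Omega z w).

Definition pseudodistance_on A (d : Cn -> Cn -> \bar R) :=
  [/\ (forall z w, A z -> A w -> d z w \is a fin_num /\ 0 <= d z w),
      (forall z, A z -> d z z = 0),
      (forall z w, A z -> A w -> d z w = d w z) &
      (forall z w u, A z -> A w -> A u -> d z u <= d z w + d w u)].

Definition distance_on A (d : Cn -> Cn -> \bar R) :=
  pseudodistance_on A d /\ (forall z w, A z -> A w -> d z w = 0 -> z = w).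

(* A pointwise supremum of pseudodistances is a pseudodistance as soon as it is
   finite, which is the case here when Omega is a domain; it is then the largest
   one not exceeding the Lempert function. *)
Definition kobayashi Omega z w : \bar R :=
  ereal_sup [set d z w | d in [set d | pseudodistance_on Omega d /\
    forall x y, Omega x -> Omega y -> d x y <= lempert Omega x y]].

Definition kobayashi_royden Omega z v : \bar R :=
  ereal_inf [set (modulus alpha)%:E | alpha in
    [set alpha | exists phi : C -> Cn,
      [/\ holomorphic_disc Omega phi, phi 0%R = z &
          (alpha *: derive1 phi 0 = v)%R]]].

Definition hyperbolic Omega := distance_on Omega (kobayashi Omega).

(* The filter of neighbourhoods of infinity in C^n. *)
Definition cobounded : set_system Cn := [set A | bounded_set (~` A)].

Definition hyperbolic_at Omega p :=
  bounded_set Omega \/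
  (~ bounded_set Omega /\
   0 < limf_einf (fun zw : Cn * Cn => lempert Omega zw.1 zw.2)
         (filter_prod (within Omega (nbhs p)) (within Omega cobounded))).

Definition absolutely_continuous (a b : R) (gamma : R -> Cn) :=
  forall eps : R, (0 < eps)%R -> exists2 delta : R, (0 < delta)%R &
    forall (m : nat) (s t : 'I_m -> R),
      (forall i, [/\ a <= s i, s i <= t i & t i <= b]%R) ->
      trivIset setT (fun i => `]s i, t i[%classic) ->
      (\sum_(i < m) (t i - s i) < delta)%R ->
      (\sum_(i < m) `|gamma (t i) - gamma (s i)| < (eps%:C : Cplx R))%R.

(* derive1 is not available for a real variable since the library has no
   real normed module structure on C^n.  At points where the limit does not
   exist the value is arbitrary; for absolutely continuous curves these form
   a null set. *)
Definition velocity (gamma : R -> Cn) (t : R) : Cn :=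
  (lim ((fun h : R => ((h^-1)%:C : Cplx R) *: (gamma (h + t) - gamma t)) @ 0^'))%R.

Definition kr_length Omega (gamma : R -> Cn) (t1 t2 : R) : \bar R :=
  \int[lebesgue_measure]_(t in `[t1, t2]%classic)
    kobayashi_royden Omega (gamma t) (velocity gamma t).

Definition geodesic (lambda eps : R) Omega (a b : R) (gamma : R -> Cn) :=
  [/\ (a <= b)%R,
      absolutely_continuous a b gamma,
      gamma @` `[a, b]%classic `<=` Omega &
      forall t1 t2 : R, (a <= t1)%R -> (t1 <= t2)%R -> (t2 <= b)%R ->
        kr_length Omega gamma t1 t2 <=
          lambda%:E * kobayashi Omega (gamma t1) (gamma t2) + eps%:E].

Definition visible_point2 (lambda eps : R) Omega p :=
  forall U, open U -> U p -> bounded_set U ->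
    exists V K : set Cn,
      [/\ open V /\ V p, relatively_compact_in V U,
          compact K, K `<=` Omega &
          forall (a b : R) (gamma : R -> Cn),
            geodesic lambda eps Omega a b gamma ->
            (Omega `&` V) (gamma a) -> (Omega `\` U) (gamma b) ->
            (gamma @` `[a, b]%classic) `&` K !=set0].

Definition visible_point (lambda : R) Omega p :=
  forall eps : R, (0 <= eps)%R -> visible_point2 lambda eps Omega p.

Definition hyperbolic_domain_at Omega p :=
  [/\ domain Omega, hyperbolic Omega, boundary Omega p & hyperbolic_at Omega p].

Definition equivalent_at p Omega D :=
  exists U, [/\ open U, U p, bounded_set U & U `&` Omega = U `&` D].

Definition local_equiv_class Omega p : set (set Cn) :=
  [set D | hyperbolic_domain_at D p /\ equivalent_at p Omega D].

End Definitions.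

(* Main.v *)
(** Suppose [X] and [Y] coincide in a ball around [p], and let [m] be a lower bound
  for the Kobayashi distance in [X] from [x] to the part of [X] outside the ball.
  A disc in [X] centred at [x], restricted to the radius [th m], stays in the ball,
  hence in [Y], and [1 / th m = 1 + O(exp (-2m))]: so the infinitesimal metrics,
  and the lengths of short chains of discs, of [X] and [Y] at [x] agree up to a
  factor [1 + O(exp (-2m))].  Near [p], hyperbolicity at [p] and Cauchy's estimate
  bound the admissible radius below by a constant, whatever [m] is.

  Visibility of [p] for [X] gives [m >= k_X(x, o) - const] for [x] near [p],
  since a nearly shortest chain of discs from [x] to the outside is turned into
  a nearly shortest polygon and must pass near a compact set.  The same bound
  holds for the distance in [Y].  Along a nearly geodesic curve or chain the
  errors are then [a_i exp (-2 m_i)] with steps [a_i] and [m_i] growing at least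
  linearly in the length on both sides of the point closest to [o], so their sum
  is bounded independently of the curve.  Therefore [k_Y <= k_X + const] near [p],
  and the Kobayashi-Royden length in [X] of a geodesic of [Y] near [p] exceeds its
  length in [Y] by at most a constant: geodesics of [Y] are geodesics of [X] with
  a larger additive constant, and meet the compact set given by the visibility of
  [p] for [X]. *)

Require Import Defs.
From mathcomp Require Import all_boot all_order all_algebra.
From mathcomp Require Import all_classical all_reals all_analysis.
From mathcomp Require Import measurable_realfun.
From mathcomp Require Import finmap complex.
From mathcomp Require Import zify ring lra.

Set Implicit Arguments.
Unset Strict Implicit.
Unset Printing Implicit Defensive.
Import Order.TTheory GRing.Theory Num.Theory.
Import numFieldNormedType.Exports HBNNSimple.
Local Open Scope classical_set_scope.
Local Open Scope complex_scope.
Local Open Scope ring_scope.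

(** * Real-valued norms *)

(** [kobayashi] is a supremum of pseudodistances, whereas geodesics are defined through an integral
    of [kobayashi_royden]. Chains of small discs mediate between the two: the infimum of their
    lengths is itself a pseudodistance below the Lempert function, hence at most [kobayashi], and a
    chain whose steps also control the metric on straight segments can be replaced by a polygon of
    no greater length, to which visibility applies. The order of the estimates avoids a circle. The
    distance in [Y] to the outside of the ball cannot be bounded by visibility in [Y], which is to
    be proved. Instead, a nearly shortest chain to the outside is, at each vertex, about as far from
    the outside as its own remaining length, so its errors are summable and it passes to [X], where
    visibility is given. Next, a nearly shortest chain of [X] between two points near [p] may leave
    the ball, beyond which the domains are unrelated; visibility of [X] then applies from both ends,
    and the two pieces are joined through the base point [o]. Only after these additive bounds are
    lengths of curves compared, now from [Y] to [X]. *)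

Section Norms.
Context {R : realType}.
Local Notation C := (Cplx R).
Implicit Types (a b z : C).

Context {V : normedModType C}.
Implicit Types x y : V.

Definition nrm x : R := complex.Re `|x|.

Lemma nrmE x : `|x| = (nrm x)%:C.
Proof. by rewrite /nrm RRe_real // normr_real. Qed.

Lemma nrm_ltE x (e : R) : (`|x| < e%:C) = (nrm x < e).
Proof. by rewrite nrmE ltcR. Qed.

Lemma nrm_leE x (e : R) : (`|x| <= e%:C) = (nrm x <= e).
Proof. by rewrite nrmE lecR. Qed.

Lemma nrm_ge0 x : 0 <= nrm x.
Proof. by rewrite -lecR -nrmE normr_ge0. Qed.

Lemma nrm0 : nrm 0 = 0.
Proof. by rewrite /nrm normr0. Qed.

Lemma nrm_eq0 x : nrm x = 0 -> x = 0.
Proof. move=> h; apply: normr0_eq0; by rewrite nrmE h. Qed.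

Lemma nrmN x : nrm (- x) = nrm x.
Proof. by rewrite /nrm normrN. Qed.

Lemma nrmB x y : nrm (x - y) = nrm (y - x).
Proof. by rewrite /nrm distrC. Qed.

Lemma nrmD x y : nrm (x + y) <= nrm x + nrm y.
Proof.
have := ler_normD x y; rewrite !nrmE -rmorphD/=.
by rewrite lecR.
Qed.

Lemma nrmD3 (y x z : V) : nrm (x - z) <= nrm (x - y) + nrm (y - z).
Proof. by apply: le_trans (nrmD _ _); rewrite addrA subrK. Qed.

Lemma nrmZ a x : nrm (a *: x) = modulus a * nrm x.
Proof.
have := normrZ a x; rewrite !nrmE.
have -> : `|a| = (modulus a)%:C by rewrite /modulus RRe_real // normr_real.
by rewrite -rmorphM/= => /(congr1 (@complex.Re R)).
Qed.

Lemma nbhs_nrm x (A : set V) :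
  nbhs x A <-> exists2 e : R, 0 < e & forall y, nrm (y - x) < e -> A y.
Proof.
split.
  move=> /nbhs_normP[e /= e0 h].
  have eR : (complex.Re e)%:C = e by rewrite RRe_real // gtr0_real.
  exists (complex.Re e); first by rewrite -ltcR eR.
  by move=> y yx; apply: h => /=; rewrite distrC -eR nrm_ltE.
move=> [e e0 h]; apply/nbhs_normP; exists e%:C => /=; first by rewrite ltcR.
by move=> y /= ; rewrite distrC nrm_ltE; exact: h.
Qed.

Lemma open_nrm (A : set V) :
  open A -> forall x, A x -> exists2 e : R, 0 < e & forall y, nrm (y - x) < e -> A y.
Proof. by move=> oA x Ax; apply/nbhs_nrm; exact: open_nbhs_nbhs. Qed.

Lemma open_nrmP (A : set V) :
  (forall x, A x -> exists2 e : R, 0 < e & forall y, nrm (y - x) < e -> A y) -> open A.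
Proof. by move=> h; rewrite openE => x Ax; apply/nbhs_nrm; exact: h. Qed.

Definition nball x (r : R) : set V := [set y | nrm (y - x) < r].

Lemma nball_open x r : open (nball x r).
Proof.
apply: open_nrmP => y; rewrite /nball /= => yx.
exists (r - nrm (y - x)); first by rewrite subr_gt0.
move=> z; rewrite ltrBrDr; apply: le_lt_trans.
exact: nrmD3.
Qed.

Lemma nball_center x r : 0 < r -> nball x r x.
Proof. by rewrite /nball /= subrr nrm0. Qed.

Lemma closure_nrm (A : set V) x :
  closure A x <-> forall e : R, 0 < e -> exists2 y, A y & nrm (y - x) < e.
Proof.
split.
  move=> cA e e0; have [|y [Ay yx]] := cA (nball x e).
    by apply/nbhs_nrm; exists e.
  by exists y.
move=> h B /nbhs_nrm[e e0 hB]; have [y Ay yx] := h e e0.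
by exists y; split => //; exact: hB.
Qed.

Lemma bounded_nrm (A : set V) :
  bounded_set A <-> exists M : R, forall x, A x -> nrm x <= M.
Proof.
split.
  move=> [M [Mr h]].
  have eR : (complex.Re M)%:C = M by rewrite RRe_real.
  exists (complex.Re M + 1) => x Ax.
  have := h (complex.Re M + 1)%:C; rewrite -eR ltcR => /(_ _ x Ax).
  by rewrite ltrDl ltr01 => /(_ isT); rewrite /= nrm_leE.
move=> [M h]; exists M%:C; split; first by rewrite complex_real.
move=> N MN x Ax /=.
apply/ltW/(le_lt_trans _ MN); rewrite nrm_leE; exact: h.
Qed.

Lemma nball_bounded x r : bounded_set (nball x r).
Proof.
apply/bounded_nrm; exists (r + nrm x) => y yx.
have := nrmD (y - x) x; rewrite subrK => /le_trans; apply.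
by rewrite lerD2r ltW.
Qed.

(** A Lebesgue number argument: balls of half the local radius cover [K], and the smallest half
    radius serves all points. Since [f] may take the value [+oo], an upper bound also proves
    membership: in the applications [f] is infinite off an open set. *)
Lemma compact_bounded_nrm (K : set V) (f : V -> \bar R) :
  compact K -> (forall x, K x -> exists2 e : R, 0 < e &
    exists M : R, forall y, nrm (y - x) < e -> (f y <= M%:E)%E) ->
  exists2 e : R, 0 < e &
    exists M : R, forall x y, K x -> nrm (y - x) < e -> (f y <= M%:E)%E.
Proof.
move=> cK h.
pose g x := if pselect (K x) is left k then projT1 (cid2 (h x k)) else 1.
have g0 x : 0 < g x.
  by rewrite /g; case: pselect => // k; case: cid2 => ? ? ?.
have gP x : K x -> exists M : R, forall y, nrm (y - x) < g x -> (f y <= M%:E)%E.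
  by move=> Kx; rewrite /g; case: pselect => // k; case: cid2 => ? ? ?.
pose G x := if pselect (K x) is left k then projT1 (cid (gP x k)) else 0.
have GP x y : K x -> nrm (y - x) < g x -> (f y <= (G x)%:E)%E.
  move=> Kx; rewrite /G; case: pselect => // k; case: cid => ? hh /=; exact: hh.
move: cK; rewrite compact_cover => /(_ V K (fun x => nball x (g x / 2))).
case=> [x _|x Kx|D DK cov]; first exact: nball_open.
  by exists x => //; apply: nball_center; rewrite divr_gt0.
exists (\big[Order.min/1]_(i <- D) (g i / 2)).
  by apply: lt_bigmin => // i _; rewrite divr_gt0.
exists (\big[Order.max/0]_(i <- D) (G i)).
move=> x y Kx yx.
have [i /= iD xi] := cov _ Kx.
have Ki : K i by exact/set_mem/DK.
apply: (@le_trans _ _ (G i)%:E).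
  apply: GP => //; apply: (le_lt_trans (nrmD3 x _ _)).
  rewrite [ltRHS](splitr (g i)) ltrD//.
  apply: lt_le_trans yx _.
  by apply: ge_bigmin_seq.
by rewrite lee_fin; apply: le_bigmax_seq.
Qed.

End Norms.

(** * Chains and weighted sums *)

Section RealLemmas.
Context {R : realType}.
Implicit Types (a b c d s t u x y : R).

(** Real induction on the supremum of the [t] with [P a t]. This is how local estimates are summed
    along a path throughout the proof. *)
Lemma cousin (P : R -> R -> Prop) a b : a <= b ->
  (forall s t u, a <= s -> s <= t -> t <= u -> u <= b ->
     P s t -> P t u -> P s u) ->
  (forall u, a <= u -> u <= b -> exists2 d, 0 < d &
     forall s t, a <= s -> s <= u -> u <= t -> t <= b -> t - s < d -> P s t) ->
  P a b.
Proof.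
move=> ab tr loc.
pose E := [set t | [/\ a <= t, t <= b & P a t]].
have Ea : E a.
  have [d d0 h] := loc a (lexx a) ab.
  by split => //; apply: h => //; rewrite subrr.
have Esup : has_sup E by split; [exists a | exists b => t []].
set c := sup E.
have ac : a <= c by apply: ub_le_sup => //; case: Esup.
have cb : c <= b by apply: ge_sup; [exists a | move=> t []].
have [d d0 h] := loc c ac cb.
have d4 : 0 < d / 4 by rewrite divr_gt0.
have [t [at_ tb Pat] ct] := sup_adherent d4 Esup.
have tc : t <= c by apply: ub_le_sup => //; case: Esup.
pose c' := Num.min b (c + d / 4).
have cc' : c <= c' by rewrite le_min cb lerDl ltW.
have c'b : c' <= b by rewrite ge_min lexx.
have c'd : c' <= c + d / 4 by rewrite ge_min lexx orbT.
have Pac' : P a c'.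
  apply: (tr a t c') => //; first exact: le_trans cc'.
  by apply: h => //; rewrite -/c in ct *; lra.
have c'c : c' <= c.
  apply: ub_le_sup; first by case: Esup.
  by split => //; exact: le_trans cc'.
have : c' = b.
  apply/eqP; rewrite eq_le c'b /=.
  by move: c'c; rewrite /c' ge_min => /orP[bc|]; [rewrite le_min lexx /=|]; lra.
by move=> <-.
Qed.

(** The hyperbolic tangent, inverse to [artanh]. The exponent [2 * d] is the origin of the weights
    [expR (- (2 * m))]. *)
Definition th d : R := (expR (2 * d) - 1) / (expR (2 * d) + 1).

Lemma artanh_arg x : -1 < x -> x < 1 -> 0 < (1 + x) / (1 - x).
Proof. by move=> x0 x1; rewrite divr_gt0 //; lra. Qed.

Lemma le_artanh d x : -1 < x -> x < 1 -> (d <= artanh x) = (th d <= x).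
Proof.
move=> x0 x1.
rewrite /artanh ler_pdivlMr // -[d * 2]expRK ler_ln ?posrE ?expR_gt0 ?artanh_arg//.
rewrite mulrC /th; set E := expR _.
have E0 : 0 < E := expR_gt0 _.
rewrite ler_pdivlMr ?ler_pdivrMr; [|lra..].
by apply/idP/idP => ?; lra.
Qed.

Lemma artanh_le x y : -1 < x -> x <= y -> y < 1 -> artanh x <= artanh y.
Proof.
move=> x0 xy y1.
have x1 : x < 1 by exact: le_lt_trans y1.
rewrite le_artanh//; last exact: lt_le_trans xy.
by apply: le_trans xy; have := le_artanh (artanh x) x0 x1; rewrite lexx.
Qed.

Lemma artanh0 : artanh 0 = 0 :> R.
Proof. by rewrite /artanh addr0 subr0 divr1 ln1 mul0r. Qed.

Lemma artanh_ge0 x : 0 <= x -> x < 1 -> 0 <= artanh x.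
Proof. by move=> x0 x1; rewrite -artanh0 artanh_le//; lra. Qed.

Lemma artanh_ub x : 0 <= x -> x < 1 -> artanh x <= x / (1 - x).
Proof.
move=> x0 x1; rewrite /artanh ler_pdivrMr//.
have -> : (1 + x) / (1 - x) = 1 + x / (1 - x) * 2 by field; rewrite subr_eq0 gt_eqF.
by apply: le_ln1Dx; have : 0 <= x / (1 - x); [rewrite divr_ge0// subr_ge0 ltW|lra].
Qed.

Lemma artanhB s t : 0 <= s -> s <= t -> t < 1 ->
  artanh t - artanh s = artanh ((t - s) / (1 - s * t)).
Proof.
move=> s0 st t1.
have st1 : 0 < 1 - s * t by nra.
have s1 : 0 < 1 - s by lra.
have t1' : 0 < 1 - t by lra.
rewrite /artanh -mulrBl -ln_div ?posrE ?artanh_arg//; [|lra..].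
congr (ln _ / _); field.
have ? : 0 < 1 - s * t - (t - s) by nra.
by rewrite !gt_eqF//=; lra.
Qed.

Lemma artanh_lb x : 0 <= x -> x < 1 -> x <= artanh x.
Proof.
move=> x0 x1.
have lb y : 0 <= y -> y < 1 -> y / (1 + y) <= artanh y.
  move=> y0 y1; rewrite /artanh ler_pdivlMr//.
  have w0 : 0 < (1 - y) / (1 + y) by rewrite divr_gt0; lra.
  rewrite -[(1 + y) / _]invf_div lnV ?posrE// lerNr.
  have -> : (1 - y) / (1 + y) = 1 + - (y / (1 + y) * 2).
    by field; rewrite gt_eqF//; lra.
  apply: le_ln1Dx; rewrite ltrN2.
  by rewrite mulrAC ltr_pdivrMr; lra.
apply/ler_addgt0Pr => e e0.
(* The bound [y / (1 + y) <= artanh y] is exact to first order, so by the addition formula [artanhB]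
   it sums over a fine subdivision of [[0, x]] to the sharp bound, up to [e]. *)
pose P s t := t - s <= artanh t - artanh s + e * (t - s).
suff : P 0 x by rewrite /P artanh0 !subr0 => /le_trans; apply; nra.
apply: (@cousin P) => //.
  by move=> s t u _ _ _ _; rewrite /P; lra.
move=> u u0 ux; exists (e * (1 - x)); first by rewrite mulr_gt0// subr_gt0.
move=> s t s0 su ut tx tsd; rewrite /P artanhB//; [|lra..].
set y := (t - s) / (1 - s * t).
have st1 : 0 < 1 - s * t by nra.
have stx : 1 - x <= 1 - s * t by nra.
have y0 : 0 <= y by rewrite divr_ge0 ?(ltW st1)// subr_ge0; lra.
have ts0 : 0 <= t - s by lra.
have t0 : 0 <= t by lra.
have st0 : 0 <= s * t by exact: mulr_ge0.
have yts : t - s <= y by rewrite ler_pdivlMr// ler_piMr//; lra.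
have ye : y < e.
  by rewrite ltr_pdivrMr// (lt_le_trans tsd)// ler_wpM2l// ltW.
have y1 : y < 1.
  have : 0 < (1 - t) * (1 + s) by rewrite mulr_gt0; lra.
  by rewrite ltr_pdivrMr//; lra.
apply: le_trans (lerD (lb _ y0 y1) (lexx _)).
have y1' : 0 < 1 + y by lra.
rewrite -lerBlDr ler_pdivlMr//.
have -> : (t - s - e * (t - s)) * (1 + y) = (t - s) * (1 + y - e - e * y) by ring.
have : (t - s) * (1 + y - e - e * y) <= (t - s) * 1.
  by rewrite ler_wpM2l//; have := mulr_ge0 (ltW e0) y0; lra.
lra.
Qed.

End RealLemmas.

Section Chains.
Context {R : realType} {T : Type}.
Variable step : T -> T -> R -> Prop.

Inductive chain : T -> T -> R -> Prop :=
| chain_nil x : chain x x 0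
| chain_rcons x y z L a : chain x y L -> step y z a -> chain x z (L + a).

Lemma chain_trans x y z L L' : chain x y L -> chain y z L' -> chain x z (L + L').
Proof.
move=> h h'; elim: h' h => [w h|u v w L1 a _ IH s h]; first by rewrite addr0.
by rewrite addrA; apply: (chain_rcons (IH h) s).
Qed.

Lemma chain1 x y a : step x y a -> chain x y a.
Proof. by move=> s; rewrite -[a]add0r; apply: chain_rcons s; exact: chain_nil. Qed.

Lemma chain_sym : (forall x y a, step x y a -> step y x a) ->
  forall x y L, chain x y L -> chain y x L.
Proof.
move=> sym x y L; elim=> [w|u v w L1 a _ IH s]; first exact: chain_nil.
by rewrite addrC; apply: chain_trans IH; apply: chain1; exact: sym.
Qed.

Lemma chain_ge0 : (forall x y a, step x y a -> 0 <= a) ->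
  forall x y L, chain x y L -> 0 <= L.
Proof.
by move=> pos x y L; elim=> // u v w L1 a _ IH s; rewrite addr_ge0// (pos _ _ _ s).
Qed.

Lemma chain_seq x y L : chain x y L -> exists (N : nat) (z : nat -> T) (a : nat -> R),
  [/\ z 0%N = x, z N = y, L = \sum_(0 <= i < N) a i &
      forall i, (i < N)%N -> step (z i) (z i.+1) (a i)].
Proof.
elim=> [w|u v w L1 b _ [N [z [a [z0 zN LE st]]]] s].
  by exists 0%N, (fun=> w), (fun=> 0); split => //; rewrite big_geq.
exists N.+1, (fun i => if (i <= N)%N then z i else w), (fun i => if (i < N)%N then a i else b).
split => //; first by rewrite ltnn.
  rewrite big_nat_recr//= ltnn LE; congr (_ + _).
  by apply: eq_big_nat => i /andP[_ ->].
move=> i iN.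
case: (ltngtP i N) => [iN'|Ni|->]; first exact: st.
  by move: iN; rewrite ltnS leqNgt Ni.
by rewrite zN.
Qed.

End Chains.

Section WeightedSums.
Context {R : realType}.
Implicit Types (a m : nat -> R) (A B : R) (N : nat).

(* The integral of [exp (2 / A * (B - s))] over [s >= 0], of which the weighted
   sums below are lower sums. *)
Definition wsum_bound A B : R := A / 2 * expR (2 / A * B).

Lemma wsum_fwd a m N A B : 0 < A ->
  (forall j, (j < N)%N -> 0 <= a j) ->
  (forall j, (j < N)%N -> \sum_(0 <= l < j.+1) a l <= A * m j + B) ->
  \sum_(0 <= j < N) a j * expR (- (2 * m j)) <= wsum_bound A B.
Proof.
move=> A0 a0 h; set K := wsum_bound A B.
have K0 : 0 <= K by rewrite mulr_ge0 ?expR_ge0// divr_ge0// ltW.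
(* Strengthened for the induction: the new right-hand side is the integral from 0 to the total of
   the [a j] only. *)
suff : \sum_(0 <= j < N) a j * expR (- (2 * m j)) <=
    K * (1 - expR (- (2 / A * \sum_(0 <= j < N) a j))).
  move=> /le_trans; apply.
  by rewrite ler_piMr// lerBlDr lerDl expR_ge0.
elim: N a0 h => [|N IH] a0 h.
  by rewrite !big_geq// mulr0 oppr0 expR0 subrr mulr0.
rewrite big_nat_recr//=.
apply: le_trans (lerD (IH _ _) (lexx _)) _.
- by move=> j jN; apply: a0; exact: ltnW.
- by move=> j jN; apply: h; exact: ltnW.
have hN := h N (ltnSn N).
have aN := a0 N (ltnSn N).
rewrite big_nat_recr//= in hN *.
set S := \sum_(0 <= j < N) a j in hN *.
set c := 2 / A.
have c0 : 0 < c by rewrite divr_gt0.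
have cA : c * A = 2 by rewrite /c divfK// gt_eqF.
have e1 : expR (- (2 * m N)) <= expR (c * B) * expR (- (c * (S + a N))).
  rewrite -expRD ler_expR.
  by have := ler_wpM2l (ltW c0) hN; rewrite [c * (A * _ + _)]mulrDr mulrA cA; lra.
have e2 : expR (- (c * S)) = expR (- (c * (S + a N))) * expR (c * a N).
  by rewrite -expRD; congr expR; ring.
have e3 : 1 + c * a N <= expR (c * a N) by exact: expR_ge1Dx.
have KE : K = c^-1 * expR (c * B) by rewrite /K /wsum_bound /c invf_div.
rewrite e2 KE; set E := expR (- (c * (S + a N))) in e1 *.
set F := expR (c * B) in e1 *; set G := expR (c * a N) in e3 *.
have E0 : 0 <= E by exact: expR_ge0.
have F0 : 0 <= F by exact: expR_ge0.
have : a N * expR (- (2 * m N)) <= a N * (F * E) by rewrite ler_wpM2l.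
suff : a N * (F * E) <= c^-1 * F * (E * (G - 1)) by nra.
rewrite [leLHS](_ : _ = c^-1 * F * (E * (c * a N))); last first.
  by field; rewrite gt_eqF.
by rewrite ler_wpM2l ?mulr_ge0 ?invr_ge0 ?(ltW c0)// ler_wpM2l//; lra.
Qed.

Lemma wsum_bwd a m N A B : 0 < A ->
  (forall j, (j < N)%N -> 0 <= a j) ->
  (forall j, (j < N)%N -> \sum_(j <= l < N) a l <= A * m j + B) ->
  \sum_(0 <= j < N) a j * expR (- (2 * m j)) <= wsum_bound A B.
Proof.
move=> A0 a0 h; rewrite big_nat_rev/= add0n.
apply: (@wsum_fwd (fun j => a (N - j.+1)%N) (fun j => m (N - j.+1)%N)) => //.
  by move=> j jN; apply: a0; rewrite ltn_subrL /=; case: (N) jN.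
move=> j jN; have jN' : (N - j.+1 < N)%N by rewrite ltn_subrL /=; case: (N) jN.
apply: le_trans (h _ jN'); rewrite le_eqVlt; apply/orP; left; apply/eqP.
rewrite -{1}[(N - j.+1)%N]add0n big_addn subKn// [RHS]big_nat_rev /=; apply: eq_big_nat => i /andP[_ ij].
congr a; lia.
Qed.

(* Cut at an index minimizing [m]. *)
Lemma wsum2 a m N A B : 0 < A ->
  (forall j, (j < N)%N -> 0 <= a j) ->
  (forall i j, (i <= j)%N -> (j < N)%N ->
     \sum_(i <= l < j.+1) a l <= A * (m i + m j) + B) ->
  \sum_(0 <= j < N) a j * expR (- (2 * m j)) <= 2 * wsum_bound (2 * A) B.
Proof.
move=> A0 a0 h.
case: N => [|N] in a0 h *.
  by rewrite big_geq// /wsum_bound !mulr_ge0 ?expR_ge0 ?invr_ge0// ltW.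
have [i0 i0N mi0] : exists2 i0, (i0 < N.+1)%N & forall j, (j < N.+1)%N -> m i0 <= m j.
  case: (@arg_minP _ _ _ (@ord0 N) xpredT (fun i : 'I_N.+1 => m i) isT) => i _ hi.
  by exists i => [|j jN]; [exact: ltn_ord | exact: (hi (Ordinal jN))].
rewrite (big_cat_nat (n := i0))//=; last exact: ltnW.
rewrite mulr_natl mulr2n lerD//.
  apply: wsum_bwd; first lra.
    by move=> j ji; apply: a0; exact: ltn_trans i0N.
  move=> j ji.
  have jN : (j < N.+1)%N by exact: ltn_trans i0N.
  apply: (@le_trans _ _ (\sum_(j <= l < i0.+1) a l)).
    by rewrite [leRHS]big_nat_recr/= ?lerDl ?a0// ltnW.
  (* By the choice of [i0], [m j + m i0 <= 2 * m j]; hence the constant [2 * A]. *)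
  apply: le_trans (h j i0 (ltnW ji) i0N) _.
  have := mi0 j jN; nra.
rewrite -{1}[i0]add0n big_addn.
apply: (@wsum_fwd (fun l => a (l + i0)%N) (fun l => m (l + i0)%N)); first lra.
  by move=> j ji; apply: a0; lia.
move=> j ji.
have jN : (j + i0 < N.+1)%N by lia.
have -> : \sum_(0 <= l < j.+1) a (l + i0)%N = \sum_(i0 <= l < (j + i0).+1) a l.
  by rewrite -[X in _ = \sum_(X <= _ < _) _]add0n big_addn -addSn addnK.
apply: le_trans (h i0 (j + i0)%N _ jN) _; first by lia.
have := mi0 _ jN; nra.
Qed.

End WeightedSums.

(** * Complex derivatives *)

Section Modulus.
Context {R : realType}.
Local Notation C := (Cplx R).
Implicit Types (z w h : C) (x y r : R).

Lemma modulusE z : modulus z = nrm z. Proof. by []. Qed.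

Lemma modulus_norm z : `|z| = (modulus z)%:C.
Proof. exact: nrmE. Qed.

Lemma modulus_ge0 z : 0 <= modulus z. Proof. exact: (nrm_ge0 (z : C)). Qed.

Lemma modulus0 : modulus (0 : C) = 0. Proof. by rewrite /modulus normr0. Qed.

Lemma modulus_eq0 z : (modulus z == 0) = (z == 0).
Proof.
by rewrite -(@normr_eq0 _ _ z) modulus_norm -(rmorph0 (real_complex R)) (inj_eq (fmorph_inj _)).
Qed.

Lemma modulus_gt0 z : (0 < modulus z) = (z != 0).
Proof. by rewrite lt_def modulus_ge0 andbT modulus_eq0. Qed.

Lemma modulusM z w : modulus (z * w) = modulus z * modulus w.
Proof. exact: (nrmZ z w). Qed.

Lemma modulus1 : modulus (1 : C) = 1.
Proof. by rewrite /modulus normr1. Qed.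

Lemma modulusV z : modulus z^-1 = (modulus z)^-1.
Proof.
have [->|z0] := eqVneq z 0; first by rewrite invr0 modulus0 invr0.
have m0 : modulus z != 0 by rewrite modulus_eq0.
by apply: (mulfI m0); rewrite -modulusM !divff// modulus1.
Qed.

Lemma modulusR x : modulus (x%:C : C) = `|x|.
Proof. by rewrite /modulus normc_def /= expr0n addr0 sqrtr_sqr. Qed.

Lemma modulusi : modulus ('i : C) = 1.
Proof. by rewrite /modulus normc_def /= expr0n expr1n add0r sqrtr1. Qed.

Lemma modulusN z : modulus (- z) = modulus z. Proof. exact: (nrmN (z : C)). Qed.

Lemma modulusB z w : modulus (z - w) = modulus (w - z). Proof. exact: (nrmB (z : C) (w : C)). Qed.

Lemma modulusD z w : modulus (z + w) <= modulus z + modulus w.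
Proof. exact: (nrmD (z : C) (w : C)). Qed.

Lemma modulus_Re z : `|complex.Re z| <= modulus z.
Proof. by rewrite -lecR -modulus_norm normc_ge_Re. Qed.

Lemma modulus_Im z : `|complex.Im z| <= modulus z.
Proof.
rewrite /modulus normc_def /= -sqrtr_sqr ler_wsqrtr// lerDr; exact: sqr_ge0.
Qed.

Lemma modulus_le z : modulus z <= `|complex.Re z| + `|complex.Im z|.
Proof.
have {1}-> : z = (complex.Re z)%:C + 'i * (complex.Im z)%:C by rewrite -complexE.
by apply: le_trans (modulusD _ _) _; rewrite modulusM modulusi mul1r !modulusR.
Qed.

Lemma modulus2 : modulus (2 : C) = 2.
Proof.
have -> : (2 : C) = (2 : R)%:C by rewrite (rmorph_nat (real_complex R) 2).
by rewrite modulusR ger0_norm.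
Qed.

Lemma modulus_half z : modulus (z / 2) = modulus z / 2.
Proof. by rewrite modulusM modulusV modulus2. Qed.

Lemma unit_discE z : unit_disc z <-> modulus z < 1.
Proof. by rewrite /unit_disc /= modulus_norm ltcR. Qed.

Lemma cball_compact r : compact [set z : C | modulus z <= r].
Proof.
pose f (u : R * R) : C := u.1%:C + 'i * u.2%:C.
have cf : continuous f.
  move=> u; apply/cvgrPdist_lt => e e0.
  have eR : (complex.Re e)%:C = e by rewrite RRe_real // gtr0_real.
  have e0' : 0 < complex.Re e / 2 by rewrite divr_gt0// -ltcR eR.
  exists (ball u.1 (complex.Re e / 2), ball u.2 (complex.Re e / 2)) => /=.
    by split; exact: nbhsx_ballx.
  move=> [x y] /= [bx by_]; rewrite -eR modulus_norm ltcR.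
  have -> : f u - f (x, y) = (u.1 - x)%:C + 'i * (u.2 - y)%:C.
    by rewrite /f /= !rmorphB /=; ring.
  apply: le_lt_trans (modulusD _ _) _; rewrite modulusM modulusi mul1r !modulusR.
  by rewrite [ltRHS](splitr (complex.Re e)) ltrD.
have cS : compact (`[- r, r]%classic `*` `[- r, r]%classic : set (R * R)).
  by apply: compact_setX; exact: segment_compact.
have cI : compact (f @` (`[- r, r]%classic `*` `[- r, r]%classic)).
  by apply: continuous_compact => //; exact: continuous_subspaceT.
apply: (subclosed_compact _ cI).
  move=> z /closure_nrm cz /=; apply/ler_addgt0Pr => e e0.
  have [w /= wr wz] := cz e e0.
  rewrite -[z](subKr w) (le_trans (modulusD _ _))// modulusN.
  by rewrite lerD// ltW.
move=> z /= zr; exists (complex.Re z, complex.Im z); last by rewrite /f /= -complexE.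
split; rewrite /= in_itv /= -ler_norml; apply: le_trans zr;
  [exact: modulus_Re | exact: modulus_Im].
Qed.

End Modulus.

Section ComplexDerivative.
Context {R : realType} {V : normedModType (Cplx R)}.
Local Notation C := (Cplx R).
Implicit Types (f : C -> V) (z h : C) (L : V).

(** The derivative in increment form, with real-valued norms and no division by [h]: the rules of
    calculus then reduce to linear inequalities. *)
Definition cder f z L := forall e : R, 0 < e -> exists2 d : R, 0 < d &
  forall h, modulus h < d -> nrm (f (z + h) - f z - h *: L) <= e * modulus h.

Lemma derivable_cder f z : derivable f z 1 -> cder f z (derive1 f z).
Proof.
move=> df e e0.
have : (fun h => h^-1 *: (f (h + z) - f z)) @ (0 : C)^' --> derive1 f z.
  rewrite derive1E; move/derivableP : df => -[df _].
  by apply: cvg_trans df; apply: near_eq_cvg; near=> h; rewrite /= scaler1.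
move=> /cvgrPdist_le /(_ e%:C); rewrite ltcR => /(_ e0).
rewrite near_withinE => /nbhs_nrm[d d0 hd].
exists d => // h hh.
have [->|h0] := eqVneq h 0.
  by rewrite addr0 subrr scale0r subrr nrm0 modulus0 mulr0.
have := hd h; rewrite subr0 => /(_ hh h0).
rewrite nrm_leE => H.
have -> : f (z + h) - f z - h *: derive1 f z =
    - (h *: (derive1 f z - h^-1 *: (f (h + z) - f z))).
  by rewrite scalerBr scalerA divff// scale1r opprB (addrC h).
by rewrite nrmN nrmZ mulrC ler_wpM2r// modulus_ge0.
Unshelve. all: by end_near. Qed.

Lemma cder_cvg f z L : cder f z L ->
  (fun h => h^-1 *: (f (h + z) - f z)) @ (0 : C)^' --> L.
Proof.
move=> df; apply/cvgrPdist_le => e e0.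
have eR : (complex.Re e)%:C = e by rewrite RRe_real // gtr0_real.
have e0' : 0 < complex.Re e by rewrite -ltcR eR.
have [d d0 hd] := df _ e0'.
rewrite near_withinE; apply/nbhs_nrm; exists d => // h; rewrite subr0 => hh h0.
rewrite -eR nrm_leE -(@ler_pM2l _ (modulus h)) ?modulus_gt0// -nrmZ.
rewrite mulrC; apply: le_trans (hd h hh); rewrite -nrmN.
by rewrite scalerBr scalerA divff// scale1r opprB (addrC h).
Qed.

Lemma cder_derivable f z L : cder f z L -> derivable f z 1.
Proof.
move=> /cder_cvg df; apply/cvg_ex; exists L.
by apply: cvg_trans df; apply: near_eq_cvg; near=> h; rewrite /= scaler1.
Unshelve. all: by end_near. Qed.

Lemma cder_derive1 f z L : cder f z L -> derive1 f z = L.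
Proof. by move=> /cder_cvg df; rewrite /derive1; apply/cvg_lim. Qed.

Lemma cder_cont f z L : cder f z L -> forall e : R, 0 < e -> exists2 d : R, 0 < d &
  forall w, modulus (w - z) < d -> nrm (f w - f z) < e.
Proof.
move=> df e e0; have [d d0 hd] := df 1 ltr01.
have K0 : 0 < 1 + nrm L by rewrite ltr_wpDr// nrm_ge0.
exists (Num.min d (e / (1 + nrm L))); first by rewrite lt_min d0 divr_gt0.
move=> w; rewrite lt_min => /andP[wd we].
have := hd _ wd; rewrite subrKC mul1r => H.
have -> : f w - f z = (f w - f z - (w - z) *: L) + (w - z) *: L by rewrite subrK.
apply: le_lt_trans (nrmD _ _) _; rewrite nrmZ.
apply: (@le_lt_trans _ _ (modulus (w - z) * (1 + nrm L))).
  by rewrite mulrDr mulr1 lerD2r.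
by rewrite -ltr_pdivlMr.
Qed.

Lemma cderD f g z L M : cder f z L -> cder g z M -> cder (f \+ g) z (L + M).
Proof.
move=> df dg e e0; have e2 : 0 < e / 2 by rewrite divr_gt0.
have [d d0 hd] := df _ e2; have [c c0 hc] := dg _ e2.
exists (Num.min d c); first by rewrite lt_min d0.
move=> h; rewrite lt_min => /andP[h1 h2] /=.
have -> : f (z + h) + g (z + h) - (f z + g z) - h *: (L + M) =
  (f (z + h) - f z - h *: L) + (g (z + h) - g z - h *: M).
  by rewrite scalerDr !opprD (addrACA (f (z + h))) (addrACA (f (z + h) - f z)).
apply: le_trans (nrmD _ _) _; rewrite [e](splitr e) mulrDl lerD//; [exact: hd|exact: hc].
Qed.

Lemma cder_affine (a w : V) z : cder (fun u => a + u *: w) z w.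
Proof.
move=> e e0; exists 1 => // h _.
rewrite scalerDl addrA (addrC (a + _)) addrK subrr nrm0.
by rewrite mulr_ge0 ?modulus_ge0// ltW.
Qed.

Lemma cder_comp f (g : C -> C) z (a : C) L :
  (forall e : R, 0 < e -> exists2 d : R, 0 < d &
    forall h, modulus h < d -> modulus (g (z + h) - g z - h * a) <= e * modulus h) ->
  cder f (g z) L -> cder (f \o g) z (a *: L).
Proof.
move=> dg df e e0.
set K := 1 + modulus a; have K0 : 0 < K by rewrite ltr_wpDr// modulus_ge0.
set M := 1 + nrm L; have M0 : 0 < M by rewrite ltr_wpDr// nrm_ge0.
have e1 : 0 < e / 2 / K by rewrite !divr_gt0.
have e2 : 0 < e / 2 / M by rewrite !divr_gt0.
have [d d0 hd] := df _ e1.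
have [c c0 hc] := dg _ e2; have [c' c'0 hc'] := dg _ ltr01.
exists (Num.min (Num.min c c') (d / K)); first by rewrite !lt_min c0 c'0 divr_gt0.
move=> h; rewrite !lt_min => /andP[/andP[h1 h1'] h2] /=.
have gK : modulus (g (z + h) - g z) <= modulus h * K.
  have -> : g (z + h) - g z = (g (z + h) - g z - h * a) + h * a by rewrite subrK.
  apply: le_trans (modulusD _ _) _; rewrite modulusM mulrDr mulr1.
  by rewrite lerD2r -[leRHS]mul1r hc'.
have gd : modulus (g (z + h) - g z) < d by rewrite (le_lt_trans gK)// -ltr_pdivlMr.
have := hd _ gd; rewrite subrKC => H.
have -> : f (g (z + h)) - f (g z) - h *: (a *: L) =
  (f (g (z + h)) - f (g z) - (g (z + h) - g z) *: L) + (g (z + h) - g z - h * a) *: L.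
  by rewrite (scalerBl _ (h * a)) addrA subrK scalerA.
apply: le_trans (nrmD _ _) _; rewrite [leRHS](splitr (e * modulus h)) lerD//.
  apply: le_trans H _; apply: le_trans (ler_wpM2l (ltW e1) gK) _.
  rewrite mulrCA mulrA -mulrA; rewrite [leLHS](_ : _ = e * modulus h / 2) //.
  by field; rewrite gt_eqF.
rewrite nrmZ; apply: (@le_trans _ _ (e / 2 / M * modulus h * M)).
  by rewrite ler_pM ?modulus_ge0 ?nrm_ge0 ?hc// /M lerDr.
by rewrite [leLHS](_ : _ = e * modulus h / 2) //; field; rewrite gt_eqF.
Qed.

End ComplexDerivative.

(** * Cauchy's estimate *)

Section Goursat.
Context {R : realType}.
Local Notation C := (Cplx R).
Implicit Types (f g : C -> C) (a b c z w : C) (S : set C).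

(* Trapezoid sums stand for line integrals: refining once, the sum over the
   boundary of a triangle is exactly that over its four midpoint triangles. *)
Fixpoint trap (n : nat) f a b : C :=
  if n is m.+1 then trap m f a ((a + b) / 2) + trap m f ((a + b) / 2) b
  else (f a + f b) / 2 * (b - a).

Lemma two_neq0 : (2 : C) != 0.
Proof. by rewrite pnatr_eq0. Qed.

Lemma trap_antisym n f a b : trap n f b a = - trap n f a b.
Proof.
elim: n a b => [|n IH] a b /=; first by ring.
by rewrite (addrC b a) (IH ((a + b) / 2) b) (IH a ((a + b) / 2)) opprD addrC.
Qed.

Lemma trapD n f g a b : trap n (f \+ g) a b = trap n f a b + trap n g a b.
Proof. by elim: n a b => [|n IH] a b /=; [ring | rewrite !IH addrACA]. Qed.

Lemma eq_trap n f g a b : f =1 g -> trap n f a b = trap n g a b.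
Proof. by move=> fg; elim: n a b => [|n IH] a b /=; rewrite ?fg ?IH. Qed.

(** The trapezoid rule is exact on affine functions, so their sums around a triangle vanish. This
    plays the part of a primitive in the proof for triangles. *)
Lemma trap_affine n A B a b :
  trap n (fun z => A + B * z) a b = A * (b - a) + B * (b ^+ 2 - a ^+ 2) / 2.
Proof.
have t0 := two_neq0.
by elim: n a b => [|n IH] a b /=; rewrite ?IH; field.
Qed.

Lemma trap_mul n f a b (u : C) : trap n (fun z => u * f z) a b = u * trap n f a b.
Proof. by elim: n a b => [|n IH] a b /=; [ring | rewrite !IH mulrDr]. Qed.

Lemma trap_rot n f a b (u : C) : (forall z, f (u * z) * u = f z) ->
  trap n f (u * a) (u * b) = trap n f a b.
Proof.
move=> fu; elim: n a b => [|n IH] a b /=.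
  by rewrite -(fu a) -(fu b); ring.
by rewrite -mulrDr -mulrA !IH.
Qed.

(** All nodes arise from the two ends by taking midpoints, so a midpoint-closed set [P] contains
    them. *)
Lemma trap_le n f a b (P : set C) (E : R) : 0 <= E ->
  (forall z w, P z -> P w -> P ((z + w) / 2)) -> P a -> P b ->
  (forall z, P z -> modulus (f z) <= E) ->
  modulus (trap n f a b) <= E * modulus (b - a).
Proof.
move=> E0 Pm Pa Pb fE; have t0 := two_neq0.
elim: n a b Pa Pb => [|n IH] a b Pa Pb /=.
  rewrite modulusM ler_wpM2r ?modulus_ge0// modulus_half ler_pdivrMr//.
  by apply: le_trans (modulusD _ _) _; have := fE _ Pa; have := fE _ Pb; lra.
have Pab := Pm _ _ Pa Pb.
apply: le_trans (modulusD _ _) _; apply: le_trans (lerD (IH _ _ Pa Pab) (IH _ _ Pab Pb)) _.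
have -> : (a + b) / 2 - a = (b - a) / 2 by field.
have -> : b - (a + b) / 2 = (b - a) / 2 by field.
rewrite modulus_half; lra.
Qed.

Definition tri n f (T : C * C * C) : C :=
  trap n f T.1.1 T.1.2 + trap n f T.1.2 T.2 + trap n f T.2 T.1.1.

Definition per (T : C * C * C) : R :=
  modulus (T.1.2 - T.1.1) + modulus (T.2 - T.1.2) + modulus (T.1.1 - T.2).

Definition mid1 (T : C * C * C) := (T.1.1, (T.1.1 + T.1.2) / 2, (T.2 + T.1.1) / 2).
Definition mid2 (T : C * C * C) := ((T.1.1 + T.1.2) / 2, T.1.2, (T.1.2 + T.2) / 2).
Definition mid3 (T : C * C * C) := ((T.2 + T.1.1) / 2, (T.1.2 + T.2) / 2, T.2).
Definition mid4 (T : C * C * C) :=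
  ((T.1.1 + T.1.2) / 2, (T.1.2 + T.2) / 2, (T.2 + T.1.1) / 2).

Definition mids (T : C * C * C) := [:: mid1 T; mid2 T; mid3 T; mid4 T].

Lemma tri_mids n f T : tri n.+1 f T =
  tri n f (mid1 T) + tri n f (mid2 T) + tri n f (mid3 T) + tri n f (mid4 T).
Proof.
case: T => -[a b] c; rewrite /tri /=.
set x := (a + b) / 2; set y := (b + c) / 2; set z := (c + a) / 2.
rewrite (trap_antisym n f z x) (trap_antisym n f x y) (trap_antisym n f y z).
ring.
Qed.

Lemma per_ge0 T : 0 <= per T.
Proof. by rewrite /per !addr_ge0//; exact: modulus_ge0. Qed.

Lemma mids_prop T T' : T' \in mids T ->
  per T' = per T / 2 /\ modulus (T'.1.1 - T.1.1) <= per T.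
Proof.
have t0 := two_neq0.
case: T => -[a b] c; rewrite !inE /per => H.
have m1 : modulus (a - b) = modulus (b - a) by exact: modulusB.
have m2 : modulus (b - c) = modulus (c - b) by exact: modulusB.
have m3 : modulus (c - a) = modulus (a - c) by exact: modulusB.
have [p1 p2 p3] : [/\ 0 <= modulus (b - a), 0 <= modulus (c - b) & 0 <= modulus (a - c)].
  by rewrite !modulus_ge0.
case/or4P: H => /eqP -> /=.
- have -> : (a + b) / 2 - a = (b - a) / 2 by field.
  have -> : (c + a) / 2 - (a + b) / 2 = (c - b) / 2 by field.
  have -> : a - (c + a) / 2 = (a - c) / 2 by field.
  by rewrite !modulus_half subrr modulus0; split; lra.
- have -> : b - (a + b) / 2 = (b - a) / 2 by field.
  have -> : (b + c) / 2 - b = (c - b) / 2 by field.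
  have -> : (a + b) / 2 - (b + c) / 2 = (a - c) / 2 by field.
  have -> : (a + b) / 2 - a = (b - a) / 2 by field.
  by rewrite !modulus_half; split; lra.
- have -> : (b + c) / 2 - (c + a) / 2 = (b - a) / 2 by field.
  have -> : c - (b + c) / 2 = (c - b) / 2 by field.
  have -> : (c + a) / 2 - c = (a - c) / 2 by field.
  have -> : (c + a) / 2 - a = (c - a) / 2 by field.
  by rewrite !modulus_half; split; lra.
have -> : (b + c) / 2 - (a + b) / 2 = (c - a) / 2 by field.
have -> : (c + a) / 2 - (b + c) / 2 = (a - b) / 2 by field.
have -> : (a + b) / 2 - (c + a) / 2 = (b - c) / 2 by field.
have -> : (a + b) / 2 - a = (b - a) / 2 by field.
by rewrite !modulus_half; split; lra.
Qed.

Definition vert_in S (T : C * C * C) := [/\ S T.1.1, S T.1.2 & S T.2].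

(** In each coordinate the supremum of the lower bounds [r k - d k] is within [d k] of [r k]; the
    factor 2 comes from adding the real and imaginary parts. *)
Lemma nested_limit (a : nat -> C) (d : nat -> R) :
  (forall j k, (k <= j)%N -> modulus (a j - a k) <= d k) ->
  (forall j k, (k <= j)%N -> d j <= d k) ->
  exists z, forall k, modulus (z - a k) <= 2 * d k.
Proof.
move=> ad dd.
have lim (r : nat -> R) : (forall j k, (k <= j)%N -> `|r j - r k| <= d k) ->
    exists x, forall k, `|x - r k| <= d k.
  move=> rd; pose E := [set x | exists k, x = r k - d k].
  have ub k : ubound E (r k + d k).
    move=> _ [j ->]; case: (leqP k j) => kj.
      have d0 : 0 <= d j by apply: le_trans (rd j j _); rewrite ?leqnn.
      by have := rd _ _ kj; rewrite ler_norml => /andP[_]; lra.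
    have d0 : 0 <= d k by apply: le_trans (rd k k _); rewrite ?leqnn.
    by have := rd _ _ (ltnW kj); rewrite ler_norml => /andP[+ _]; lra.
  exists (sup E) => k; rewrite ler_norml.
  have h1 : r k - d k <= sup E.
    by apply: ub_le_sup; [exists (r 0%N + d 0%N); exact: ub | exists k].
  have h2 : sup E <= r k + d k.
    by apply: ge_sup; [exists (r k - d k), k | exact: ub].
  by apply/andP; split; lra.
have [x hx] : exists x, forall k, `|x - complex.Re (a k)| <= d k.
  apply: lim => j k kj; apply: le_trans (ad j k kj).
  by apply: le_trans (modulus_Re _); case: (a j) (a k) => ? ? [].
have [y hy] : exists x, forall k, `|x - complex.Im (a k)| <= d k.
  apply: lim => j k kj; apply: le_trans (ad j k kj).
  by apply: le_trans (modulus_Im _); case: (a j) (a k) => ? ? [].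
exists (Complex x y) => k.
apply: le_trans (modulus_le _) _.
by rewrite mulr_natl mulr2n; case: (a k) (hx k) (hy k) => /= p q h1 h2; rewrite lerD.
Qed.

(** Goursat's bisection. Trapezoid sums need not vanish, so the claim is a bound for all
    sufficiently fine ones. The midpoint triangles have half the perimeter, so their four bounds add
    up to that of the triangle at one more refinement: a bad triangle has a bad midpoint triangle,
    and the nested sequence contradicts differentiability at its limit. *)
Lemma goursat f S T : closed S ->
  (forall z w, S z -> S w -> S ((z + w) / 2)) -> vert_in S T ->
  (forall z, S z -> derivable f z 1) ->
  forall e : R, 0 < e -> exists N, forall n, (N <= n)%N ->
    modulus (tri n f T) <= e * per T ^+ 2.
Proof.
move=> cS Sm ST df e e0.
pose good U := exists N, forall n, (N <= n)%N -> modulus (tri n f U) <= e * per U ^+ 2.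
apply: contrapT => badT.
have step U : ~ good U -> exists2 U', U' \in mids U & ~ good U'.
  move=> bU; apply: contrapT => /forall2NP h; apply: bU.
  have gU U' : U' \in mids U -> good U' by move=> U'U; case: (h U') => // /contrapT.
  have [N1 h1] : good (mid1 U) by apply: gU; rewrite !inE eqxx.
  have [N2 h2] : good (mid2 U) by apply: gU; rewrite !inE eqxx orbT.
  have [N3 h3] : good (mid3 U) by apply: gU; rewrite !inE eqxx !orbT.
  have [N4 h4] : good (mid4 U) by apply: gU; rewrite !inE eqxx !orbT.
  exists (N1 + N2 + N3 + N4).+1 => -[//|n] hn; rewrite tri_mids.
  have {}h1 := h1 n ltac:(lia); have {}h2 := h2 n ltac:(lia).
  have {}h3 := h3 n ltac:(lia); have {}h4 := h4 n ltac:(lia).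
  have pE U' : U' \in mids U -> per U' ^+ 2 = per U ^+ 2 / 4.
    by move=> /mids_prop[-> _]; field.
  rewrite pE ?inE ?eqxx// in h1; rewrite pE ?inE ?eqxx ?orbT// in h2.
  rewrite pE ?inE ?eqxx ?orbT// in h3; rewrite pE ?inE ?eqxx ?orbT// in h4.
  have := modulusD (tri n f (mid1 U) + tri n f (mid2 U) + tri n f (mid3 U)) (tri n f (mid4 U)).
  have := modulusD (tri n f (mid1 U) + tri n f (mid2 U)) (tri n f (mid3 U)).
  have := modulusD (tri n f (mid1 U)) (tri n f (mid2 U)).
  lra.
pose next U := if pselect (~ good U) is left b then sval (cid2 (step U b)) else U.
have nextP U : ~ good U -> next U \in mids U /\ ~ good (next U).
  by move=> b; rewrite /next; case: pselect => // b'; case: cid2.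
pose t k := iter k next T.
have bt k : ~ good (t k) by elim: k => // k IH; have [] := nextP _ IH.
have mt k : t k.+1 \in mids (t k) by have [] := nextP _ (bt k).
have St k : vert_in S (t k).
  elim: k => // k [S1 S2 S3]; move: (mt k); rewrite !inE.
  by move=> /or4P[] /eqP ->; split => //=; exact: Sm.
have pt k : per (t k) = per T / 2 ^+ k.
  elim: k => [|k IH]; first by rewrite expr0 divr1.
  have [-> _] := mids_prop (mt k); rewrite IH exprS; field.
  by rewrite expf_neq0.
have pS k : per (t k.+1) = per (t k) / 2 by have [] := mids_prop (mt k).
have at_ j k : (k <= j)%N -> modulus ((t j).1.1 - (t k).1.1) <= 2 * per (t k) - 2 * per (t j).
  elim: j => [|j IH]; first by rewrite leqn0 => /eqP ->; rewrite !subrr modulus0.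
  rewrite leq_eqVlt => /orP[/eqP ->|]; first by rewrite !subrr modulus0.
  rewrite ltnS => /IH h.
  have [p1 p2] := mids_prop (mt j).
  have -> : (t j.+1).1.1 - (t k).1.1 = ((t j.+1).1.1 - (t j).1.1) + ((t j).1.1 - (t k).1.1).
    by rewrite addrA subrK.
  by apply: le_trans (modulusD _ _) _; rewrite p1; lra.
have [z hz] : exists z, forall k, modulus (z - (t k).1.1) <= 2 * (2 * per (t k)).
  apply: nested_limit => j k kj; have := at_ j k kj; have := per_ge0 (t j).
    by lra.
  have := modulus_ge0 ((t j).1.1 - (t k).1.1); lra.
have small (d : R) : 0 < d -> exists k, per (t k) < d.
  move=> d0; have [k hk] : exists k, per T / d < 2 ^+ k.
    by exists (Num.bound (per T / d)); exact: upper_nthrootP.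
  by exists k; rewrite pt ltr_pdivrMr ?exprn_gt0// mulrC -ltr_pdivrMr.
have Sz : S z.
  apply: cS; apply/closure_nrm => d d0.
  have [k hk] := small (d / 4) ltac:(lra); exists (t k).1.1; first by have [] := St k.
  by have := hz k; rewrite modulusB modulusE; lra.
have e10 : 0 < e / 10 by lra.
have [d d0 hd] := derivable_cder (df z Sz) e10.
have [k hk] := small (d / 5) ltac:(lra).
(* Around a triangle this small the sums of every order satisfy the bound. *)
apply: (bt k); exists 0%N => n _.
set L := derive1 f z in hd.
(* The first vertex is within [4 * per (t k)] of [z] by [hz], hence all three are within
   [5 * per (t k)]. The error of linearization is then at most [e / 10 * (5 * per (t k))], half of
   what is allowed. *)
pose P := [set w : C | modulus (w - z) <= 5 * per (t k)].
have Pm v w : P v -> P w -> P ((v + w) / 2).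
  rewrite /P /= => hv hw.
  have -> : (v + w) / 2 - z = (v - z) / 2 + (w - z) / 2 by have := two_neq0; move=> t0; field.
  by apply: le_trans (modulusD _ _) _; rewrite !modulus_half; lra.
have [Pa Pb Pc] : [/\ P (t k).1.1, P (t k).1.2 & P (t k).2].
  have h1 := hz k; rewrite modulusB in h1.
  have p0 := per_ge0 (t k).
  rewrite /P /=; split; first by lra.
    have -> : (t k).1.2 - z = ((t k).1.2 - (t k).1.1) + ((t k).1.1 - z) by rewrite addrA subrK.
    apply: le_trans (modulusD _ _) _; move: h1; rewrite /per.
    by have := modulus_ge0 ((t k).2 - (t k).1.2); have := modulus_ge0 ((t k).1.1 - (t k).2); lra.
  have -> : (t k).2 - z = ((t k).2 - (t k).1.1) + ((t k).1.1 - z) by rewrite addrA subrK.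
  apply: le_trans (modulusD _ _) _; move: h1; rewrite /per (modulusB (t k).2 (t k).1.1).
  by have := modulus_ge0 ((t k).2 - (t k).1.2); have := modulus_ge0 ((t k).1.2 - (t k).1.1); lra.
pose aff w := (f z - L * z) + L * w.
pose rem w := f w - aff w.
have fE : f =1 aff \+ rem by move=> w /=; rewrite /rem addrC subrK.
have remP w : P w -> modulus (rem w) <= e / 10 * (5 * per (t k)).
  move=> Pw.
  have wd : modulus (w - z) < d by apply: le_lt_trans Pw _; lra.
  have := hd _ wd; rewrite subrKC.
  have -> : f w - f z - (w - z) *: L = rem w.
    by rewrite /rem /aff -[(w - z) *: L]/((w - z) * L); ring.
  move=> /le_trans; apply; rewrite ler_wpM2l//; lra.
have E0 : 0 <= e / 10 * (5 * per (t k)) by rewrite !mulr_ge0 ?per_ge0//; lra.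
have -> : tri n f (t k) = trap n rem (t k).1.1 (t k).1.2 + trap n rem (t k).1.2 (t k).2
    + trap n rem (t k).2 (t k).1.1.
  have affE u v : trap n aff u v = _ := trap_affine n (f z - L * z) L u v.
  have trE u v : trap n f u v = trap n aff u v + trap n rem u v.
    by rewrite -trapD; exact: eq_trap.
  by rewrite /tri !trE !affE; have t0 := two_neq0; field.
have H1 := trap_le n E0 Pm Pa Pb remP.
have H2 := trap_le n E0 Pm Pb Pc remP.
have H3 := trap_le n E0 Pm Pc Pa remP.
apply: le_trans (modulusD _ _) _; apply: le_trans (lerD (modulusD _ _) (lexx _)) _.
apply: le_trans (lerD (lerD H1 H2) H3) _.
rewrite -!mulrDr -/(per (t k)).
have := sqr_ge0 (per (t k)); rewrite expr2.
have := per_ge0 (t k); nra.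
Qed.

End Goursat.

Section CauchyEstimate.
Context {R : realType}.
Local Notation C := (Cplx R).
Implicit Types (f g : C -> C) (z w : C).

(** The point of abscissa [r] on the line of slope [y] through 0; [-1 <= y <= 1] describes the right
    side of the square of half side [r]. *)
Definition vpt (r y : R) : C := Complex r (r * y).

Lemma vpt_mid r y y' : (vpt r y + vpt r y') / 2 = vpt r ((y + y') / 2).
Proof.
have t0 := @two_neq0 R.
apply: (mulIf t0); rewrite divfK// /vpt.
by rewrite mulrDr mulr1; apply/eqP; rewrite eq_complex /=; apply/andP; split; apply/eqP; field.
Qed.

Lemma Re_vptV r y : 0 < r -> -1 <= y -> y <= 1 -> (2 * r)^-1 <= complex.Re (vpt r y)^-1.
Proof.
move=> r0 y0 y1 /=; rewrite invfM ler_pdivlMr; last first.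
  by rewrite ltr_wpDr ?sqr_ge0// exprn_gt0.
rewrite -[leRHS](@mulfK _ (2 * r)) ?mulf_neq0 ?gt_eqF//.
have -> : r * (2 * r) / (2 * r) = 2^-1 / r * (2 * r ^+ 2) by field; rewrite gt_eqF.
rewrite ler_wpM2l ?mulr_ge0 ?invr_ge0 ?(ltW r0)// mulr_natl mulr2n lerD2l exprMn.
by rewrite ler_piMr ?sqr_ge0// expr2; nra.
Qed.

(** On a vertical side [dz = i r dy] and the real part of [1 / z] is at least [1 / (2 r)]. Over the
    whole side the integral is [i pi / 2]; the lower bound 1 obtained here for its imaginary part is
    enough. *)
Lemma Im_trapV n r y y' : 0 < r -> -1 <= y -> y <= y' -> y' <= 1 ->
  (y' - y) / 2 <= complex.Im (trap n (fun z : C => z^-1) (vpt r y) (vpt r y')).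
Proof.
move=> r0; elim: n y y' => [|n IH] y y' h1 h2 h3.
  rewrite /trap.
  have -> : vpt r y' - vpt r y = Complex 0 (r * (y' - y)).
    by apply/eqP; rewrite eq_complex /= subrr mulrBr !eqxx.
  have k1 := Re_vptV r0 h1 (le_trans h2 h3).
  have k2 := Re_vptV r0 (le_trans h1 h2) h3.
  move: k1 k2; set a := (vpt r y)^-1; set b := (vpt r y')^-1.
  have -> : (a + b) / 2 * Complex 0 (r * (y' - y)) = (a + b) * Complex 0 (r * (y' - y) / 2).
    rewrite -mulrA; congr (_ * _); apply: (mulIf (@two_neq0 R)).
    rewrite mulrAC mulVf ?two_neq0// mul1r [RHS]mulr_natr mulr2n.
    by apply/eqP; rewrite eq_complex /=; apply/andP; split; apply/eqP; field.
  rewrite invfM; case: a b => [a a'] [b b'] /= k1 k2.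
  rewrite mulr0 addr0.
  have -> : (y' - y) / 2 = (2^-1 / r + 2^-1 / r) * (r * (y' - y) / 2) by field; rewrite gt_eqF.
  rewrite ler_wpM2r//; last lra.
  by rewrite !mulr_ge0 ?invr_ge0 ?(ltW r0)//; lra.
rewrite /= vpt_mid.
have := IH y ((y + y') / 2) h1 ltac:(lra) ltac:(lra).
have := IH ((y + y') / 2) y' ltac:(lra) ltac:(lra) h3.
rewrite raddfD /=; lra.
Qed.

(* An integral over a square centred at 0 is the integral of [rot4 f] over one of
   its sides, so that a trapezoid avoiding 0 replaces a square annulus. *)
Definition rot4 f z : C := f z - 'i * f ('i * z) - f (- z) + 'i * f (- 'i * z).

Lemma sqri : ('i : C) * 'i = -1.
Proof. by rewrite -expr2 sqr_i. Qed.

Lemma derivable_mul_comp f (a : C) z : derivable f (a * z) 1 -> derivable (fun z => f (a * z)) z 1.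
Proof.
move=> df; apply: (@cder_derivable _ _ _ _ (a *: derive1 f (a * z))).
apply: (@cder_comp _ _ f (fun z => a * z)); last exact: derivable_cder.
move=> e e0; exists 1 => // h _.
rewrite (_ : _ - _ = 0); last by ring.
by rewrite modulus0 mulr_ge0 ?modulus_ge0// ltW.
Qed.

Lemma derivable_sq z : derivable (fun z : C => z ^+ 2) z 1.
Proof.
apply: (@cder_derivable _ _ _ _ (2 * z : C)) => e e0; exists e => // h he.
rewrite (_ : _ - _ - _ = h * h); last by rewrite -[h *: _]/(h * (2 * z)); ring.
by rewrite -modulusE modulusM ler_wpM2r ?modulus_ge0// ltW.
Qed.

Lemma derivable_add f g z : derivable f z 1 -> derivable g z 1 ->
  derivable (fun w => f w + g w) z 1.
Proof.
move=> /derivable_cder df /derivable_cder dg; apply: cder_derivable; exact: cderD df dg.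
Qed.

Lemma derivable_scale_comp f (a b : C) z : derivable f (a * z) 1 ->
  derivable (fun w => b * f (a * w)) z 1.
Proof.
move=> df.
have /derivable_cder dg := derivable_mul_comp df.
apply: (@cder_derivable _ _ _ _ (b * derive1 (fun w => f (a * w)) z : C)).
have b0 : 0 < 1 + modulus b by rewrite ltr_wpDr// modulus_ge0.
move=> e e0; have eb : 0 < e / (1 + modulus b) by rewrite divr_gt0.
have [d d0 hd] := dg _ eb; exists d => // h /hd.
set L := derive1 _ _; rewrite -[h *: L]/(h * L) -[h *: (b * L)]/(h * (b * L)).
rewrite (_ : b * _ - _ - _ = b * (f (a * (z + h)) - f (a * z) - h * L)); last by ring.
rewrite -!modulusE modulusM => H.
apply: le_trans (ler_wpM2l (modulus_ge0 b) H) _.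
rewrite mulrA ler_wpM2r ?modulus_ge0// mulrCA ler_piMr ?(ltW e0)//.
by rewrite ler_pdivrMr// mul1r lerDr.
Qed.

Lemma derivable_rot4 f z : derivable f z 1 -> derivable f ('i * z) 1 ->
  derivable f (- z) 1 -> derivable f (- 'i * z) 1 -> derivable (rot4 f) z 1.
Proof.
move=> d1 d2 d3 d4.
have -> : rot4 f = fun w => (f w + (- 'i) * f ('i * w) + (-1) * f (-1 * w)) + 'i * f (- 'i * w).
  by apply/funext => w; rewrite /rot4 !(mulN1r, mulNr).
have d3' : derivable f (-1 * z) 1 by rewrite mulN1r; exact: d3.
have h2 := derivable_scale_comp (b := - 'i) d2.
have h3 := derivable_scale_comp (b := -1) d3'.
have h4 := derivable_scale_comp (b := 'i) d4.
exact: (derivable_add (derivable_add (derivable_add d1 h2) h3) h4).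
Qed.

Lemma rot4_le f z (r M : R) : (forall w, modulus w <= r -> modulus (f w) <= M) ->
  modulus z <= r -> modulus (rot4 f z) <= 4 * M.
Proof.
move=> fM zr.
have mi w : modulus ('i * w) = modulus w by rewrite modulusM modulusi mul1r.
have mNi w : modulus (- 'i * w) = modulus w by rewrite modulusM modulusN modulusi mul1r.
have h1 := fM z zr.
have h2 : modulus (f ('i * z)) <= M by apply: fM; rewrite mi.
have h3 : modulus (f (- z)) <= M by apply: fM; rewrite modulusN.
have h4 : modulus (f (- 'i * z)) <= M by apply: fM; rewrite mNi.
rewrite /rot4.
have := modulusD (f z - 'i * f ('i * z) - f (- z)) ('i * f (- 'i * z)).
have := modulusD (f z - 'i * f ('i * z)) (- f (- z)).
have := modulusD (f z) (- ('i * f ('i * z))).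
rewrite !modulusN !mi; lra.
Qed.

Lemma Re_half z : complex.Re (z / 2) = complex.Re z / 2.
Proof.
rewrite -{2}[z](divfK two_neq0) mulrDr mulr1.
by case: (z / 2) => x y /=; field.
Qed.

Lemma modulus4 : modulus (4 : C) = 4.
Proof.
have -> : (4 : C) = (4 : R)%:C by rewrite (rmorph_nat (real_complex R) 4).
by rewrite modulusR ger0_norm.
Qed.

Lemma modulus_vptB r : 0 < r -> modulus (vpt r 1 - vpt r (-1)) = 2 * r.
Proof.
move=> r0.
have -> : vpt r 1 - vpt r (-1) = 'i * (2 * r)%:C.
  by apply/eqP; rewrite eq_complex /=; apply/andP; split; apply/eqP; ring.
by rewrite modulusM modulusi mul1r modulusR ger0_norm//; lra.
Qed.

(** The form [f z / z ^+ 2 dz] is summed over two squares around 0, of half sides [r] and [rho],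
    folded onto one quarter by [rot4]. The slanted sides of the resulting trapezoid cancel, the
    outer side contributes at most [8 * M / rho], and the inner one is close to [4 * L] times a
    number of modulus at least 1. *)
Lemma cauchy_derivative f (rho M : R) : 0 < rho ->
  (forall z, modulus z <= 2 * rho -> derivable f z 1) ->
  (forall z, modulus z <= 2 * rho -> modulus (f z) <= M) ->
  modulus (derive1 f 0) <= 2 * M / rho.
Proof.
move=> rho0 df fM.
have M0 : 0 <= M by apply: le_trans (fM 0 _); rewrite ?modulus_ge0// modulus0; lra.
set L := derive1 f 0.
have mi z : modulus ('i * z) = modulus z by rewrite modulusM modulusi mul1r.
have mNi z : modulus (- 'i * z) = modulus z by rewrite modulusM modulusN modulusi mul1r.
have i4 := sqri.
pose H z := rot4 f z / z ^+ 2.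
have Hrot z : H ('i * z) * 'i = H z.
  rewrite /H /rot4 exprMn sqr_i mulN1r invrN mulrN mulNr mulrAC.
  rewrite -mulNr; congr (_ / _).
  rewrite !mulrA mulNr i4 opprK mulN1r -mulNr mul1r.
  rewrite (_ : - ('i * z) = - 'i * z); last by ring.
  ring: i4.
apply/ler_addgt0Pr => e e0.
have e40 : 0 < e / 4 by lra.
have d00 : derivable f 0 1 by apply: df; rewrite modulus0; lra.
have [d d0 hd] := derivable_cder d00 e40.
set r := Num.min (rho / 2) (d / 4).
have r0 : 0 < r by rewrite lt_min !divr_gt0.
have rrho : r <= rho / 2 by rewrite ge_min lexx.
have rd : r <= d / 4 by rewrite ge_min lexx orbT.
pose S : set C := [set z | [/\ r <= complex.Re z, complex.Re z <= rho,
   complex.Im z <= complex.Re z & - complex.Re z <= complex.Im z]].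
pose a := vpt r (-1); pose b := vpt rho (-1); pose c := vpt rho 1; pose a' := vpt r 1.
have S_le z : S z -> modulus z <= 2 * rho.
  move=> [h1 h2 h3 h4]; apply: le_trans (modulus_le _) _.
  have : `|complex.Re z| <= rho by rewrite ler_norml; lra.
  have : `|complex.Im z| <= rho by rewrite ler_norml; lra.
  lra.
have cS : closed S.
  move=> z /closure_nrm cz.
  have cz2 k : 0 < k -> exists w, [/\ S w, `|complex.Re w - complex.Re z| < k / 2
      & `|complex.Im w - complex.Im z| < k / 2].
    move=> k0; have [w Sw wz] := cz (k / 2) ltac:(lra); exists w; split => //.
      by apply: le_lt_trans wz; apply: le_trans (modulus_Re _); case: (w) z {cz} => ? ? [].
    by apply: le_lt_trans wz; apply: le_trans (modulus_Im _); case: (w) z {cz} => ? ? [].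
  by split; apply/ler_addgt0Pr => k /cz2[w [[h1 h2 h3 h4]]];
    rewrite !ltr_norml => /andP[? ?] /andP[? ?]; lra.
have Sm z w : S z -> S w -> S ((z + w) / 2).
  have -> : (z + w) / 2 = Complex ((complex.Re z + complex.Re w) / 2) ((complex.Im z + complex.Im w) / 2).
    apply: (mulIf (@two_neq0 R)); rewrite divfK ?two_neq0// mulrDr mulr1.
    by case: z w => [p q] [p' q']; apply/eqP; rewrite eq_complex /=; apply/andP; split; apply/eqP; field.
  by move=> [? ? ? ?] [? ? ? ?]; split => /=; lra.
have Sa : S a by split => /=; lra.
have Sb : S b by split => /=; lra.
have Sc : S c by split => /=; lra.
have Sa' : S a' by split => /=; lra.
have dH z : S z -> derivable H z 1.
  move=> Sz; have zr := S_le z Sz.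
  have z0 : z != 0 by apply/eqP => z0; case: Sz; rewrite z0 /= => ?; lra.
  apply: derivableM; last first.
    apply: derivableV; first by rewrite expf_neq0.
    exact: derivable_sq.
  by apply: derivable_rot4; apply: df; rewrite ?mi ?mNi ?modulusN.
have mH z : S z -> modulus (H z) <= 4 * M / modulus z ^+ 2.
  move=> Sz; have zr := S_le z Sz; rewrite /H modulusM modulusV.
  have -> : modulus (z ^+ 2) = modulus z ^+ 2 by rewrite !expr2 modulusM.
  rewrite ler_wpM2r ?invr_ge0 ?sqr_ge0//; exact: (rot4_le fM zr).
(* Multiplication by ['i] takes [a] to [a'] and [b] to [c], and leaves [H z dz] invariant. *)
have nab n : trap n H a b + trap n H c a' = 0.
  have -> : c = 'i * b by apply/eqP; rewrite eq_complex /=; apply/andP; split; apply/eqP; ring.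
  have -> : a' = 'i * a by apply/eqP; rewrite eq_complex /=; apply/andP; split; apply/eqP; ring.
  by rewrite (trap_rot n b a Hrot) (trap_antisym n H a b) subrr.
have lim0 (k : R) : 0 < k -> exists n, modulus (trap n H b c - trap n H a a') <= k.
  move=> k0.
  have p0 (T : C * C * C) : 0 < 1 + per T ^+ 2 by rewrite ltr_pwDl// sqr_ge0.
  have k2 (T : C * C * C) : 0 < k / 2 / (1 + per T ^+ 2) by rewrite !divr_gt0.
  have k3 (T : C * C * C) : k / 2 / (1 + per T ^+ 2) * per T ^+ 2 <= k / 2.
    by rewrite -mulrA ler_piMr//; [lra | rewrite mulrC ler_pdivrMr// mul1r lerDr].
  have [N1 h1] := goursat (T := (a, b, c)) cS Sm (And3 Sa Sb Sc) dH
     (k2 (a, b, c)).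
  have [N2 h2] := goursat (T := (a, c, a')) cS Sm (And3 Sa Sc Sa') dH
     (k2 (a, c, a')).
  exists (N1 + N2)%N; set n := (N1 + N2)%N.
  have -> : trap n H b c - trap n H a a' = tri n H (a, b, c) + tri n H (a, c, a').
    rewrite /tri /= (trap_antisym n H a' a) (trap_antisym n H c a).
    have := nab n; move=> /eqP; rewrite addr_eq0 => /eqP ->; ring.
  apply: le_trans (modulusD _ _) _.
  have := le_trans (h1 n (leq_addr _ _)) (k3 _); have := le_trans (h2 n (leq_addl _ _)) (k3 _).
  lra.
have ca : modulus (a' - a) = 2 * r by exact: modulus_vptB.
have cb : modulus (c - b) = 2 * rho by exact: modulus_vptB.
have bc n : modulus (trap n H b c) <= 8 * M / rho.
  have -> : 8 * M / rho = 4 * M / rho ^+ 2 * (2 * rho) by field; rewrite gt_eqF.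
  rewrite -cb; pose P : set C := [set z | S z /\ complex.Re z = rho].
  apply: (@trap_le _ _ _ _ _ P).
  - by rewrite !mulr_ge0 ?invr_ge0 ?sqr_ge0.
  - move=> z w [Sz zr] [Sw wr]; split; first exact: Sm.
    by rewrite Re_half raddfD/= zr wr; lra.
  - by [].
  - by [].
  move=> z [Sz zr]; apply: le_trans (mH z Sz) _; rewrite ler_wpM2l//; first lra.
  have zrho : rho <= modulus z by apply: le_trans (modulus_Re z); rewrite zr ler_norm.
  by rewrite lef_pV2 ?posrE ?exprn_gt0 ?(lt_le_trans rho0)// lerXn2r ?nnegrE ?modulus_ge0// ltW.
have aa n : 4 * modulus L - 2 * e <= modulus (trap n H a a').
  pose P : set C := [set z | S z /\ complex.Re z = r].
  (* [rot4] kills constants and multiplies linear functions by 4, which leaves the main term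
     [4 * L / z]. *)
  pose rem z := f z - f 0 - L * z.
  pose err z := rot4 rem z / z ^+ 2.
  pose main z := 4 * L * z^-1.
  have trE u v : trap n H u v = 4 * L * trap n (fun z => z^-1) u v + trap n err u v.
    rewrite -trap_mul -/main -trapD; apply: eq_trap => z /=.
    rewrite /main /err /H.
    have [->|z0] := eqVneq z 0; first by rewrite expr0n/= invr0 !mulr0 addr0.
    have -> : rot4 f z = 4 * L * z + rot4 rem z.
      by rewrite /rot4 /rem; ring: i4.
    by field.
  have lower : 4 * modulus L <= modulus (4 * L * trap n (fun z => z^-1) a a').
    rewrite !modulusM modulus4 ler_peMr//.
      by rewrite mulr_ge0// modulus_ge0.
    apply: le_trans (modulus_Im _); apply: le_trans (ler_norm _).
    by have := @Im_trapV n r (-1) 1 r0 ltac:(lra) ltac:(lra) ltac:(lra); apply: le_trans; lra.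
  have upper : modulus (trap n err a a') <= 2 * e.
    have -> : 2 * e = e / r * modulus (a' - a) by rewrite ca; field; rewrite gt_eqF.
    apply: (@trap_le _ _ _ _ _ P).
    - by rewrite divr_ge0 ?ltW.
    - move=> z w [Sz zr] [Sw wr]; split; first exact: Sm.
      by rewrite Re_half raddfD/= zr wr; lra.
    - by [].
    - by [].
    move=> z [Sz zr].
    have zrr : r <= modulus z by apply: le_trans (modulus_Re z); rewrite zr ler_norm.
    have z0 : 0 < modulus z by exact: lt_le_trans zrr.
    have zd : modulus z < d.
      apply: le_lt_trans (modulus_le _) _; case: Sz => _ _ k1 k2.
      have : `|complex.Re z| <= r by rewrite ler_norml; lra.
      have : `|complex.Im z| <= r by rewrite ler_norml; lra.
      lra.
    have remz w : modulus w <= modulus z -> modulus (rem w) <= e / 4 * modulus z.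
      move=> wz; have := hd w (le_lt_trans wz zd); rewrite add0r.
      have -> : w *: L = L * w by rewrite mulrC.
      by move=> /le_trans; apply; rewrite ler_wpM2l//; lra.
    have := rot4_le remz (lexx _); rewrite /err modulusM modulusV.
    have -> : modulus (z ^+ 2) = modulus z ^+ 2 by rewrite !expr2 modulusM.
    move=> k; apply: (@le_trans _ _ (4 * (e / 4 * modulus z) / modulus z ^+ 2)).
      by rewrite ler_wpM2r ?invr_ge0 ?sqr_ge0.
    rewrite (_ : 4 * _ / _ = e / modulus z); last by field; rewrite gt_eqF.
    by rewrite ler_wpM2l ?(ltW e0)// lef_pV2.
  rewrite trE; set X := 4 * L * _ in lower *; set Y := trap n err a a' in upper *.
  have := modulusB 0 Y; rewrite sub0r subr0 => YN.
  have := modulusD (X + Y) (- Y); rewrite addrK; lra.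
have [n hn] := lim0 (e / 4) ltac:(lra).
have := bc n; have := aa n.
have := modulusD (trap n H b c) (trap n H a a' - trap n H b c).
rewrite subrKC modulusB.
move: hn; rewrite modulusB => hn k1 k2 k3.
have -> : 2 * M / rho = (8 * M / rho) / 4 by field; rewrite gt_eqF.
lra.
Qed.

End CauchyEstimate.

(** * Analytic discs *)

Section BoundedDiscs.
Context {R : realType}.
Local Notation C := (Cplx R).

Lemma cder_shift {V : normedModType C} (f : C -> V) u w L :
  cder f (u + w) L -> cder (fun v => f (u + v)) w L.
Proof.
by move=> df e /df[d d0 hd]; exists d => // h hh; rewrite addrA; exact: hd.
Qed.

Lemma derivable_shift {V : normedModType C} (f : C -> V) u w :
  derivable f (u + w) 1 -> derivable (fun v => f (u + v)) w 1.
Proof. by move=> /derivable_cder df; apply: cder_derivable; exact: cder_shift df. Qed.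

(** Cauchy's estimate on discs of radius [s / 4] about the points of modulus at most [s / 2] bounds
    the derivative by [16 * M / s]; the mean value inequality follows by [cousin] along the ray to
    [z]. *)
Lemma bounded_lipschitz (f : C -> C) (s M : R) : 0 < s ->
  (forall z, modulus z < s -> derivable f z 1 /\ modulus (f z) <= M) ->
  forall z, modulus z <= s / 2 -> modulus (f z - f 0) <= 16 * M / s * modulus z.
Proof.
move=> s0 fs z zs; set K := 16 * M / s.
have M0 : 0 <= M.
  by have [|_ h] := fs 0; [rewrite modulus0|exact: le_trans (modulus_ge0 _) h].
have K0 : 0 <= K by rewrite divr_ge0 ?mulr_ge0 ?(ltW s0).
have dfK u : modulus u <= s / 2 -> modulus (derive1 f u) <= K.
  move=> us.
  have duz w : modulus w <= 2 * (s / 8) -> modulus (u + w) < s.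
    by move=> ws; apply: le_lt_trans (modulusD _ _) _; lra.
  have -> : derive1 f u = derive1 (fun w => f (u + w)) 0.
    apply/esym/cder_derive1/cder_shift; rewrite addr0; apply: derivable_cder.
    by have [] := fs u ltac:(lra).
  have -> : K = 2 * M / (s / 8) by rewrite /K; field; rewrite gt_eqF.
  apply: cauchy_derivative; first lra.
    by move=> w /duz /fs[dw _]; exact: derivable_shift.
  by move=> w /duz /fs[].
apply/ler_addgt0Pr => e e0.
have z10 : 0 < 1 + modulus z by rewrite ltr_wpDr// modulus_ge0.
pose e' := e / (1 + modulus z).
have e'0 : 0 < e' by rewrite divr_gt0.
pose P (a b : R) := modulus (f (b%:C * z) - f (a%:C * z)) <= (K + e') * modulus z * (b - a).
suff : P 0 1.
  rewrite /P mul1r mul0r subr0 mulr1 => /le_trans; apply.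
  rewrite mulrDl lerD2l /e' -mulrA ler_piMr ?(ltW e0)// mulrC ler_pdivrMr// mul1r.
  by rewrite lerDr.
apply: (@cousin _ P) => //.
  move=> a b c _ _ _ _; rewrite /P => h1 h2.
  have -> : f (c%:C * z) - f (a%:C * z) =
    (f (c%:C * z) - f (b%:C * z)) + (f (b%:C * z) - f (a%:C * z)) by rewrite addrA subrK.
  by apply: le_trans (modulusD _ _) _; nra.
move=> u u0 u1.
have uz : modulus (u%:C * z) <= s / 2.
  apply: le_trans zs.
  by rewrite modulusM modulusR ger0_norm// ler_piMl// modulus_ge0.
have /derivable_cder duz : derivable f (u%:C * z) 1 by have [] := fs (u%:C * z) ltac:(lra).
have [d d0 hd] := duz _ e'0.
exists (d / (1 + modulus z)); first by rewrite divr_gt0.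
move=> a b a0 au ub b1 bad.
have near_ c : `|c - u| <= b - a ->
    modulus (f (c%:C * z) - f (u%:C * z)) <= (K + e') * modulus z * `|c - u|.
  move=> cu.
  have czE : c%:C * z = u%:C * z + (c - u)%:C * z by rewrite -mulrDl -rmorphD/= subrKC.
  have mcz : modulus ((c - u)%:C * z) = `|c - u| * modulus z by rewrite modulusM modulusR.
  have := hd ((c - u)%:C * z); rewrite mcz => H.
  have {}H : nrm (f (u%:C * z + (c - u)%:C * z) - f (u%:C * z) - ((c - u)%:C * z) *: derive1 f (u%:C * z)) <= e' * (`|c - u| * modulus z).
    apply: H; apply: (@le_lt_trans _ _ (`|c - u| * (1 + modulus z))).
      by rewrite ler_wpM2l// lerDr.
    by rewrite -ltr_pdivlMr//; exact: le_lt_trans bad.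
  rewrite czE; set h := _%:C * z in mcz H *.
  have -> : f (u%:C * z + h) - f (u%:C * z) =
     (f (u%:C * z + h) - f (u%:C * z) - h *: derive1 f (u%:C * z)) + h * derive1 f (u%:C * z).
    by rewrite -[h *: _]/(h * _) subrK.
  apply: le_trans (modulusD _ _) _; rewrite modulusM mcz.
  have := ler_wpM2l (mulr_ge0 (normr_ge0 (c - u)) (modulus_ge0 z)) (dfK _ uz).
  rewrite -modulusE in H; lra.
rewrite /P.
have -> : f (b%:C * z) - f (a%:C * z) =
    (f (b%:C * z) - f (u%:C * z)) - (f (a%:C * z) - f (u%:C * z)).
  by rewrite opprB addrA subrK.
apply: le_trans (modulusD _ _) _; rewrite modulusN.
have h1 := near_ b ltac:(rewrite ger0_norm; lra).
have h2 := near_ a ltac:(rewrite ler0_norm; lra).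
rewrite ger0_norm ?subr_ge0// in h1; rewrite ler0_norm ?subr_le0// in h2.
lra.
Qed.

Context {n : nat}.
Local Notation Cn := 'rV[Cplx R]_n.
Implicit Types (X : set Cn) (p x y : Cn) (z w : C) (phi : C -> Cn).

Lemma coord_le (x : Cn) j : modulus (x ord0 j) <= nrm x.
Proof.
rewrite -lecR -nrmE -modulus_norm (_ : `|x| = mx_norm x)// mx_normE.
have -> : `|x ord0 j| = (`|x ord0 j|%:nng)%:num by [].
rewrite num_le; apply/bigmax_geP; right => /=; by exists (ord0, j).
Qed.

Lemma nrm_le_coord (x : Cn) (E : R) : 0 <= E ->
  (forall j, modulus (x ord0 j) <= E) -> nrm x <= E.
Proof.
move=> E0 h; rewrite -nrm_leE.
have [x0|x0] := eqVneq `|x| 0; first by rewrite x0 lecR.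
have [[i j] /= hx] := mx_norm_neq0 x0.
by rewrite (_ : `|x| = mx_norm x)// hx (ord1 i) modulus_norm lecR.
Qed.

Lemma cder_coord phi z L j : cder phi z L -> cder (fun w => phi w ord0 j) z (L ord0 j).
Proof.
move=> dp e /dp[d d0 hd]; exists d => // h /hd; apply: le_trans.
by apply: le_trans (coord_le _ j); rewrite !mxE.
Qed.

Lemma disc_lipschitz phi (s M : R) : 0 < s ->
  (forall z, modulus z < s -> derivable phi z 1 /\ nrm (phi z) <= M) ->
  forall z, modulus z <= s / 2 -> nrm (phi z - phi 0) <= 16 * M / s * modulus z.
Proof.
move=> s0 hs z zs.
have M0 : 0 <= M.
  by have [|_ h] := hs 0; [rewrite modulus0|exact: le_trans (nrm_ge0 _) h].
apply: nrm_le_coord; first by rewrite !mulr_ge0 ?modulus_ge0 ?invr_ge0 ?(ltW s0).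
move=> j; rewrite !mxE; apply: (@bounded_lipschitz (fun w => phi w ord0 j) s M) => // w /hs[dw wM].
split; last exact: le_trans (coord_le _ _) wM.
by move/derivable_cder : dw => dw; apply: cder_derivable; exact: cder_coord dw.
Qed.

Lemma artanhe_le (x : \bar R) (r : R) : (0 <= x)%E -> (x <= r%:E)%E -> r < 1 ->
  (artanhe x <= (artanh r)%:E)%E.
Proof.
case: x => [x| |] //; rewrite !lee_fin => x0 xr r1.
rewrite /artanhe (le_lt_trans xr r1) lee_fin artanh_le//.
by apply: lt_le_trans x0; rewrite oppr_lt0.
Qed.

Lemma lempert_tilde_ge0 X x y : (0 <= lempert_tilde X x y)%E.
Proof. by apply/le_ereal_inf_tmp => _ [a _ <-]; rewrite lee_fin modulus_ge0. Qed.

Lemma lempert_disc X phi (a : C) : holomorphic_disc X phi -> modulus a < 1 ->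
  (lempert X (phi 0%R) (phi a) <= (artanh (modulus a))%:E)%E.
Proof.
move=> hphi a1; apply: artanhe_le => //; first exact: lempert_tilde_ge0.
apply: ereal_inf_lbound; exists a => //; split; first exact/unit_discE.
by exists phi.
Qed.

Lemma th_artanh_lt (x c : R) : 0 <= x -> x < 1 -> x < th c -> artanh x < c.
Proof. by move=> x0 x1; rewrite !ltNge le_artanh//; apply: lt_le_trans x0; rewrite oppr_lt0. Qed.

Lemma th_gt0 (c : R) : 0 < c -> 0 < th c.
Proof.
move=> c0; apply: divr_gt0; last by rewrite addr_gt0 ?expR_gt0.
by rewrite subr_gt0 expR_gt1; lra.
Qed.

Lemma th_lt1 (c : R) : th c < 1.
Proof.
have := expR_gt0 (2 * c); rewrite /th => h.
by rewrite ltr_pdivrMr; lra.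
Qed.

(** Hyperbolicity at [p] bounds [lempert] below by some [c > 0] between points near [p] and points
    far out, and within radius [th c] a disc reaches no point at Lempert distance [c] or more from
    its centre. The bound is uniform over all discs centred near [p]. *)
Lemma disc_bounded_near X p : hyperbolic_at X p -> exists s M r : R,
  [/\ 0 < s, s <= 1, 0 < r & forall phi, holomorphic_disc X phi -> nrm (phi 0 - p) < r ->
    forall z, modulus z < s -> nrm (phi z) <= M].
Proof.
case=> [/bounded_nrm[M hM]|[_]].
  by exists 1, M, 1; split => // phi hphi _ z /unit_discE /hphi[_ /hM].
rewrite limf_einfE => /ereal_sup_gt[_ [A [[P Q] /= [/nbhs_nrm[r r0 hr] /bounded_nrm[M hM]] PQA] <-]] inf0.
have [c [c0 hc]] : exists c : R, 0 < c /\
    (c%:E <= ereal_inf ((fun zw : Cn * Cn => lempert X zw.1 zw.2) @` A))%E.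
  case: (ereal_inf _) inf0 => [c| |]//; first by rewrite lte_fin => c0; exists c.
  (* The infimum may be [+oo], and then any positive constant will do. *)
  by move=> _; exists 1; split => //; rewrite leey.
exists (th c), M, r; split => //; first exact: th_gt0.
  exact/ltW/th_lt1.
move=> phi hphi pr z zs.
have z1 : modulus z < 1 by apply: lt_trans zs (th_lt1 _).
have Xd w : modulus w < 1 -> X (phi w) by move=> /unit_discE/hphi[].
have Xz := Xd z z1.
have X0 : X (phi 0) by apply: Xd; rewrite modulus0.
rewrite leNgt; apply/negP => Mz.
have Qz : Q (phi z).
  apply: contrapT => nQ; have := hM (phi z); rewrite leNgt Mz => /(_ _)/negP; apply => //=.
  by move=> h; apply: nQ; exact: h.
have PA : A (phi 0, phi z) by apply: PQA; split => //=; exact: hr.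
have : (c%:E <= (artanh (modulus z))%:E)%E.
  apply: le_trans hc _; apply: le_trans (lempert_disc hphi z1).
  by apply: ereal_inf_lbound; exists (phi 0, phi z).
by rewrite lee_fin leNgt th_artanh_lt// modulus_ge0.
Qed.

(** Uniformly bounded discs are uniformly Lipschitz, so those centred near [p] leave the ball only
    beyond a fixed radius. The same [c] serves as that radius and as the allowed distance of the
    centre from [p]. *)
Lemma disc_stays_near X p (r : R) : hyperbolic_at X p -> 0 < r ->
  exists2 c : R, 0 < c & c < 1 /\ forall phi, holomorphic_disc X phi ->
    nrm (phi 0 - p) < c -> forall z, modulus z < c -> nrm (phi z - p) < r.
Proof.
move=> /disc_bounded_near[s [M [r' [s0 s1 r'0 hM]]]] r0.
pose K := 1 + `|16 * M / s|.
have K0 : 0 < K by rewrite ltr_pwDl.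
exists (Num.min (Num.min r' (r / 2)) (Num.min (s / 2) (r / 2 / K))).
  by rewrite !lt_min r'0 !divr_gt0.
split; first by rewrite !gt_min (_ : s / 2 < 1) ?orbT//; lra.
move=> phi hphi; rewrite !lt_min => /andP[/andP[p1 p2] _] z.
rewrite !lt_min => /andP[_ /andP[z1 z2]].
have := @disc_lipschitz phi s M s0 _ z (ltW z1).
have hs w : modulus w < s -> derivable phi w 1 /\ nrm (phi w) <= M.
  move=> ws; split; last exact: hM ws.
  by have [] := hphi w (iffRL (unit_discE _) (lt_le_trans ws s1)).
move=> /(_ hs) H.
apply: le_lt_trans (nrmD3 (phi 0) _ _) _.
rewrite [ltRHS](splitr r) ler_ltD//.
apply: le_trans H _; apply: (@le_trans _ _ (K * modulus z)).
  rewrite ler_wpM2r ?modulus_ge0// /K; apply: le_trans (ler_norm _) _; lra.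
by rewrite mulrC -ler_pdivlMr// ltW.
Qed.

End BoundedDiscs.

(** * Rotations, automorphisms and perturbations of discs *)

Section Discs.
Context {R : realType} {n : nat}.
Local Notation C := (Cplx R).
Local Notation Cn := 'rV[Cplx R]_n.
Implicit Types (X Y : set Cn) (p x y v w : Cn) (z a : C) (phi : C -> Cn) (r s : R).

Lemma holomorphic_discP X phi : holomorphic_disc X phi <->
  forall z, modulus z < 1 -> derivable phi z 1 /\ X (phi z).
Proof. by split=> h z /unit_discE; exact: h. Qed.

Lemma cder_mul (V : normedModType C) (f : C -> V) a z L :
  cder f (a * z) L -> cder (fun u => f (a * u)) z (a *: L).
Proof.
apply: cder_comp => e e0; exists 1 => // h _.
rewrite (_ : _ - _ - _ = 0); last by ring.
by rewrite modulus0 mulr_ge0 ?modulus_ge0// ltW.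
Qed.

Lemma disc_scale X Y phi r : holomorphic_disc X phi -> 0 < r -> r <= 1 ->
  (forall z, modulus z < r -> Y (phi z)) ->
  holomorphic_disc Y (fun z => phi (r%:C * z)).
Proof.
move=> /holomorphic_discP hphi r0 r1 hY; apply/holomorphic_discP => z z1.
have rz : modulus (r%:C * z) < r.
  by rewrite modulusM modulusR gtr0_norm// -ltr_pdivlMl// mulVf// gt_eqF.
split; last exact: hY.
have [] := hphi (r%:C * z) (lt_le_trans rz r1).
by move=> /derivable_cder/cder_mul/cder_derivable.
Qed.

Lemma disc_rot X phi a : holomorphic_disc X phi -> modulus a = 1 ->
  holomorphic_disc X (fun z => phi (a * z)).
Proof.
move=> /holomorphic_discP hphi a1; apply/holomorphic_discP => z z1.
have [] := hphi (a * z); first by rewrite modulusM a1 mul1r.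
by move=> /derivable_cder/cder_mul/cder_derivable.
Qed.

Lemma disc_real X phi a : holomorphic_disc X phi -> modulus a < 1 ->
  exists psi, [/\ holomorphic_disc X psi, psi 0 = phi 0 & psi (modulus a)%:C = phi a].
Proof.
move=> hphi a1; have [->|a0] := eqVneq a 0.
  by exists phi; rewrite modulus0.
have ma0 : (modulus a)%:C != 0 :> C by rewrite -modulus_norm normr_eq0.
have mE : modulus (a / (modulus a)%:C) = 1.
  by rewrite modulusM modulusV modulusR ger0_norm ?modulus_ge0// divff// modulus_eq0.
exists (fun z => phi (a / (modulus a)%:C * z)); split; first exact: disc_rot.
  by rewrite mulr0.
by rewrite divfK.
Qed.

(** For [0 <= s < 1], the automorphism of the unit disc taking 0 to [s]. Real [s] suffices because
    [disc_real] turns a second point onto the real axis. *)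
Definition mob s z : C := (z + s%:C) / (1 + s%:C * z).

Lemma mob_den s z : 0 <= s -> s < 1 -> modulus z < 1 -> 1 + s%:C * z != 0.
Proof.
move=> s0 s1 z1; apply/eqP => /eqP; rewrite addrC addr_eq0 => /eqP h.
have : modulus (s%:C * z) = 1 by rewrite h modulusN modulus1.
rewrite modulusM modulusR ger0_norm// => h'.
by have := modulus_ge0 z; nra.
Qed.

Lemma modulus_sqr z : modulus z ^+ 2 = complex.Re z ^+ 2 + complex.Im z ^+ 2.
Proof. by rewrite /modulus normc_def /= sqr_sqrtr// addr_ge0 ?sqr_ge0. Qed.

Lemma mob_lt1 s z : 0 <= s -> s < 1 -> modulus z < 1 -> modulus (mob s z) < 1.
Proof.
move=> s0 s1 z1; rewrite /mob modulusM modulusV ltr_pdivrMr ?mul1r; last first.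
  by rewrite modulus_gt0 mob_den.
rewrite -(@ltr_pXn2r _ 2) ?nnegrE ?modulus_ge0// !modulus_sqr.
have : modulus z ^+ 2 < 1 by rewrite expr_lt1// modulus_ge0.
rewrite modulus_sqr; case: z {z1} => x y /=; rewrite !expr2 => h.
have : 0 < (1 - s * s) * (1 - (x * x + y * y)) by rewrite mulr_gt0//; nra.
nra.
Qed.

Lemma mob0 s : mob s 0 = s%:C.
Proof. by rewrite /mob add0r mulr0 addr0 divr1. Qed.

Lemma mob_expand s z h : 1 + s%:C * z != 0 -> 1 + s%:C * (z + h) != 0 ->
  mob s (z + h) - mob s z - h * ((1 - s ^+ 2)%:C / (1 + s%:C * z) ^+ 2) =
  - (h ^+ 2 * (s%:C * (1 - s ^+ 2)%:C) / ((1 + s%:C * z) ^+ 2 * (1 + s%:C * (z + h)))).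
Proof.
move=> d1 d2; rewrite /mob rmorphB rmorphXn rmorph1 /=.
by field; rewrite d1 d2.
Qed.

Lemma mob_deriv s z : 0 <= s -> s < 1 -> modulus z < 1 ->
  forall e : R, 0 < e -> exists2 d : R, 0 < d & forall h, modulus h < d ->
   modulus (mob s (z + h) - mob s z - h * ((1 - s ^+ 2)%:C / (1 + s%:C * z) ^+ 2))
     <= e * modulus h.
Proof.
move=> s0 s1 z1 e e0.
have d1 := mob_den s0 s1 z1.
set D := 1 + s%:C * z in d1 *.
have D0 : 0 < modulus D by rewrite modulus_gt0.
pose K := modulus (s%:C * (1 - s ^+ 2)%:C : C) / (modulus D ^+ 2 * (modulus D / 2)).
have K0 : 0 <= K by rewrite !mulr_ge0 ?modulus_ge0 ?invr_ge0// !mulr_ge0 ?sqr_ge0 ?modulus_ge0.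
exists (Num.min (modulus D / 2) (e / (1 + K))).
  by rewrite lt_min !divr_gt0// ltr_pwDl.
move=> h; rewrite lt_min => /andP[h1 h2].
have Dh : modulus D / 2 <= modulus (1 + s%:C * (z + h)).
  have DE : D = (1 + s%:C * (z + h)) - s%:C * h by rewrite /D; ring.
  have := modulusD (1 + s%:C * (z + h)) (- (s%:C * h)).
  rewrite -DE modulusN modulusM modulusR ger0_norm//.
  have := modulus_ge0 h; nra.
have Dh0 : 1 + s%:C * (z + h) != 0.
  by rewrite -modulus_gt0; apply: lt_le_trans Dh; rewrite divr_gt0.
rewrite mob_expand// modulusN expr2 -/D.
rewrite -(mulrA h) -(mulrA h) modulusM mulrC ler_wpM2r ?modulus_ge0//.
rewrite -mulrA modulusM.
apply: (@le_trans _ _ (modulus h * K)).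
  rewrite ler_wpM2l ?modulus_ge0// /K modulusM ler_wpM2l ?modulus_ge0//.
  rewrite modulusV lef_pV2 ?posrE; last 2 first.
  - by rewrite modulus_gt0 mulf_neq0// expf_neq0.
  - by rewrite !mulr_gt0// divr_gt0.
  by rewrite modulusM expr2 modulusM -expr2 ler_wpM2l// sqr_ge0.
have K1 : 0 < 1 + K by rewrite ltr_pwDl.
move: h2; rewrite ltr_pdivlMr// => h2.
apply: le_trans (ltW h2); rewrite ler_wpM2l ?modulus_ge0//; lra.
Qed.

Lemma cder_mob phi s z L : 0 <= s -> s < 1 -> modulus z < 1 -> cder phi (mob s z) L ->
  cder (fun u => phi (mob s u)) z (((1 - s ^+ 2)%:C / (1 + s%:C * z) ^+ 2) *: L).
Proof. move=> s0 s1 z1; apply: cder_comp; exact: mob_deriv. Qed.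

Lemma disc_mob X phi s : 0 <= s -> s < 1 -> holomorphic_disc X phi ->
  holomorphic_disc X (fun z => phi (mob s z)).
Proof.
move=> s0 s1 /holomorphic_discP hphi; apply/holomorphic_discP => z z1.
have [dz Xz] := hphi (mob s z) (mob_lt1 s0 s1 z1); split; last exact: Xz.
by move: dz => /derivable_cder/(cder_mob s0 s1 z1)/cder_derivable.
Qed.

Lemma mobB s t : 0 <= s -> s <= t -> t < 1 -> mob s ((t - s) / (1 - s * t))%:C = t%:C.
Proof.
move=> s0 st t1.
have st1 : 1 - s * t != 0 by rewrite gt_eqF//; nra.
have s2 : 1 - s ^+ 2 != 0 by rewrite gt_eqF//; nra.
rewrite /mob -rmorphD -rmorphM -(rmorph1 (real_complex R)) -rmorphD -fmorph_div /=.
by congr (_%:C); field; rewrite st1 /= (_ : _ + _ = 1 - s ^+ 2)//; ring.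
Qed.

(** The map [z -> mob s (- z)] exchanges 0 and [s]. *)
Lemma disc_sym X phi a : holomorphic_disc X phi -> modulus a < 1 ->
  exists psi b, [/\ holomorphic_disc X psi, psi 0 = phi a, psi b = phi 0 & modulus b = modulus a].
Proof.
move=> hphi a1; have [psi [hpsi <- <-]] := disc_real hphi a1.
have m0 := modulus_ge0 a.
exists (fun z => psi (mob (modulus a) (-1 * z))), (modulus a)%:C; split.
- apply: (@disc_rot _ (fun z => psi (mob (modulus a) z))); last by rewrite modulusN modulus1.
  exact: disc_mob.
- by rewrite mulr0 mob0.
- by rewrite /mob mulN1r addNr mul0r.
- by rewrite modulusR ger0_norm.
Qed.

Lemma disc_ball X x y r : nball x r `<=` X -> nrm (y - x) < r ->
  exists phi, [/\ holomorphic_disc X phi, phi 0 = x & phi (nrm (y - x) / r)%:C = y].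
Proof.
move=> xX yr; have r0 : 0 < r by exact: le_lt_trans (nrm_ge0 _) yr.
have [->|yx] := eqVneq y x.
  exists (fun z => x + z *: 0); split; last by rewrite scaler0 addr0.
    apply/holomorphic_discP => z _; split; first exact: cder_derivable (cder_affine _ _ _).
    by apply: xX; rewrite /nball /= scaler0 addr0 subrr nrm0.
  by rewrite scaler0 addr0.
have d0 : 0 < nrm (y - x).
  rewrite lt_def nrm_ge0 andbT; apply/eqP => /nrm_eq0/eqP.
  by rewrite subr_eq0 (negbTE yx).
exists (fun z => x + z *: ((r / nrm (y - x))%:C *: (y - x))); split.
- apply/holomorphic_discP => z z1; split; first exact: cder_derivable (cder_affine _ _ _).
  apply: xX; rewrite /nball /= addrC addKr !nrmZ modulusR ger0_norm ?divr_ge0 ?ltW//.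
  by rewrite divfK ?gt_eqF// -ltr_pdivlMr// divff// gt_eqF.
- by rewrite scale0r addr0.
rewrite scalerA -rmorphM /= mulrA divfK ?gt_eqF// divff ?gt_eqF// scale1r.
by rewrite addrC subrK.
Qed.

(** The image of the compact disc of radius [r] keeps away from the complement of [X], so the
    shrunken disc can be moved and tilted. This is the mechanism behind the upper semicontinuity of
    the Kobayashi-Royden metric. *)
Lemma disc_perturb X phi r : open X -> holomorphic_disc X phi -> 0 < r -> r < 1 ->
  exists2 d : R, 0 < d & forall v w, nrm v < d -> nrm w < d ->
    holomorphic_disc X (fun z => phi (r%:C * z) + (v + z *: w)).
Proof.
move=> oX /holomorphic_discP hphi r0 r1.
(* Reciprocals of radii of balls inside [X]: an upper bound for [f] is a lower bound for the
   distance to the complement. *)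
pose f z := ereal_inf [set M%:E | M in [set M : R | 0 < M /\ nball (phi z) M^-1 `<=` X]].
have [] := compact_bounded_nrm (f := f) (@cball_compact R r).
  move=> z zr.
  have [dz Xz] := hphi z (le_lt_trans zr r1).
  have [d d0 hd] := open_nrm oX Xz.
  have d20 : 0 < d / 2 by rewrite divr_gt0.
  have [c c0 hc] := cder_cont (derivable_cder dz) d20.
  exists c => //; exists (d / 2)^-1 => u uz.
  apply: ereal_inf_lbound; exists (d / 2)^-1 => //; split; first by rewrite invr_gt0.
  rewrite invrK => x xu; apply: hd.
  apply: le_lt_trans (nrmD3 (phi u) _ _) _.
  by rewrite [ltRHS](splitr d) ltrD//; exact: hc.
move=> e e0 [M hM].
have M10 : 0 < `|M| + 1 by rewrite ltr_wpDl.
exists ((`|M| + 1)^-1 / 2); first by rewrite divr_gt0// invr_gt0.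
move=> v w hv hw; apply/holomorphic_discP => z z1.
have rz : modulus (r%:C * z) < r.
  by rewrite modulusM modulusR gtr0_norm// -ltr_pdivlMl// mulVf// gt_eqF.
have [dz Xz] := hphi (r%:C * z) (lt_trans rz r1).
split.
  have := cderD (cder_mul (derivable_cder dz)) (cder_affine v w z).
  exact: cder_derivable.
have : (f (r%:C * z)%R < (`|M| + 1)%:E)%E.
  apply: le_lt_trans (hM (r%:C * z) (r%:C * z) (ltW rz) _) _.
    by rewrite subrr nrm0.
  by rewrite lte_fin; apply: le_lt_trans (ler_norm _) _; rewrite ltrDl.
move=> /ereal_inf_lt[_ [M' [M'0 hM'] <-]]; rewrite lte_fin => M'M.
apply: hM'; rewrite /nball /= addrC addKr.
apply: (@lt_trans _ _ (`|M| + 1)^-1); last by rewrite ltf_pV2.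
apply: le_lt_trans (nrmD _ _) _; rewrite [ltRHS]splitr ltrD//.
rewrite nrmZ; apply: le_lt_trans hw; rewrite ler_piMl ?nrm_ge0// ltW//.
Qed.

End Discs.

(** * The Kobayashi distance and metric *)

Section Kobayashi.
Context {R : realType} {n : nat}.
Local Notation C := (Cplx R).
Local Notation Cn := 'rV[Cplx R]_n.
Implicit Types (X Y : set Cn) (p x y u v w : Cn) (z a : C) (phi : C -> Cn) (r s : R).

Definition kd X x y : R := fine (kobayashi X x y).

Section Pseudodistance.
Variable X : set Cn.
Hypothesis pX : pseudodistance_on X (kobayashi X).

Lemma kdE x y : X x -> X y -> kobayashi X x y = (kd X x y)%:E.
Proof. by case: pX => h _ _ _ Xx Xy; have [f _] := h x y Xx Xy; rewrite /kd fineK. Qed.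

Lemma kd_ge0 x y : X x -> X y -> 0 <= kd X x y.
Proof.
by case: pX => h _ _ _ Xx Xy; have [_ g] := h x y Xx Xy; rewrite -lee_fin -kdE.
Qed.

Lemma kdxx x : X x -> kd X x x = 0.
Proof. by case: pX => _ h _ _ Xx; rewrite /kd h. Qed.

Lemma kdC x y : X x -> X y -> kd X x y = kd X y x.
Proof. by case: pX => _ _ h _ Xx Xy; rewrite /kd h. Qed.

Lemma kd_tri y x u : X x -> X y -> X u -> kd X x u <= kd X x y + kd X y u.
Proof.
move=> Xx Xy Xu; rewrite -lee_fin EFinD -!kdE//.
by case: pX => _ _ _; apply.
Qed.

Lemma kobayashi_lempert x y : X x -> X y -> (kobayashi X x y <= lempert X x y)%E.
Proof. by move=> Xx Xy; apply: ge_ereal_sup => _ [d [_ hd] <-]; exact: hd. Qed.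

Lemma disc_in phi z : holomorphic_disc X phi -> modulus z < 1 -> X (phi z).
Proof. by move=> /holomorphic_discP h /h[]. Qed.

Lemma kd_disc phi a : holomorphic_disc X phi -> modulus a < 1 ->
  kd X (phi 0) (phi a) <= artanh (modulus a).
Proof.
move=> hphi a1; have X0 : X (phi 0) by apply: disc_in; rewrite ?modulus0.
have Xa : X (phi a) by exact: disc_in.
rewrite -lee_fin -kdE//; apply: le_trans (kobayashi_lempert X0 Xa) _.
exact: lempert_disc.
Qed.

Lemma kd_ball x y r : nball x r `<=` X -> nrm (y - x) < r ->
  kd X x y <= artanh (nrm (y - x) / r).
Proof.
move=> xX yr; have [phi [hphi p0 yE]] := disc_ball xX yr.
have r0 : 0 < r by exact: le_lt_trans (nrm_ge0 _) yr.
have q0 : 0 <= nrm (y - x) / r by rewrite divr_ge0 ?nrm_ge0// ltW.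
have m : modulus ((nrm (y - x) / r)%:C : C) = nrm (y - x) / r by rewrite modulusR ger0_norm.
move: yE m q0; set q := nrm (y - x) / r => yE m q0.
have q1 : q < 1 by rewrite ltr_pdivrMr// mul1r.
have := kd_disc hphi (a := q%:C); rewrite m p0 yE; exact.
Qed.

Lemma kd_small x (e : R) : open X -> X x -> 0 < e ->
  exists2 d : R, 0 < d & forall y u, nrm (y - x) < d -> nrm (u - x) < d ->
    [/\ X y, X u & kd X y u <= e].
Proof.
move=> oX Xx e0; have [r r0 hr] := open_nrm oX Xx.
(* The solution of [q / (1 - q) = e / 2], to be used in [artanh_ub]. *)
pose q := e / (2 + e).
have e2 : 0 < 2 + e by lra.
have q0 : 0 < q by rewrite divr_gt0.
have q1 : q < 1 by rewrite ltr_pdivrMr//; lra.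
have kq y : nrm (y - x) < q * r -> X y /\ kd X x y <= e / 2.
  move=> yd.
  have yr : nrm (y - x) < r by apply: lt_le_trans yd _; rewrite ler_piMl// ltW.
  split; first exact: hr.
  have Y0 : 0 <= nrm (y - x) / r by rewrite divr_ge0 ?nrm_ge0// ltW.
  have Yq : nrm (y - x) / r <= q by rewrite ler_pdivrMr// ltW.
  apply: le_trans (kd_ball (r := r) _ yr) _ => //.
  apply: le_trans (artanh_le (y := q) _ Yq q1) _; first lra.
  apply: le_trans (artanh_ub (ltW q0) q1) _.
  rewrite /q ler_pdivrMr; last by rewrite subr_gt0.
  by rewrite le_eqVlt; apply/orP; left; apply/eqP; field; rewrite gt_eqF.
exists (q * r); first exact: mulr_gt0.
move=> y u /kq[Xy ky] /kq[Xu ku]; split => //.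
apply: le_trans (kd_tri Xy Xx Xu) _; rewrite (kdC Xy Xx); lra.
Qed.

End Pseudodistance.

Lemma kr_ge0 X x v : (0 <= kobayashi_royden X x v)%E.
Proof. by apply: le_ereal_inf_tmp => _ [a _ <-]; rewrite lee_fin modulus_ge0. Qed.

Lemma kr_disc X phi a L : holomorphic_disc X phi -> cder phi 0 L ->
  (kobayashi_royden X (phi 0%R) (a *: L)%R <= (modulus a)%:E)%E.
Proof.
move=> hphi dphi; apply: ereal_inf_lbound; exists a => //; exists phi; split => //.
by rewrite (cder_derive1 dphi).
Qed.

Lemma krN X x v : (kobayashi_royden X x (- v)%R <= kobayashi_royden X x v)%E.
Proof.
apply: le_ereal_inf_tmp => _ [a [phi [hphi p0 av]] <-].
apply: ereal_inf_lbound; exists (- a); last by rewrite modulusN.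
by exists phi; split => //; rewrite scaleNr av.
Qed.

(** A disc restricted to radius [r] and rescaled to the unit disc has its derivative at 0 multiplied
    by [r], which costs the factor [r^-1]. *)
Lemma kr_transfer X Y x v r : 0 < r -> r <= 1 ->
  (forall phi, holomorphic_disc X phi -> phi 0 = x ->
     forall z, modulus z < r -> Y (phi z)) ->
  (kobayashi_royden Y x v <= (r^-1)%:E * kobayashi_royden X x v)%E.
Proof.
move=> r0 r1 h.
rewrite -lee_pdivrMl ?invr_gt0//.
apply: le_ereal_inf_tmp => _ [a [phi [hphi p0 av]] <-].
rewrite lee_pdivrMl ?invr_gt0// -EFinM.
have h1 := disc_scale hphi r0 r1 (h _ hphi p0).
have /holomorphic_discP/(_ 0) := hphi; rewrite modulus0 => /(_ ltr01)[d0 _].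
have d1 : cder (fun z => phi (r%:C * z)) 0 (r%:C *: derive1 phi 0).
  by apply: cder_mul; rewrite mulr0; exact: derivable_cder.
have -> : r^-1 * modulus a = modulus (a * (r%:C)^-1).
  by rewrite modulusM modulusV modulusR ger0_norm ?(ltW r0)// mulrC.
have := kr_disc (a * (r%:C)^-1) h1 d1.
rewrite mulr0 p0 scalerA divfK ?av//.
by rewrite -(rmorph0 (real_complex R)) (inj_eq (fmorph_inj _)) gt_eqF.
Qed.

Lemma kd_transfer X Y phi a r : pseudodistance_on Y (kobayashi Y) ->
  holomorphic_disc X phi -> 0 < r -> r <= 1 ->
  (forall z, modulus z < r -> Y (phi z)) -> modulus a < r ->
  kd Y (phi 0) (phi a) <= artanh (modulus a / r).
Proof.
move=> pY hphi r0 r1 hY ar.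
have h1 := disc_scale hphi r0 r1 hY.
have rn0 : (r%:C : C) != 0.
  by rewrite -(rmorph0 (real_complex R)) (inj_eq (fmorph_inj _)) gt_eqF.
have mE : modulus (a / r%:C) = modulus a / r.
  by rewrite modulusM modulusV modulusR ger0_norm// ltW.
have := kd_disc pY h1 (a := a / r%:C).
rewrite mE mulr0 (mulrC (r%:C)) divfK//; apply.
by rewrite ltr_pdivrMr// mul1r.
Qed.

End Kobayashi.

(** * Chains of small discs *)

Section NiceChains.
Context {R : realType} {n : nat}.
Local Notation C := (Cplx R).
Local Notation Cn := 'rV[Cplx R]_n.
Implicit Types (X Y : set Cn) (p x y u v w : Cn) (z : C) (phi : C -> Cn) (a r s t e eta : R).

Definition seg x y t : Cn := x + (t%:C : C) *: (y - x).

Lemma seg0 x y : seg x y 0 = x.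
Proof. by rewrite /seg scale0r addr0. Qed.

Lemma seg1 x y : seg x y 1 = y.
Proof. by rewrite /seg scale1r addrC subrK. Qed.

Lemma rcB r s : ((r - s)%:C : C) = r%:C - s%:C.
Proof. exact: rmorphB. Qed.

Lemma seg_sym x y t : seg y x t = seg x y (1 - t).
Proof.
by rewrite /seg rcB scalerBl scale1r -(opprB y x) scalerN addrA (addrC x) subrK.
Qed.

Lemma seg_ball x y v r t : nrm (x - v) < r -> nrm (y - v) < r -> 0 <= t -> t <= 1 ->
  nrm (seg x y t - v) < r.
Proof.
move=> xr yr t0 t1.
have -> : seg x y t - v = ((1 - t)%:C : C) *: (x - v) + (t%:C : C) *: (y - v).
  by apply/rowP => i; rewrite /seg !mxE rcB; ring.
apply: le_lt_trans (nrmD _ _) _; rewrite !nrmZ !modulusR !ger0_norm ?subr_ge0//.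
have [->|t0'] := eqVneq t 0; first by rewrite subr0 mul1r mul0r addr0.
have : 0 < t by rewrite lt_def t0'.
nra.
Qed.

Definition step_disc X x y a := exists phi z,
  [/\ holomorphic_disc X phi, phi 0 = x, phi z = y, modulus z < 1 & artanh (modulus z) <= a].

(** Two kinds of closeness to the ends are recorded: in norm, to find a vertex near a point of a
    compact set, and in distance, to compare a point of a polygon with the vertices. *)
Definition step_seg X eta x y a u :=
  [/\ X u /\ (kobayashi_royden X u (y - x)%R <= a%:E)%E,
      nrm (u - x) <= eta, nrm (u - y) <= eta, kd X x u <= eta & kd X u y <= eta].

(* The condition on the segment makes [a] a bound for its Kobayashi-Royden
   length, so that chains of steps can be replaced by polygons. *)
Definition nstep X eta x y a :=
  [/\ 0 <= a, a <= eta, step_disc X x y a &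
      forall t, 0 <= t -> t <= 1 -> step_seg X eta x y a (seg x y t)].

Lemma real_complex_neq0 r : r != 0 -> (r%:C : C) != 0.
Proof. by rewrite -(rmorph0 (real_complex R)) (inj_eq (fmorph_inj _)). Qed.

Lemma quotientB x v r : r != 0 ->
  ((r^-1)%:C : C) *: x - v = ((r^-1)%:C : C) *: (x - (r%:C : C) *: v).
Proof.
by move=> /real_complex_neq0 rn0; apply/rowP => i; rewrite !mxE fmorphV; field.
Qed.

Lemma scale_correction v w r s :
  ((r * s)%:C : C) *: v = (r%:C : C) *: ((s%:C : C) *: w) + ((r * s)%:C : C) *: (v - w).
Proof. by rewrite scalerA -rmorphM scalerBr addrC subrK. Qed.

(** The ends of the chord lie on both sides of [s], so the two increments from [s] have lengths
    adding up to [t - s'] and their errors can be divided by it. *)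
Lemma chord_derivative phi s s' t L k : 0 < k -> s' <= s -> s <= t -> s' < t ->
  nrm (phi t%:C - phi s%:C - ((t - s)%:C : C) *: L) <= k / 2 * `|t - s| ->
  nrm (phi s'%:C - phi s%:C - ((s' - s)%:C : C) *: L) <= k / 2 * `|s' - s| ->
  nrm (((t - s')^-1%:C : C) *: (phi t%:C - phi s'%:C) - L) < k.
Proof.
move=> k0 s's st s't.
have fin : k / 2 * (t - s) + k / 2 * - (s' - s) < k * (t - s').
  have : 0 < k * (t - s') by rewrite mulr_gt0// subr_gt0.
  lra.
rewrite ger0_norm ?subr_ge0// ler0_norm ?subr_le0// => h1 h2.
have ts0 : 0 < t - s' by rewrite subr_gt0.
rewrite quotientB ?gt_eqF// nrmZ modulusR gtr0_norm ?invr_gt0// mulrC ltr_pdivrMr//.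
have -> : phi t%:C - phi s'%:C - ((t - s')%:C : C) *: L =
    (phi t%:C - phi s%:C - ((t - s)%:C : C) *: L) -
    (phi s'%:C - phi s%:C - ((s' - s)%:C : C) *: L).
  by apply/rowP => i; rewrite !mxE !rcB; ring.
apply: le_lt_trans (nrmD _ _) _; rewrite nrmN.
apply: le_lt_trans (lerD h1 h2) _.
exact: fin.
Qed.

(** The right side contains the hyperbolic step, the left side the metric frozen at [s]. Half of [e]
    pays for shrinking the disc by [(1 + e / 2)^-1], the other half for replacing [1 - s ^+ 2] by
    [1 - s' * t]. *)
Lemma radial_ratio e s s' t : 0 < e -> 0 <= s' -> s' <= s -> s <= t -> t < 1 ->
  t - s' < (e / 2) * (1 - s) / (1 + e / 2) ->
  (t - s') / ((1 + e / 2)^-1 * (1 - s ^+ 2)) <= (1 + e) * ((t - s') / (1 - s' * t)).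
Proof.
move=> e0 s'0 s's st t1.
have e20 : 0 < 1 + e / 2 by lra.
have s2 : 0 < 1 - s ^+ 2 by rewrite subr_gt0 expr_lt1//; lra.
have s't1 : 0 < 1 - s' * t by nra.
rewrite ltr_pdivlMr// => td6.
rewrite invfM invrK.
rewrite (_ : (t - s') * ((1 + e / 2) / (1 - s ^+ 2)) = (t - s') * (1 + e / 2) / (1 - s ^+ 2)); last by ring.
rewrite ler_pdivrMr// (_ : (1 + e) * _ * _ = (t - s') * ((1 + e) * (1 - s ^+ 2)) / (1 - s' * t)); last by ring.
rewrite ler_pdivlMr// -mulrA ler_wpM2l//; first lra.
have h1 : 1 - s' * t <= 1 - s ^+ 2 + (t - s').
  have : 0 <= s' * (t - s) by rewrite mulr_ge0//; lra.
  have : 0 <= (1 - s) * (s - s') by rewrite mulr_ge0//; lra.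
  rewrite expr2; lra.
have h2 : 1 - s <= 1 - s ^+ 2.
  have : 0 <= s * (1 - s) by rewrite mulr_ge0//; lra.
  rewrite expr2; lra.
have := ler_wpM2l (ltW e20) h1.
have : e / 2 * (1 - s) <= e / 2 * (1 - s ^+ 2) by rewrite ler_wpM2l//; lra.
lra.
Qed.

Lemma radial_small q eta e : 0 <= q -> 0 < e -> q <= 1 / 2 -> q <= eta / (2 * (1 + e)) ->
  (1 + e) * artanh q <= eta.
Proof.
move=> q0 e0 q12 qeta.
have a_ub : artanh q <= 2 * q.
  apply: le_trans (artanh_ub _ _) _ => //; first lra.
  by rewrite ler_pdivrMr; [nra|lra].
have e1 : 0 < 1 + e by lra.
move: qeta; rewrite ler_pdivlMr ?mulr_gt0// => qeta.
by apply: le_trans (ler_wpM2l (ltW e1) a_ub) _; lra.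
Qed.

Section Steps.
Variable X : set Cn.
Hypotheses (oX : open X) (pX : pseudodistance_on X (kobayashi X)).

Lemma nstep_in eta x y a : nstep X eta x y a -> X x /\ X y.
Proof.
move=> [_ _ _ h]; split.
  by have [[]] := h 0 (lexx _) ler01; rewrite seg0.
by have [[]] := h 1 ler01 (lexx _); rewrite seg1.
Qed.

Lemma nstep_kd eta x y a : nstep X eta x y a -> kd X x y <= a.
Proof.
by move=> [_ _ [phi [z [hphi <- <- z1 za]]] _]; apply: le_trans za; exact: kd_disc.
Qed.

Lemma nstep_sym eta x y a : nstep X eta x y a -> nstep X eta y x a.
Proof.
move=> st; have [Xx Xy] := nstep_in st; case: st => a0 ae [phi [z [hphi p0 pz z1 za]]] h.
split => //.
  have [psi [b [hpsi s0 sb bz]]] := disc_sym hphi z1.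
  by exists psi, b; split; rewrite ?s0 ?sb ?bz.
move=> t t0 t1; rewrite seg_sym.
have [[Xu ku] h1 h2 h3 h4] := h (1 - t) ltac:(lra) ltac:(lra).
split => //.
- split => //; apply: le_trans ku; rewrite -(opprB y x); exact: krN.
- by rewrite kdC.
- by rewrite kdC.
Qed.

(** The disc recentred at [s'] witnesses the step. For the metric on the segment, the disc recentred
    at [s] is shrunk and perturbed so that it passes through the given point of the segment with
    derivative an exact multiple of the chord. *)
Lemma nstep_radial phi s e eta : holomorphic_disc X phi ->
  0 <= s -> s < 1 -> 0 < e -> 0 < eta ->
  exists2 d : R, 0 < d & forall s' t, 0 <= s' -> s' <= s -> s <= t -> t < 1 ->
    s' < t -> t - s' < d ->
    nstep X eta (phi s'%:C) (phi t%:C) ((1 + e) * (artanh t - artanh s')).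
Proof.
move=> hphi s0 s1 e0 eta0.
have ms : modulus (s%:C : C) < 1 by rewrite modulusR ger0_norm.
have [ds Xs] : derivable phi s%:C 1 /\ X (phi s%:C).
  by move/holomorphic_discP : (hphi); apply.
set L := derive1 phi s%:C.
have dphi : cder phi s%:C L by exact: derivable_cder.
have s2 : 0 < 1 - s ^+ 2 by rewrite subr_gt0 expr_lt1.
have dpsi : cder (fun z => phi (mob s z)) 0 ((1 - s ^+ 2)%:C *: L).
  have := @cder_mob R n phi s 0 L s0 s1; rewrite modulus0 mob0 => /(_ ltr01 dphi).
  by rewrite mulr0 addr0 expr1n divr1.
pose r := (1 + e / 2)^-1.
have e20 : 0 < 1 + e / 2 by lra.
have r0 : 0 < r by rewrite invr_gt0.
have r1 : r < 1 by rewrite invf_lt1//; lra.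
have [d1 d10 hd1] := disc_perturb oX (disc_mob s0 s1 hphi) r0 r1.
have [d3 d30 hd3] := kd_small pX oX Xs eta0.
have d120 : 0 < d1 / 2 by lra.
have [d2 d20 hd2] := dphi _ d120.
have m0 : 0 < Num.min (Num.min d1 d3) (eta / 2) by rewrite !lt_min d10 d30 divr_gt0.
have [d4 d40 hd4] := cder_cont dphi m0.
(* Below [1 / 2] one has [artanh q <= 2 * q], and the second bound then makes [(1 + e) * artanh q]
   at most [eta]. *)
pose q0 := Num.min (1 / 2) (eta / (2 * (1 + e))).
have q00 : 0 < q0 by rewrite lt_min !divr_gt0// mulr_gt0//; lra.
pose d5 := q0 * ((1 - s) / 2).
pose d6 := (e / 2) * (1 - s) / (1 + e / 2).
have d50 : 0 < d5 by rewrite mulr_gt0// divr_gt0// subr_gt0.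
have d60 : 0 < d6 by rewrite divr_gt0// mulr_gt0 ?subr_gt0//; lra.
exists (Num.min (Num.min d2 d4) (Num.min (Num.min d5 d6) ((1 - s) / 2))).
  by rewrite !lt_min d20 d40 d50 d60 divr_gt0// subr_gt0.
move=> s' t s'0 s's st t1 s't; rewrite !lt_min => /andP[/andP[td2 td4] /andP[/andP[td5 td6] td7]].
have near_ c : s' <= c -> c <= t -> `|c - s| <= t - s'.
  by move=> *; rewrite ler_norml; apply/andP; split; lra.
have pnear c : s' <= c -> c <= t ->
    [/\ nrm (phi c%:C - phi s%:C) < d1, nrm (phi c%:C - phi s%:C) < d3 &
        nrm (phi c%:C - phi s%:C) < eta / 2].
  move=> c1 c2; have : modulus (c%:C - s%:C : C) < d4.
    by rewrite -rmorphB modulusR; apply: le_lt_trans (near_ c c1 c2) td4.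
  by move=> /hd4; rewrite !lt_min => /andP[/andP[? ?] ?].
have lin c : s' <= c -> c <= t ->
    nrm (phi c%:C - phi s%:C - ((c - s)%:C : C) *: L) <= d1 / 2 * `|c - s|.
  move=> c1 c2; have : modulus ((c - s)%:C : C) < d2.
    by rewrite modulusR; apply: le_lt_trans (near_ c c1 c2) td2.
  by move=> /hd2; rewrite modulusR -rmorphD subrKC.
have ts0 : 0 < t - s' by rewrite subr_gt0.
have s't1 : 0 < 1 - s' * t by nra.
have s'ts : (1 - s) / 2 <= 1 - s' * t by nra.
set q := (t - s') / (1 - s' * t).
have q_gt0 : 0 < q by rewrite divr_gt0.
have qq0 : q <= q0.
  rewrite ler_pdivrMr//; apply: le_trans (ltW td5) _.
  by rewrite /d5 ler_wpM2l// ltW.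
have [q12 qeta] : q <= 1 / 2 /\ q <= eta / (2 * (1 + e)).
  by move: qq0; rewrite le_min => /andP[].
have e1 : 0 < 1 + e by lra.
have aE : artanh t - artanh s' = artanh q by rewrite artanhB// ltW.
rewrite aE.
have a_lb : q <= artanh q.
  by apply: artanh_lb; [exact: ltW | apply: le_lt_trans q12 _; rewrite mul1r invf_lt1 ?ltr1n].
have mq : modulus (q%:C : C) = q by rewrite modulusR gtr0_norm.
have aq0 : 0 <= artanh q by apply: le_trans a_lb; exact: ltW.
have q1 : q < 1 by apply: le_lt_trans q12 _; rewrite mul1r invf_lt1 ?ltr1n.
split.
- by rewrite mulr_ge0// ltW.
- exact: radial_small (ltW q_gt0) e0 q12 qeta.
- exists (fun z => phi (mob s' z)), (q%:C : C); split.
  + by apply: disc_mob => //; lra.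
  + by rewrite mob0.
  + by rewrite mobB// ltW.
  + by rewrite mq.
  + by rewrite mq ler_peMl// lerDl ltW.
move=> tau tau0 tau1.
have [p1 p2 p3] := pnear s' (lexx _) (ltW s't).
have [p1' p2' p3'] := pnear t (ltW s't) (lexx _).
set x := phi s'%:C in p1 p2 p3 *; set y := phi t%:C in p1' p2' p3' *.
set u := seg x y tau.
have u1 : nrm (u - phi s%:C) < d1 by exact: seg_ball.
have u2 : nrm (u - phi s%:C) < d3 by exact: seg_ball.
have u3 : nrm (u - phi s%:C) < eta / 2 by exact: seg_ball.
have [Xu _ kux] := hd3 u x u2 p2.
have [_ Xx _] := hd3 u x u2 p2.
have [_ _ kuy] := hd3 u y u2 p2'.
split; last 4 first.
- by rewrite ltW// (le_lt_trans (nrmD3 (phi s%:C) _ _))// (nrmB _ x) [ltRHS]splitr ltrD.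
- by rewrite ltW// (le_lt_trans (nrmD3 (phi s%:C) _ _))// (nrmB _ y) [ltRHS]splitr ltrD.
- by rewrite kdC.
- by [].
split => //.
(* The tilt [w] below corrects the derivative [k *: L] of the shrunken disc to [k *: V]; it is small
   because the slope [V] of the chord is close to [L]. *)
pose V : Cn := ((t - s')^-1%:C : C) *: (y - x).
have VL : nrm (V - L) < d1.
  exact: (chord_derivative d10 s's st s't (lin t (ltW s't) (lexx _)) (lin s' (lexx _) (ltW s't))).
pose k := r * (1 - s ^+ 2).
have k0 : 0 < k by rewrite mulr_gt0.
have k1 : k <= 1 by rewrite mulr_ile1 ?(ltW r0) ?(ltW r1) ?(ltW s2)// lerBlDr lerDl sqr_ge0.
pose w : Cn := (k%:C : C) *: (V - L).
have wd : nrm w < d1.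
  rewrite nrmZ modulusR gtr0_norm//; apply: le_lt_trans VL.
  by rewrite ler_piMl// nrm_ge0.
have hPsi := hd1 _ _ u1 wd.
have dPsi : cder (fun z => phi (mob s (r%:C * z)) + (u - phi s%:C + z *: w)) 0 ((k%:C : C) *: V).
  have -> : (k%:C : C) *: V = (r%:C : C) *: ((1 - s ^+ 2)%:C *: L) + w.
    exact: scale_correction.
  apply: cderD; last exact: cder_affine.
  by apply: (@cder_mul R _ (fun z => phi (mob s z))); rewrite mulr0.
have := kr_disc ((t - s') / k)%:C hPsi dPsi.
rewrite mulr0 mob0 scale0r addr0 subrKC scalerA -rmorphM /= divfK ?gt_eqF//.
rewrite /V scalerA -rmorphM divff ?gt_eqF// scale1r => /le_trans; apply.
rewrite lee_fin modulusR ger0_norm ?divr_ge0 ?(ltW ts0) ?(ltW k0)//.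
apply: (@le_trans _ _ ((1 + e) * q)); last by rewrite ler_wpM2l// ltW.
exact: radial_ratio td6.
Qed.

End Steps.
End NiceChains.

(** * The Kobayashi distance realized by chains of small steps *)

Section ChainDistance.
Context {R : realType} {n : nat}.
Local Notation C := (Cplx R).
Local Notation Cn := 'rV[Cplx R]_n.
Implicit Types (X Y : set Cn) (p x y u v w : Cn) (z : C) (phi : C -> Cn) (a r s t e eta : R).

Variable X : set Cn.
Hypotheses (dX : domain X) (pX : pseudodistance_on X (kobayashi X)).

Let oX : open X. Proof. by case: dX. Qed.

(** The radius from 0 to [A] is cut into radial steps by [cousin]; the lengths [artanh t - artanh s]
    telescope. *)
Lemma chain_radial phi A e eta : holomorphic_disc X phi -> 0 <= A -> A < 1 -> 0 < e -> 0 < eta ->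
  exists2 L, chain (nstep X eta) (phi 0) (phi A%:C) L & L <= (1 + e) * artanh A.
Proof.
move=> hphi A0 A1 e0 eta0.
pose P s t := exists2 L, chain (nstep X eta) (phi s%:C) (phi t%:C) L &
  L <= (1 + e) * (artanh t - artanh s).
suff : P 0 A by rewrite /P artanh0 subr0.
apply: (@cousin _ P) => //.
  move=> s t u _ _ _ _ [L1 c1 h1] [L2 c2 h2]; exists (L1 + L2); first exact: chain_trans c1 c2.
  by rewrite mulrBr in h1 h2 *; lra.
move=> u u0 uA; have u1 : u < 1 by exact: le_lt_trans A1.
have [d d0 hd] := nstep_radial oX pX hphi u0 u1 e0 eta0.
exists d => // s t s0 su ut tA tsd.
have := le_trans su ut; rewrite le_eqVlt => /orP[/eqP <-|st].
  by exists 0; [exact: chain_nil | rewrite subrr mulr0].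
exists ((1 + e) * (artanh t - artanh s)) => //.
by apply: chain1; apply: hd => //; exact: le_lt_trans A1.
Qed.

Lemma chain_ball eta x r y : 0 < eta -> nball x r `<=` X -> nrm (y - x) < r ->
  exists L, chain (nstep X eta) x y L.
Proof.
move=> eta0 xX yr; have [phi [hphi p0 py]] := disc_ball xX yr.
have r0 : 0 < r by exact: le_lt_trans (nrm_ge0 _) yr.
have A0 : 0 <= nrm (y - x) / r by rewrite divr_ge0 ?nrm_ge0// ltW.
have A1 : nrm (y - x) / r < 1 by rewrite ltr_pdivrMr// mul1r.
have [L c _] := chain_radial hphi A0 A1 ltr01 eta0.
by exists L; move: c; rewrite p0 py.
Qed.

Lemma nchain_sym eta x y L : chain (nstep X eta) x y L -> chain (nstep X eta) y x L.
Proof. by apply: chain_sym => *; exact: nstep_sym. Qed.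

Lemma nchain_ge0 eta x y L : chain (nstep X eta) x y L -> 0 <= L.
Proof. by apply: chain_ge0 => u v a []. Qed.

(** The reachable and the unreachable points both form open subsets of the connected set [X]. This
    makes [cdist] finite. *)
Lemma chain_connect eta x y : 0 < eta -> X x -> X y -> exists L, chain (nstep X eta) x y L.
Proof.
move=> eta0 Xx Xy; case: dX => _ _ cX.
pose E : set Cn := [set u | X u /\ exists L, chain (nstep X eta) x u L].
suff EX : E = X by have [_ h] : E y by rewrite EX.
apply: cX.
- by exists x; split => //; exists 0; exact: chain_nil.
- exists E; last by rewrite setIidr// => u [].
  apply: open_nrmP => u [Xu [L c]]; have [r r0 hr] := open_nrm oX Xu.
  exists r => // v vu; split; first exact: hr.
  have [L' c'] := chain_ball eta0 hr vu.
  by exists (L + L'); exact: chain_trans c c'.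
exists (~` [set u | X u /\ ~ E u]); last first.
  by apply/seteqP; split => u /=; [move=> Eu; split; [case: Eu | case] | move=> [Xu /not_andP[]// /contrapT]].
apply: open_closedC; apply: open_nrmP => u [Xu nE]; have [r r0 hr] := open_nrm oX Xu.
exists r => // v vu; split; first exact: hr.
move=> [Xv [L c]]; apply: nE; split => //.
have [L' c'] := chain_ball eta0 hr vu.
by exists (L + L'); apply: chain_trans c _; exact: nchain_sym.
Qed.

Definition cdist eta x y : \bar R :=
  ereal_inf [set L%:E | L in [set L | chain (nstep X eta) x y L]].

Lemma cdist_ge0 eta x y : (0 <= cdist eta x y)%E.
Proof.
by apply: le_ereal_inf_tmp => _ [L /= c <-]; rewrite lee_fin; exact: nchain_ge0 c.
Qed.

Lemma cdist_le eta x y L : chain (nstep X eta) x y L -> (cdist eta x y <= L%:E)%E.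
Proof. by move=> c; apply: ereal_inf_lbound; exists L. Qed.

Lemma cdist_pseudo eta : 0 < eta -> pseudodistance_on X (cdist eta).
Proof.
move=> eta0.
have fin x y : X x -> X y -> cdist eta x y \is a fin_num.
  move=> Xx Xy; have [L /cdist_le h] := chain_connect eta0 Xx Xy.
  by rewrite ge0_fin_numE ?cdist_ge0//; apply: le_lt_trans h (ltry _).
split.
- by move=> x y Xx Xy; split; [exact: fin | exact: cdist_ge0].
- move=> x Xx; apply/eqP; rewrite eq_le cdist_ge0 andbT.
  by apply: cdist_le; exact: chain_nil.
- move=> x y Xx Xy; congr ereal_inf; apply/seteqP.
  by split => _ [L c <-]; exists L => //; exact: nchain_sym.
move=> x y u Xx Xy Xu; rewrite -lee_subel_addl ?fin//.
apply: le_ereal_inf_tmp => _ [L2 c2 <-].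
rewrite lee_subel_addl ?fin// -lee_subel_addr ?fin//.
apply: le_ereal_inf_tmp => _ [L1 c1 <-].
rewrite lee_subel_addr ?fin// -EFinD.
by apply: cdist_le; exact: chain_trans c1 c2.
Qed.

Lemma cdist_lempert eta x y : 0 < eta -> X x -> X y -> (cdist eta x y <= lempert X x y)%E.
Proof.
move=> eta0 Xx Xy.
have [fin _] : cdist eta x y \is a fin_num /\ (0 <= cdist eta x y)%E.
  by have [h _ _ _] := cdist_pseudo eta0; exact: h.
rewrite -(fineK fin); set c := fine _.
have key (b : C) : modulus b < 1 -> (exists phi, [/\ holomorphic_disc X phi, phi 0 = x & phi b = y]) ->
    th c <= modulus b.
  move=> b1 [phi [hphi p0 pb]]; rewrite -le_artanh//; last first.
    by apply: lt_le_trans (modulus_ge0 _); rewrite oppr_lt0.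
  have [psi [hpsi s0 sb]] := disc_real hphi b1.
  apply/ler_addgt0Pr => e e0.
  have A0 := artanh_ge0 (modulus_ge0 b) b1.
  pose e' := e / (1 + artanh (modulus b)).
  have e'0 : 0 < e' by rewrite divr_gt0//; lra.
  have [L cL LA] := chain_radial hpsi (modulus_ge0 b) b1 e'0 eta0.
  rewrite s0 sb p0 pb in cL.
  apply: (@le_trans _ _ L).
    by rewrite -lee_fin fineK//; exact: cdist_le.
  apply: le_trans LA _; rewrite mulrDl mul1r lerD2l /e' -mulrA ler_piMr ?(ltW e0)//.
  by rewrite mulrC ler_pdivrMr; lra.
rewrite /lempert.
have lk : ((th c)%:E <= lempert_tilde X x y)%E.
  apply: le_ereal_inf_tmp => _ [b [b1 hb] <-]; rewrite lee_fin; apply: key => //.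
  exact/unit_discE.
case: (lempert_tilde X x y) lk (lempert_tilde_ge0 X x y) => [l| |] //=; last by move=> *; exact: leey.
rewrite !lee_fin => cl l0; case: ifP => l1; last by rewrite leey.
rewrite lee_fin le_artanh//.
by apply: lt_le_trans l0; rewrite oppr_lt0.
Qed.

(** [cdist eta] is a competitor in the supremum defining [kobayashi], hence below it: steps of any
    prescribed smallness already realize the distance. *)
Lemma nchain_exists eta e x y : 0 < eta -> 0 < e -> X x -> X y ->
  exists2 L, chain (nstep X eta) x y L & L <= kd X x y + e.
Proof.
move=> eta0 e0 Xx Xy.
have h : (cdist eta x y <= (kd X x y)%:E)%E.
  rewrite -kdE//; apply: ereal_sup_ubound; exists (cdist eta) => //.
  by split; [exact: cdist_pseudo | move=> u v Xu Xv; exact: cdist_lempert].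
have : (cdist eta x y < (kd X x y + e)%:E)%E.
  by apply: le_lt_trans h _; rewrite lte_fin ltrDl.
by move=> /ereal_inf_lt[_ [L cL <-]]; rewrite lte_fin => /ltW h'; exists L.
Qed.

(** The discrete form of a [(1, e)]-geodesic: every part of the chain is shortest up to [e]. *)
Definition near_min eta e N (z : nat -> Cn) (a : nat -> R) :=
  (forall i, (i < N)%N -> nstep X eta (z i) (z i.+1) (a i)) /\
  (forall i j, (i <= j)%N -> (j <= N)%N -> \sum_(i <= l < j) a l <= kd X (z i) (z j) + e).

Lemma nchain_kd eta N (z : nat -> Cn) (a : nat -> R) :
  X (z 0%N) -> (forall i, (i < N)%N -> nstep X eta (z i) (z i.+1) (a i)) ->
  (forall i, (i <= N)%N -> X (z i)) /\
  (forall i j, (i <= j)%N -> (j <= N)%N -> kd X (z i) (z j) <= \sum_(i <= l < j) a l).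
Proof.
move=> X0 hs.
have Xz k : (k <= N)%N -> X (z k).
  by case: k => [//|k kN]; exact: (nstep_in (hs k kN)).2.
split => // i; elim=> [|j IH].
  by rewrite leqn0 => /eqP -> _; rewrite big_geq// kdxx.
rewrite leq_eqVlt => /orP[/eqP <- jN|ij jN]; first by rewrite big_geq// kdxx//; exact: Xz.
rewrite big_nat_recr//=.
have Xi : X (z i) by apply: Xz; lia.
apply: le_trans (kd_tri pX Xi (Xz j (ltnW jN)) (Xz _ jN)) _.
rewrite lerD//; first by apply: IH => //; exact: ltnW.
exact: (nstep_kd pX (hs j jN)).
Qed.

(** A chain that is shortest up to [e] as a whole has this property on each part, because the
    complementary parts are at least as long as the distances they span. *)
Lemma near_min_exists eta e x y : 0 < eta -> 0 < e -> X x -> X y ->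
  exists N (z : nat -> Cn) (a : nat -> R), [/\ z 0%N = x, z N = y & near_min eta e N z a].
Proof.
move=> eta0 e0 Xx Xy.
have [L cL Lk] := nchain_exists eta0 e0 Xx Xy.
have [N [z [a [z0 zN LE hs]]]] := chain_seq cL.
exists N, z, a; split => //.
have X0 : X (z 0%N) by rewrite z0.
have [Xz kz] := nchain_kd X0 hs.
split => // i j ij jN.
have iN := leq_trans ij jN.
have h1 := kz 0%N i (leq0n _) iN; have h2 := kz j N jN (leqnn _).
have LE' : L = \sum_(0 <= l < i) a l + \sum_(i <= l < j) a l + \sum_(j <= l < N) a l.
  by rewrite LE (big_cat_nat (leq0n i) iN) (big_cat_nat ij jN) /= addrA.
have := kd_tri pX (Xz 0%N (leq0n _)) (Xz i iN) (Xz N (leqnn _)).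
have := kd_tri pX (Xz i iN) (Xz j jN) (Xz N (leqnn _)).
rewrite z0 zN in h1 h2 *; lra.
Qed.

End ChainDistance.

(** * Lengths of curves *)

Section LowerIntegral.
Context d (T : measurableType d) (R : realType) (mu : {measure set T -> \bar R}).
Implicit Types (f g : T -> \bar R) (A B D : set T) (h : {nnsfun T >-> R}).
Local Open Scope ereal_scope.

(* The Kobayashi-Royden metric along a curve is not known to be measurable here;
   the integral of a nonnegative function is the supremum over the simple
   functions below it, which is still monotone and additive in the set. *)
Lemma nnsfun_le_integral D f h : measurable D -> (forall x, D x -> 0 <= f x) ->
  (forall x, D x -> (h x)%:E <= f x) -> \int[mu]_(x in D) (h x)%:E <= \int[mu]_(x in D) f x.
Proof.
move=> mD f0 hf; rewrite integral_nnsfun// (ge0_integralE mu f0).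
apply: ereal_sup_ubound; exists (proj_nnsfun h mD).
  move=> x; rewrite -(mrestrict h mD) /patch; case: ifPn => // xD.
  by apply: hf; exact: set_mem.
by rewrite (mrestrict h mD).
Qed.

Lemma integral_le_nnsfun D f (M : \bar R) : measurable D -> (forall x, D x -> 0 <= f x) ->
  (forall h, (forall x, D x -> (h x)%:E <= f x) -> \int[mu]_(x in D) (h x)%:E <= M) ->
  \int[mu]_(x in D) f x <= M.
Proof.
move=> mD f0 H; rewrite (ge0_integralE mu f0); apply: ge_ereal_sup => _ [h /= hf <-].
have -> : sintegral mu h = \int[mu]_(x in D) (h x)%:E.
  rewrite integral_nnsfun//; congr sintegral; apply/funext => x; rewrite /patch.
  case: ifPn => // xD; apply/eqP; rewrite eq_le fun_ge0 andbT.
  by have := hf x; rewrite /patch (negbTE xD) lee_fin.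
by apply: H => x Dx; have := hf x; rewrite /patch mem_set.
Qed.

Lemma le_integral_scale D f g (k : R) : measurable D -> (0 < k)%R ->
  (forall x, D x -> 0 <= f x) -> (forall x, D x -> 0 <= g x) ->
  (forall x, D x -> f x <= k%:E * g x) ->
  \int[mu]_(x in D) f x <= k%:E * \int[mu]_(x in D) g x.
Proof.
move=> mD k0 f0 g0 fg; apply: integral_le_nnsfun => // h hf.
rewrite -lee_pdivrMl//.
have ki0 : (0 <= k^-1)%R by rewrite invr_ge0 ltW.
rewrite -ge0_integralZl_EFin//; last 2 first.
- by move=> x _; rewrite lee_fin fun_ge0.
- by apply/measurable_EFinP; exact: measurable_funTS.
have := @nnsfun_le_integral D g (scale_nnsfun h ki0) mD g0.
move=> /(_ _)/le_trans; apply.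
  by move=> x Dx /=; rewrite EFinM lee_pdivrMl//; exact: le_trans (hf x Dx) (fg x Dx).
by [].
Qed.

(** Simple functions below [f] on [A] and on [B], extended by 0, add up to one below [f] on the
    union; this gives the inequality that is not immediate for a lower integral. *)
Lemma integral_setU_lower A B f : measurable A -> measurable B -> [disjoint A & B] ->
  (forall x, 0 <= f x) ->
  \int[mu]_(x in A `|` B) f x = \int[mu]_(x in A) f x + \int[mu]_(x in B) f x.
Proof.
move=> mA mB AB f0; have mAB : measurable (A `|` B) by exact: measurableU.
have hU h : \int[mu]_(x in A `|` B) (h x)%:E =
    \int[mu]_(x in A) (h x)%:E + \int[mu]_(x in B) (h x)%:E.
  apply: ge0_integral_setU => //.
    by apply/measurable_EFinP; exact: measurable_funTS.
  by move=> x _; rewrite lee_fin fun_ge0.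
apply/eqP; rewrite eq_le; apply/andP; split.
  apply: integral_le_nnsfun => // h hf; rewrite hU leeD//.
    by apply: nnsfun_le_integral => // x xA; apply: hf; left.
  by apply: nnsfun_le_integral => // x xB; apply: hf; right.
set I := (X in _ <= X).
have I0 D : 0 <= \int[mu]_(x in D) f x by exact: integral_ge0.
have H h1 h2 : (forall x, A x -> (h1 x)%:E <= f x) -> (forall x, B x -> (h2 x)%:E <= f x) ->
    \int[mu]_(x in A) (h1 x)%:E + \int[mu]_(x in B) (h2 x)%:E <= I.
  move=> hA hB.
  pose h := add_nnsfun (proj_nnsfun h1 mA) (proj_nnsfun h2 mB).
  have hE x : h x = ((h1 \_ A) x + (h2 \_ B) x)%R by rewrite (mrestrict h1 mA) (mrestrict h2 mB).
  have AB0 x : A x -> B x -> False by move=> Ax Bx; move/disj_setPS : AB => /(_ x); apply.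
  have hAE x : A x -> h x = h1 x.
    by move=> Ax; rewrite hE /patch mem_set// memNset ?addr0// => /(AB0 _ Ax).
  have hBE x : B x -> h x = h2 x.
    by move=> Bx; rewrite hE /patch memNset ?mem_set ?add0r// => /AB0; exact.
  rewrite [X in X + _](_ : _ = \int[mu]_(x in A) (h x)%:E); last first.
    by apply: eq_integral => x /set_mem /hAE ->.
  rewrite [X in _ + X](_ : _ = \int[mu]_(x in B) (h x)%:E); last first.
    by apply: eq_integral => x /set_mem /hBE ->.
  rewrite -hU; apply: nnsfun_le_integral => // x [Ax|Bx]; first by rewrite hAE// hA.
  by rewrite hBE// hB.
(* The two suprema are taken one after the other, each time subtracting the other term, which must
   be finite. *)
have [->|Ioo] := eqVneq I +oo; first by rewrite leey.
have Ifin : I \is a fin_num by rewrite ge0_fin_numE ?I0// lt_neqAle Ioo leey.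
have h0 D x : D x -> ((@nnsfun0 _ T R) x)%:E <= f x by rewrite /= => _; exact: f0.
have int0 D : \int[mu]_(x in D) ((@nnsfun0 _ T R) x)%:E = 0 by rewrite integral0_eq.
have Ifinle x : 0 <= x -> x <= I -> x \is a fin_num.
  move=> x0 xI; rewrite ge0_fin_numE//; apply: le_lt_trans xI _.
  by rewrite -ge0_fin_numE ?I0.
have fB : \int[mu]_(x in B) f x \is a fin_num.
  apply: Ifinle => //; apply: integral_le_nnsfun => // h hB.
  by rewrite -[leLHS]add0e -(int0 A); apply: H => // x; exact: h0.
rewrite -leeBrDr//; apply: integral_le_nnsfun => // h1 hA; rewrite leeBrDr//.
have fh : \int[mu]_(x in A) (h1 x)%:E \is a fin_num.
  apply: Ifinle; first by apply: integral_ge0 => x _; rewrite lee_fin fun_ge0.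
  by rewrite -[leLHS]adde0 -(int0 B); apply: H => // x; exact: h0.
rewrite -leeBrDl//; apply: integral_le_nnsfun => // h2 hB; rewrite leeBrDl//.
exact: H.
Qed.

End LowerIntegral.

Section LengthAdd.
Context {R : realType} {n : nat}.
Local Notation Cn := 'rV[Cplx R]_n.
Implicit Types (X Y : set Cn) (gamma : R -> Cn) (a b c k : R).
Local Open Scope ereal_scope.

Lemma kr_length_ge0 X gamma a b : 0 <= kr_length X gamma a b.
Proof. by apply: integral_ge0 => x _; exact: kr_ge0. Qed.

Lemma kr_length_itvU X gamma a b c : (a <= b)%R -> (b <= c)%R ->
  kr_length X gamma a c = kr_length X gamma a b + kr_length X gamma b c.
Proof.
move=> ab bc; rewrite /kr_length.
set f := fun t => kobayashi_royden X (gamma t) (velocity gamma t).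
have f0 t : 0 <= f t by exact: kr_ge0.
have -> : `[a, c]%classic = `[a, b[%classic `|` `[b, c]%classic.
  apply/seteqP; split => x /=; rewrite !in_itv /=.
    by move=> /andP[ax xc]; case: (ltP x b) => xb; [left|right]; rewrite ?ax ?xb ?xc.
  move=> [/andP[ax xb]|/andP[bx xc]]; first by rewrite ax ltW// (lt_le_trans xb).
  by rewrite xc (le_trans ab).
have -> : `[a, b]%classic = `[a, b[%classic `|` [set b].
  by rewrite setUitv1//= bnd_simp.
rewrite !integral_setU_lower//.
- by rewrite integral_set1 adde0.
- by apply/disj_setPS => x /= [xb xE]; move: xb; rewrite xE in_itv /= ltxx andbF.
- apply/disj_setPS => x /= []; rewrite !in_itv /= => /andP[_ xb] /andP[bx _].
  by move: xb; rewrite ltNge bx.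
Qed.

Lemma kr_length_scale X Y gamma a b k : (0 < k)%R ->
  (forall t, (a <= t)%R -> (t <= b)%R ->
     kobayashi_royden Y (gamma t) (velocity gamma t) <=
     k%:E * kobayashi_royden X (gamma t) (velocity gamma t)) ->
  kr_length Y gamma a b <= k%:E * kr_length X gamma a b.
Proof.
move=> k0 h; apply: le_integral_scale => //.
- by move=> t _; exact: kr_ge0.
- by move=> t _; exact: kr_ge0.
by move=> t /=; rewrite in_itv /= => /andP[]; exact: h.
Qed.

(** The bound is asked for inside the interval only: a polygon need not have a velocity at its
    vertices, and two points are negligible. *)
Lemma kr_length_const X gamma a b k : (a <= b)%R -> (0 <= k)%R ->
  (forall t, (a < t)%R -> (t < b)%R ->
     kobayashi_royden X (gamma t) (velocity gamma t) <= k%:E) ->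
  kr_length X gamma a b <= (k * (b - a))%:E.
Proof.
move=> ab k0 h; rewrite /kr_length.
set f := fun t => kobayashi_royden X (gamma t) (velocity gamma t).
have f0 t : 0 <= f t by exact: kr_ge0.
move: ab; rewrite le_eqVlt => /orP[/eqP<-|ab].
  by rewrite set_itv1 integral_set1 subrr mulr0.
have -> : `[a, b]%classic = [set a] `|` (`]a, b[%classic `|` [set b]).
  by rewrite setUitv1 ?bnd_simp// setU1itv ?bnd_simp// ltW.
rewrite integral_setU_lower//; last 2 first.
- by apply: measurableU.
- apply/disj_setPS => x /= [->] [|ab']; first by rewrite in_itv /= ltxx.
  by move: ab; rewrite ab' ltxx.
rewrite integral_setU_lower//; last first.
  by apply/disj_setPS => x /= [xb xE]; move: xb; rewrite xE in_itv /= ltxx andbF.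
rewrite !integral_set1 add0e adde0.
apply: integral_le_nnsfun => [//|x _|g gf]; first exact: f0.
apply: (@le_trans _ _ (\int[lebesgue_measure]_(x in `]a, b[) cst k%:E x)).
  apply: ge0_le_integral => //.
  - by move=> x _; rewrite lee_fin fun_ge0.
  - by apply/measurable_EFinP; exact: measurable_funTS.
  - move=> x; rewrite /= in_itv /= => /andP[ax xb].
    by apply: le_trans (gf x _) (h x ax xb); rewrite /= in_itv /= ax.
by rewrite integral_cst//= lebesgue_measure_itv /= lte_fin ab -EFinM.
Qed.

End LengthAdd.

(** * Polygons *)

Section Polygon.
Context {R : realType} {n : nat}.
Local Notation C := (Cplx R).
Local Notation Cn := 'rV[Cplx R]_n.
Implicit Types (X : set Cn) (x y u v w : Cn) (z : nat -> Cn) (a : nat -> R) (s t e eta : R).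

Definition clamp t : R := Num.min (Num.max t 0) 1.

Lemma clamp_le0 t : t <= 0 -> clamp t = 0.
Proof. by move=> t0; rewrite /clamp max_r// min_l. Qed.

Lemma clamp_ge1 t : 1 <= t -> clamp t = 1.
Proof. by move=> t1; rewrite /clamp max_l ?min_r//; lra. Qed.

Lemma clamp_id t : 0 <= t -> t <= 1 -> clamp t = t.
Proof. by move=> t0 t1; rewrite /clamp max_l ?min_l//; lra. Qed.

Lemma clamp_lip s t : s <= t -> `|clamp t - clamp s| <= t - s.
Proof.
move=> st.
case: (leP t 0) => [t0|t0]; first by rewrite !clamp_le0 ?subrr ?normr0; lra.
case: (leP 1 s) => [s1|s1]; first by rewrite !clamp_ge1 ?subrr ?normr0; lra.
have [ct c1] : clamp t <= t /\ 0 <= clamp t.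
  by case: (leP t 1) => [t1|t1]; [rewrite clamp_id|rewrite clamp_ge1]; lra.
have [ct1] : clamp t <= 1 by rewrite /clamp ge_min lexx orbT.
have [cs] : s <= clamp s.
  by case: (leP s 0) => [s0|s0]; [rewrite clamp_le0|rewrite clamp_id]; lra.
have cst : clamp s <= clamp t.
  case: (leP s 0) => [s0|s0]; first by rewrite clamp_le0.
  rewrite (clamp_id (ltW s0) (ltW s1)).
  by case: (leP t 1) => [t1|t1]; [rewrite clamp_id|rewrite clamp_ge1]; lra.
by rewrite ger0_norm; lra.
Qed.

(** Edge [i] is traversed during [[i, i + 1]]. Written as one sum of clamped increments, the curve
    is Lipschitz on the whole line. *)
Definition polygon N z t : Cn :=
  z 0%N + \sum_(0 <= i < N) ((clamp (t - i%:R))%:C : C) *: (z i.+1 - z i).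

Lemma polygon_seg N z i t : (i < N)%N -> i%:R <= t -> t <= i.+1%:R ->
  polygon N z t = seg (z i) (z i.+1) (t - i%:R).
Proof.
move=> iN it ti; rewrite /polygon /seg.
rewrite (big_cat_nat (leq0n i) (ltnW iN)) /= (big_ltn iN).
have -> : \sum_(0 <= l < i) ((clamp (t - l%:R))%:C : C) *: (z l.+1 - z l) = z i - z 0%N.
  rewrite -(telescope_sumr z (leq0n i)); apply: eq_big_nat => l /andP[_ li].
  rewrite clamp_ge1 ?scale1r// lerBrDl natr1.
  by apply: le_trans it; rewrite ler_nat.
have -> : \sum_(i.+1 <= l < N) ((clamp (t - l%:R))%:C : C) *: (z l.+1 - z l) = 0.
  rewrite big_nat_cond big1// => l /andP[/andP[il _] _].
  rewrite clamp_le0 ?scale0r// subr_le0; apply: le_trans ti _.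
  by rewrite ler_nat.
rewrite addr0 addrA subrKC clamp_id//; first by rewrite subr_ge0.
by rewrite lerBlDl natr1.
Qed.

Lemma polygon_lip N z s t : s <= t ->
  nrm (polygon N z t - polygon N z s) <= (\sum_(0 <= i < N) nrm (z i.+1 - z i)) * (t - s).
Proof.
move=> st; rewrite /polygon opprD addrACA subrr add0r -sumrB.
elim: N => [|N IH]; first by rewrite !big_geq// nrm0 mul0r.
rewrite !big_nat_recr//= mulrDl; apply: le_trans (nrmD _ _) _.
rewrite lerD// -scalerBl -rcB nrmZ modulusR mulrC ler_wpM2l ?nrm_ge0//.
by apply: le_trans (clamp_lip _) _; lra.
Qed.

Lemma lipschitz_ac (b c M : R) (g : R -> Cn) : 0 <= M ->
  (forall s t, s <= t -> nrm (g t - g s) <= M * (t - s)) -> absolutely_continuous b c g.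
Proof.
move=> M0 hg e e0; have M10 : 0 < M + 1 by rewrite ltr_wpDl.
exists (e / (M + 1)); first by rewrite divr_gt0.
move=> m s t hst _ hsum.
under eq_bigr do rewrite nrmE.
rewrite -rmorph_sum ltcR.
apply: (@le_lt_trans _ _ (\sum_(i < m) (M + 1) * (t i - s i))).
  apply: ler_sum => i _; have [_ st _] := hst i.
  by apply: le_trans (hg _ _ st) _; rewrite ler_wpM2r ?subr_ge0// lerDl.
by rewrite -mulr_sumr mulrC -ltr_pdivlMr.
Qed.

Lemma polygon_velocity N z i t : (i < N)%N -> i%:R < t -> t < i.+1%:R ->
  velocity (polygon N z) t = z i.+1 - z i.
Proof.
move=> iN it ti; apply/cvg_lim => //.
apply: cvg_trans (cvg_cst (z i.+1 - z i)).
apply: near_eq_cvg; rewrite near_withinE.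
have d0 : 0 < Num.min (t - i%:R) (i.+1%:R - t) by rewrite lt_min !subr_gt0 it.
exists (Num.min (t - i%:R) (i.+1%:R - t)) => // h /=.
rewrite sub0r normrN lt_min !ltr_norml => /andP[/andP[h1 h2] /andP[h3 h4]] h0.
rewrite !(@polygon_seg _ _ i)//; [|lra..].
rewrite /seg opprD addrACA subrr add0r -scalerBl -rcB scalerA -rmorphM /=.
by rewrite opprB addrA subrK addrK mulVf// scale1r.
typeclasses eauto.
Qed.

Lemma time_index (N : nat) s t : (0 < N)%N -> 0 <= s -> s <= t -> t <= N%:R ->
  exists i j, [/\ (i <= j)%N, (j < N)%N, i%:R <= s <= i.+1%:R & j%:R <= t <= j.+1%:R].
Proof.
elim: N s t => // N IH s t _ s0 st tN.
have [N0|N0] := posnP N.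
  by exists 0%N, 0%N; rewrite N0 in tN *; split => //; apply/andP; split => //; lra.
have [tN'|tN'] := leP t N%:R.
  have [i [j [? ? ? ?]]] := IH s t N0 s0 st tN'.
  by exists i, j; split => //; exact: ltnW.
have [sN|sN] := leP N%:R s.
  by exists N, N; split => //; apply/andP; split => //; [exact: le_trans tN|exact: ltW].
have [i [j [? ? ? ?]]] := IH s s N0 s0 (lexx _) (ltW sN).
by exists i, N; split => //; [lia|apply/andP; split => //; exact: ltW].
Qed.

Variable X : set Cn.
Hypotheses (dX : domain X) (pX : pseudodistance_on X (kobayashi X)).

Lemma polygon_length eta e N z a i j : near_min X eta e N z a ->
  (i <= j)%N -> (j <= N)%N ->
  (kr_length X (polygon N z) i%:R j%:R <= (\sum_(i <= l < j) a l)%:E)%E.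
Proof.
move=> [hs _]; elim: j => [|j IH].
  rewrite leqn0 => /eqP -> _; rewrite big_geq// /kr_length set_itv1 integral_set1//.
rewrite leq_eqVlt => /orP[/eqP <- _|ij jN].
  by rewrite big_geq// /kr_length set_itv1 integral_set1.
rewrite big_nat_recr//= EFinD (@kr_length_itvU _ _ _ _ _ j%:R) ?ler_nat//.
apply: leeD; first by apply: IH => //; exact: ltnW.
have [a0 _ _ hseg] := hs j jN.
have -> : a j = a j * (j.+1%:R - j%:R) by rewrite -natrB// subSnn mulr1.
apply: kr_length_const => //; first by rewrite ler_nat.
move=> t jt tj; rewrite (polygon_velocity z jN jt tj) (polygon_seg z jN (ltW jt) (ltW tj)).
have [[_ h] _ _ _ _] := hseg (t - j%:R) ltac:(lra) ltac:(rewrite -natr1 in tj; lra).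
exact: h.
Qed.

Lemma polygon_on eta e N z a i t : near_min X eta e N z a -> (i < N)%N ->
  i%:R <= t <= i.+1%:R -> step_seg X eta (z i) (z i.+1) (a i) (polygon N z t).
Proof.
move=> [hs _] iN /andP[it ti]; rewrite (polygon_seg z iN it ti).
have [_ _ _ hseg] := hs i iN.
by apply: hseg; [lra|rewrite -natr1 in ti; lra].
Qed.

(** A piece of the polygon is extended to the enclosing vertices [i] and [j.+1], where near
    minimality applies; returning to its two ends costs at most [eta] each. *)
Lemma polygon_geodesic eta e N z a : 0 <= eta -> X (z 0%N) -> near_min X eta e N z a ->
  geodesic 1 (e + 2 * eta) X 0 N%:R (polygon N z).
Proof.
move=> eta0 X0 nm; have [hs ha] := nm.
have Xz i : (i <= N)%N -> X (z i).
  by case: i => // i iN; have [] := nstep_in (hs i iN).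
have Xp t : 0 <= t -> t <= N%:R -> X (polygon N z t).
  move=> t0 tN; have [N0|N0] := posnP N.
    by rewrite /polygon N0 big_geq// addr0.
  have [i [j [ij jN _ jt]]] := time_index N0 t0 (lexx t) tN.
  by have [[]] := polygon_on nm jN jt.
split => //.
- apply: lipschitz_ac (fun s t => @polygon_lip N z s t).
  by apply: sumr_ge0 => i _; exact: nrm_ge0.
- by move=> x [t tI <-]; move: tI; rewrite /= in_itv /= => /andP[t0 tN]; exact: Xp.
move=> s t s0 st tN; have t0 := le_trans s0 st; have sN := le_trans st tN.
rewrite mul1e (kdE pX); [|exact: Xp..].
have [N0|N0] := posnP N.
  have -> : s = t by apply/eqP; rewrite eq_le st; move: tN; rewrite N0; lra.
  rewrite /kr_length set_itv1 integral_set1 -EFinD lee_fin kdxx//; last exact: Xp.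
  by have := ha 0%N 0%N (leqnn _) (leq0n _); rewrite big_geq// kdxx//; lra.
have [i [j [ij jN it jt]]] := time_index N0 s0 st tN.
have [[Xs _] _ _ h1 _] := polygon_on nm (leq_ltn_trans ij jN) it.
have [[Xt _] _ _ _ h2] := polygon_on nm jN jt.
move: it jt => /andP[i1 i2] /andP[j1 j2].
apply: (@le_trans _ _ (kr_length X (polygon N z) i%:R j.+1%:R)).
  rewrite (@kr_length_itvU _ _ _ _ i%:R s j.+1%:R)//; last exact: le_trans j2.
  rewrite (@kr_length_itvU _ _ _ _ s t j.+1%:R)//.
  by rewrite addeCA leeDl// adde_ge0// kr_length_ge0.
apply: le_trans (polygon_length nm _ _) _; [exact: leqW|exact: jN|].
have := ha i j.+1 (leqW ij) jN => hij.
rewrite -EFinD lee_fin.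
have Xi : X (z i) by apply: Xz; exact: leq_trans ij (ltnW jN).
have Xj : X (z j.+1) by exact: Xz.
have t1 := kd_tri pX Xi Xs Xj; have t2 := kd_tri pX Xs Xt Xj.
lra.
Qed.

Lemma geodesic_weaken lambda (eps : R) (b c : R) g : 1 <= lambda ->
  geodesic 1 eps X b c g -> geodesic lambda eps X b c g.
Proof.
move=> l1 [bc ac gX h]; split => // s t bs st tc.
apply: le_trans (h s t bs st tc) _; rewrite leeD2r// lee_wpmul2r ?lee_fin//.
rewrite (kdE pX); first by rewrite lee_fin kd_ge0//; apply: gX; [exists s|exists t] => //=;
  rewrite in_itv/=; apply/andP; split => //; [exact: le_trans tc|exact: le_trans st].
- by apply: gX; exists s => //=; rewrite in_itv /= bs (le_trans st).
- by apply: gX; exists t => //=; rewrite in_itv /= tc (le_trans bs).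
Qed.

(** Visibility speaks of curves; applied to the polygon of the chain it gives a point of [K] on some
    edge, whose first vertex is within [eta]. *)
Lemma visible_chain lambda eps eta e N z a (U V K : set Cn) : 1 <= lambda -> 0 <= eta ->
  e + 2 * eta <= eps ->
  (forall (b c : R) (g : R -> Cn), geodesic lambda eps X b c g ->
     (X `&` V) (g b) -> (X `\` U) (g c) -> (g @` `[b, c]%classic) `&` K !=set0) ->
  X (z 0%N) -> V (z 0%N) -> X (z N) -> ~ U (z N) -> near_min X eta e N z a -> U (z 0%N) ->
  exists i q, [/\ (i < N)%N, K q & nrm (z i - q) <= eta].
Proof.
move=> l1 eta0 ee vis X0 V0 XN UN nm U0.
have [N0|N0] := posnP N; first by move: UN; rewrite N0.
have nz0 : polygon N z 0 = z 0%N.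
  rewrite (@polygon_seg N z 0 0)//; first by rewrite subr0 seg0.
have nzN : polygon N z N%:R = z N.
  case: N N0 {vis nm XN UN nz0} => // N _.
  by rewrite (@polygon_seg _ z N)// ?ler_nat// -natrB// subSnn seg1.
have geo : geodesic lambda eps X 0 N%:R (polygon N z).
  have := geodesic_weaken l1 (polygon_geodesic eta0 X0 nm).
  move=> [h1 h2 h3 h4]; split => // s t s0 st tN; apply: le_trans (h4 s t s0 st tN) _.
  by rewrite leeD2l// lee_fin.
have [||q [[t /= tN] <-] Kq] := vis 0 N%:R (polygon N z) geo.
- by rewrite nz0.
- by rewrite nzN.
move: tN; rewrite in_itv /= => /andP[t0 tN].
have [i [j [ij jN _ jt]]] := time_index N0 t0 (lexx t) tN.
exists j, (polygon N z t); split => //.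
by have [_ h _ _ _] := polygon_on nm jN jt; rewrite nrmB.
Qed.

End Polygon.

Lemma artanh_ub2 (R : realType) (q k B : R) :
  q <= B -> q <= k -> 0 <= q -> k <= 2^-1 -> artanh q <= (1 + 2 * k) * B.
Proof.
move=> qB qk q0 k12.
apply: le_trans (artanh_ub q0 _) _; first lra.
apply: (@le_trans _ _ (q * (1 + 2 * q))).
  rewrite ler_pdivrMr; last lra.
  have : 0 <= q * q * (1 - 2 * q) by rewrite mulr_ge0 ?mulr_ge0//; lra.
  lra.
by rewrite mulrC ler_pM//; lra.
Qed.

(** * Localization *)

Section Transfer.
Context {R : realType} {n : nat}.
Local Notation C := (Cplx R).
Local Notation Cn := 'rV[Cplx R]_n.
Implicit Types (x y u v w : Cn) (z : nat -> Cn) (a : nat -> R) (s t e eta r T W : R).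

Definition discs_near X (p : Cn) (r0 c0 : R) := forall phi : C -> Cn,
  holomorphic_disc X phi -> nrm (phi 0 - p) < c0 ->
  forall zeta : C, modulus zeta < c0 -> nrm (phi zeta - p) < r0.

Variables (X Y : set Cn) (p : Cn) (r0 c0 : R).
Hypotheses (dX : domain X) (pX : pseudodistance_on X (kobayashi X)).
Hypotheses (pY : pseudodistance_on Y (kobayashi Y)).
Hypotheses (c00 : 0 < c0) (c01 : c0 < 1) (c0r0 : c0 <= r0).
Hypothesis XY : forall x, nrm (x - p) < r0 -> X x -> Y x.
Hypothesis near_X : discs_near X p r0 c0.

Definition far_by (x : Cn) (m : R) :=
  forall w, X w -> r0 <= nrm (w - p) -> m <= kd X x w.

(** A radius up to which discs of [X] stay in [Y]. The constant [c0] keeps it away from 0 when [m]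
    is small or negative. *)
Definition ratio (m : R) : R := Num.max c0 (th m).

Lemma ratio_gt0 (m : R) : 0 < ratio m.
Proof. by rewrite lt_max c00. Qed.

Lemma ratio_le1 (m : R) : ratio m <= 1.
Proof. by rewrite ge_max !ltW// th_lt1. Qed.

Lemma ratio_ge (m : R) : c0 <= ratio m.
Proof. by rewrite le_max lexx. Qed.

(** The constant combines [1 - th m <= 2 * expR (- (2 * m))] with [ratio m >= c0]. *)
Lemma ratio_inv (m : R) : (ratio m)^-1 <= 1 + 2 / c0 * expR (- (2 * m)).
Proof.
have r1 := ratio_gt0 m.
have -> : (ratio m)^-1 = 1 + (1 - ratio m) / ratio m by field; rewrite gt_eqF.
rewrite lerD2l; have E0 := expR_gt0 (2 * m).
have h1 : 1 - ratio m <= 2 * expR (- (2 * m)).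
  have : th m <= ratio m by rewrite le_max lexx orbT.
  have -> : th m = 1 - 2 / (expR (2 * m) + 1) by rewrite /th; field; rewrite gt_eqF// addr_gt0.
  have : 2 / (expR (2 * m) + 1) <= 2 * expR (- (2 * m)).
    by rewrite expRN ler_wpM2l// lef_pV2 ?posrE ?addr_gt0// lerDl.
  lra.
have h2 : 0 <= 1 - ratio m by rewrite subr_ge0 ratio_le1.
have h3 : (ratio m)^-1 <= c0^-1 by rewrite lef_pV2 ?posrE ?ratio_ge.
have ci : 0 <= c0^-1 by rewrite invr_ge0 ltW.
rewrite mulrAC; apply: le_trans (ler_wpM2l h2 h3) _.
by rewrite ler_wpM2r.
Qed.

Lemma disc_ratio phi (m : R) : holomorphic_disc X phi -> nrm (phi 0 - p) < c0 ->
  far_by (phi 0) m -> forall zeta : C, modulus zeta < ratio m -> Y (phi zeta).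
Proof.
move=> hphi pc fm zeta zr.
have z1 : modulus zeta < 1 := lt_le_trans zr (ratio_le1 m).
have Xz : X (phi zeta) := disc_in hphi z1.
apply: XY => //; move: zr; rewrite lt_max => /orP[|zth]; first exact: near_X.
rewrite ltNge; apply/negP => /(fm _ Xz) h.
have := le_trans h (kd_disc pX hphi z1).
rewrite le_artanh//; first by rewrite leNgt zth.
by apply: lt_le_trans (modulus_ge0 _); rewrite oppr_lt0.
Qed.

Lemma kr_local x v (m : R) : nrm (x - p) < c0 -> far_by x m ->
  (kobayashi_royden Y x v <=
    (1 + 2 / c0 * expR (- (2 * m)))%:E * kobayashi_royden X x v)%E.
Proof.
move=> xp fm.
apply: le_trans (@kr_transfer _ _ X Y x v (ratio m) (ratio_gt0 m) (ratio_le1 m) _) _.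
  by move=> phi hphi p0; apply: disc_ratio hphi _ _; rewrite p0.
by rewrite lee_wpmul2r ?kr_ge0// lee_fin ratio_inv.
Qed.

(** The end of the step has parameter at most [b], which rescaling divides by [ratio m]. The
    quotient [q] is at most [eta / c0], and the first factor absorbs the excess of [artanh q] over
    [q]. *)
Lemma kd_local eta x y (b m : R) : step_disc X x y b -> b <= eta -> eta <= c0 / 2 ->
  nrm (x - p) < c0 -> far_by x m ->
  kd Y x y <= (1 + 2 * eta / c0) * (b * (1 + 2 / c0 * expR (- (2 * m)))).
Proof.
move=> [phi [zeta [hphi p0 pz z1 zb]]] be ec xp fm.
have m0 := modulus_ge0 zeta.
have zle : modulus zeta <= b by apply: le_trans (artanh_lb m0 z1) zb.
have b0 : 0 <= b by exact: le_trans zle.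
have rge := ratio_ge m; have rgt := ratio_gt0 m.
have zr : modulus zeta < ratio m by lra.
have hY : forall w : C, modulus w < ratio m -> Y (phi w).
  by apply: disc_ratio hphi _ _; rewrite p0.
have := kd_transfer pY hphi rgt (ratio_le1 m) hY zr; rewrite p0 pz => /le_trans; apply.
have qb : modulus zeta / ratio m <= b * (1 + 2 / c0 * expR (- (2 * m))).
  by rewrite ler_pM ?invr_ge0 ?(ltW rgt)// ratio_inv.
have qe : modulus zeta / ratio m <= eta / c0.
  apply: (@le_trans _ _ (b / c0)); last by rewrite ler_pM2r ?invr_gt0.
  by rewrite ler_pM ?invr_ge0 ?(ltW rgt)// lef_pV2.
have q0 : 0 <= modulus zeta / ratio m by rewrite divr_ge0// ltW.
have e12 : eta / c0 <= 2^-1 by rewrite ler_pdivrMr// mulrC.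
have eE : 2 * eta / c0 = 2 * (eta / c0) by rewrite mulrA.
rewrite eE; move: (modulus zeta / _) (eta / c0) (b * _) qb qe q0 e12 => q k B qB qk q0 k12.
exact: artanh_ub2.
Qed.

Lemma kd_chain_local eta N z a (m : nat -> R) : eta <= c0 / 2 -> X (z 0%N) ->
  (forall i, (i < N)%N -> nstep X eta (z i) (z i.+1) (a i)) ->
  (forall i, (i < N)%N -> nrm (z i - p) < c0 /\ far_by (z i) (m i)) ->
  nrm (z 0%N - p) < c0 ->
  Y (z N) /\ kd Y (z 0%N) (z N) <= (1 + 2 * eta / c0) *
     (\sum_(0 <= i < N) a i + 2 / c0 * \sum_(0 <= i < N) a i * expR (- (2 * m i))).
Proof.
move=> ec X0 hs hz z0.
have Y0 : Y (z 0%N) by apply: XY => //; exact: lt_le_trans c0r0.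
elim: N hs hz => [|N IH] hs hz.
  by split => //; rewrite !big_geq// kdxx// mulr0 addr0 mulr0.
have [YN kN] := IH (fun i iN => hs i (ltnW iN)) (fun i iN => hz i (ltnW iN)).
have [zN fN] := hz N (leqnn _).
have [aN0 aNe sd sg] := hs N (leqnn _).
(* The parameter of the next vertex is below [c0], and up to radius [c0] the whole disc lies in
   [Y]. *)
have YS : Y (z N.+1).
  case: (sd) => phi [zeta [hphi p0 pz z1 zb]]; rewrite -pz.
  have mm := modulus_ge0 zeta.
  apply: disc_ratio hphi _ _ _ _; [by rewrite p0|by rewrite p0; exact: fN|].
  apply: le_lt_trans (le_trans (artanh_lb mm z1) (le_trans zb (le_trans aNe ec))) _.
  by apply: lt_le_trans (ratio_ge _); rewrite ltr_pdivrMr// ltr_pMr// ltr1n.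
split => //.
apply: le_trans (kd_tri pY Y0 YN YS) _.
apply: le_trans (lerD kN (kd_local sd aNe ec zN fN)) _.
rewrite !big_nat_recr//=; rewrite le_eqVlt; apply/orP; left; apply/eqP.
set A := \sum_(0 <= i < N) a i; set B := \sum_(0 <= i < N) a i * _; set E := expR _.
by ring.
Qed.

(* With steps this small, the error of [artanh q <= q + O(q^2)] adds up to at
   most 1 along a chain of length [T] and weighted sum [W]. *)
Definition mesh T W : R := c0 / 2 / (1 + T + 2 / c0 * W).

Lemma mesh_gt0 T W : 0 <= T -> 0 <= W -> 0 < mesh T W.
Proof.
move=> T0 W0; rewrite !divr_gt0//.
have : 0 <= 2 / c0 * W by rewrite mulr_ge0// divr_ge0// ltW.
lra.
Qed.

Lemma kd_chain_mesh T W eta N z a (m : nat -> R) : 0 <= T -> 0 <= W -> eta <= mesh T W ->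
  X (z 0%N) ->
  (forall i, (i < N)%N -> nstep X eta (z i) (z i.+1) (a i)) ->
  (forall i, (i < N)%N -> nrm (z i - p) < c0 /\ far_by (z i) (m i)) ->
  nrm (z 0%N - p) < c0 ->
  \sum_(0 <= i < N) a i <= T ->
  \sum_(0 <= i < N) a i * expR (- (2 * m i)) <= W ->
  Y (z N) /\ kd Y (z 0%N) (z N) <= \sum_(0 <= i < N) a i + (2 / c0 * W + 1).
Proof.
move=> T0 W0 em X0 hs hz z0 sT sW.
have cW : 0 <= 2 / c0 * W by rewrite mulr_ge0// divr_ge0// ltW.
have D0 : 0 < 1 + T + 2 / c0 * W by lra.
have emD : eta * (1 + T + 2 / c0 * W) <= c0 / 2 by move: em; rewrite /mesh ler_pdivlMr.
have ec : eta <= c0 / 2.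
  apply: le_trans em _; rewrite /mesh ler_pdivrMr//.
  have : 0 <= c0 / 2 * (T + 2 / c0 * W) by rewrite mulr_ge0 ?divr_ge0 ?(ltW c00)// addr_ge0.
  lra.
have [YN k] := kd_chain_local ec X0 hs hz z0; split => //.
apply: le_trans k _.
have [->|N0] := posnP N.
  by rewrite !big_geq// mulr0 addr0 mulr0; lra.
have eta0 : 0 <= eta by have [a0 ae _ _] := hs 0%N N0; exact: le_trans ae.
have a0 i : (i < N)%N -> 0 <= a i by move=> /hs[].
set A := \sum_(0 <= i < N) a i in sT *; set B := \sum_(0 <= i < N) _ in sW *.
have A0 : 0 <= A by rewrite /A big_nat_cond sumr_ge0// => i /andP[/andP[_ /a0]].
have c2 : 0 <= 2 / c0 by rewrite divr_ge0// ltW.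
have B2 : 2 / c0 * B <= 2 / c0 * W by rewrite ler_wpM2l.
have S1 : A + 2 / c0 * B <= A + 2 / c0 * W by lra.
have q0 : 0 <= 2 * eta / c0 by rewrite divr_ge0 ?mulr_ge0// ltW.
apply: (@le_trans _ _ ((1 + 2 * eta / c0) * (A + 2 / c0 * W))).
  by rewrite ler_wpM2l//; lra.
rewrite mulrDl mul1r addrA lerD2l.
apply: (@le_trans _ _ (2 * eta / c0 * (1 + T + 2 / c0 * W))).
  by rewrite ler_wpM2l//; lra.
rewrite (_ : 2 * eta / c0 * _ = 2 * (eta * (1 + T + 2 / c0 * W)) / c0); last by ring.
rewrite ler_pdivrMr// mul1r; lra.
Qed.

End Transfer.

(** * Distances from points near [p] to the outside of the ball *)

Section LocalComparison.
Context {R : realType} {n : nat}.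
Local Notation C := (Cplx R).
Local Notation Cn := 'rV[Cplx R]_n.
Implicit Types (X Y : set Cn) (x y u v w o p : Cn) (z : nat -> Cn) (a : nat -> R) (s t e eta r T W : R).

Lemma wsum_bound_ge0 (A B : R) : 0 < A -> 0 <= wsum_bound A B.
Proof. by move=> A0; rewrite mulr_ge0 ?expR_ge0// divr_ge0// ltW. Qed.

Lemma sum_nat_ge0 a i j N : (forall l, (l < N)%N -> 0 <= a l) -> (j <= N)%N ->
  0 <= \sum_(i <= l < j) a l.
Proof.
move=> a0 jN; rewrite big_nat_cond sumr_ge0// => l /andP[/andP[_ lj] _].
by apply: a0; exact: leq_trans jN.
Qed.

Lemma first_exit z p r k : r <= nrm (z k - p) ->
  exists j, [/\ (j <= k)%N, r <= nrm (z j - p) &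
    forall i, (i < j)%N -> nrm (z i - p) < r].
Proof.
move=> hk; have [j hj jmin] := ex_minnP (ex_intro (fun k => r <= nrm (z k - p)) k hk).
exists j; split => //; first exact: jmin.
by move=> i ij; rewrite ltNge; apply/negP => /jmin; rewrite leqNgt ij.
Qed.

Lemma near_min_prefix X eta e N k z a : (k <= N)%N ->
  near_min X eta e N z a -> near_min X eta e k z a.
Proof.
move=> kN [hs hm]; split => [i ik|i j ij jk]; first by apply: hs; exact: leq_trans kN.
by apply: hm => //; exact: leq_trans kN.
Qed.

Lemma sum_nat_rev a N i j : (i <= j)%N -> (j <= N)%N ->
  \sum_(i <= l < j) a (N - l.+1)%N = \sum_(N - j <= l < N - i) a l.
Proof.
elim: j => [|j IH]; first by rewrite leqn0 => /eqP -> _; rewrite !big_geq.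
rewrite leq_eqVlt => /orP[/eqP <- _|ij jN]; first by rewrite !big_geq.
have h : (N - j.+1 < N - i)%N by lia.
rewrite big_nat_recr//= (IH ij (ltnW jN)) [RHS]big_ltn// addrC.
by congr (_ + _); congr (\sum_(_ <= _ < _) _); lia.
Qed.

Lemma near_min_rev X eta e N z a : pseudodistance_on X (kobayashi X) -> X (z 0%N) ->
  near_min X eta e N z a ->
  near_min X eta e N (fun i => z (N - i)%N) (fun i => a (N - i.+1)%N).
Proof.
move=> pX X0 [hs hm]; have [Xz _] := nchain_kd pX X0 hs; split => [i iN|i j ij jN].
  apply: nstep_sym => //; rewrite (_ : (N - i = (N - i.+1).+1)%N); last by lia.
  by apply: hs; lia.
rewrite kdC//; [|by apply: Xz; lia..].
have h : (N - j <= N - i)%N by lia.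
apply: le_trans (hm _ _ h (leq_subr _ _)); rewrite le_eqVlt; apply/orP; left; apply/eqP.
exact: sum_nat_rev.
Qed.

(** A nearly shortest chain is taken to an almost nearest outside point and cut at its first exit.
    It exceeds the shortest way out by at most 2, so each vertex is as far from the outside as the
    remaining length, minus 2. This is the hypothesis of [wsum_bwd] with [A = 1] and [B = 2], and
    the exit point can be taken for [u]. *)
Lemma far_shadow X Y p r0 c0 r x w : domain X ->
  pseudodistance_on X (kobayashi X) -> pseudodistance_on Y (kobayashi Y) ->
  0 < c0 -> c0 < 1 -> c0 <= r0 -> (forall u, nrm (u - p) < r0 -> X u -> Y u) ->
  discs_near X p r0 c0 -> r <= c0 ->
  X x -> nrm (x - p) < r -> X w -> r <= nrm (w - p) ->
  exists u, [/\ Y u, r <= nrm (u - p) &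
    kd Y x u <= kd X x w + (3 + 2 / c0 * wsum_bound 1 2)].
Proof.
move=> dX pX pY c00 c01 c0r0 XY near_X rc0 Xx xr Xw wr.
pose E := [set kd X x u | u in [set u | X u /\ r <= nrm (u - p)]].
have lE : lbound E 0 by move=> _ [u [Xu _] <-]; exact: kd_ge0.
have iE : has_inf E by split; [exists (kd X x w), w|exists 0].
have Ef u : X u -> r <= nrm (u - p) -> inf E <= kd X x u.
  by move=> Xu ur; apply: ge_inf; [exists 0|exists u].
have f0 : 0 <= inf E by apply: lb_le_inf => //; exact: iE.1.
have [_ [u [Xu ur] <-] uf] := inf_adherent ltr01 iE.
set f := inf E in Ef f0 uf.
(* One unit for the choice of [u], one for the defect of the chain; the rounding error of the mesh
   adds the third unit of the statement. *)
pose T := f + 2; pose W := wsum_bound (1 : R) 2.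
have T0 : 0 <= T by rewrite addr_ge0.
have W0 : 0 <= W by exact: wsum_bound_ge0.
have [N [z [a [z0 zN nm]]]] := near_min_exists dX pX (mesh_gt0 c00 T0 W0) ltr01 Xx Xu.
have [j [jN zj hj]] : exists j, [/\ (j <= N)%N, r <= nrm (z j - p) &
    forall i, (i < j)%N -> nrm (z i - p) < r] by apply: first_exit; rewrite zN.
have [hs hm] := nm.
have X0 : X (z 0%N) by rewrite z0.
have [Xz kz] := nchain_kd pX X0 hs.
have a0 l : (l < N)%N -> 0 <= a l by move=> /hs[].
have sT : \sum_(0 <= l < j) a l <= T.
  apply: (@le_trans _ _ (\sum_(0 <= l < N) a l)).
    by rewrite (big_cat_nat (leq0n _) jN)/= lerDl; exact: sum_nat_ge0 a0 _.
  by apply: le_trans (hm 0%N N (leq0n _) (leqnn _)) _; rewrite z0 zN /T; lra.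
have hs' i : (i < j)%N -> nstep X (mesh c0 T W) (z i) (z i.+1) (a i).
  by move=> ij; apply: hs; exact: leq_trans jN.
pose m i := \sum_(i <= l < j) a l - 2.
have hz i : (i < j)%N -> nrm (z i - p) < c0 /\ far_by X p r0 (z i) (m i).
  move=> ij; split; first exact: lt_le_trans (hj i ij) rc0.
  move=> v Xv vr; have iN : (i <= N)%N := ltnW (leq_trans ij jN).
  have h1 := Ef v Xv (le_trans rc0 (le_trans c0r0 vr)).
  have h2 := kd_tri pX Xx (Xz i iN) Xv.
  have h3 := kz 0%N i (leq0n _) iN.
  have h4 : \sum_(0 <= l < j) a l = \sum_(0 <= l < i) a l + \sum_(i <= l < j) a l.
    by rewrite (big_cat_nat (leq0n _) (ltnW ij)).
  by rewrite /m; rewrite z0 in h3; rewrite /T h4 in sT; lra.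
have sW : \sum_(0 <= i < j) a i * expR (- (2 * m i)) <= W.
  apply: wsum_bwd => // l lj; first by apply: a0; exact: leq_trans jN.
  by rewrite mul1r /m subrK.
have z0c : nrm (z 0%N - p) < c0 by rewrite z0; exact: lt_le_trans rc0.
have [Yj kj] := kd_chain_mesh pX pY c00 c01 c0r0 XY near_X T0 W0 (lexx _) X0 hs' hz z0c sT sW.
exists (z j); split => //; rewrite -{1}z0.
apply: le_trans kj _; rewrite -/W.
have := Ef w Xw wr; rewrite /T in sT; lra.
Qed.

Lemma kd_compact X K o : open X -> pseudodistance_on X (kobayashi X) ->
  compact K -> K `<=` X -> X o ->
  exists2 e : R, 0 < e & exists2 M : R, 0 <= M & forall y q, K q -> nrm (y - q) < e ->
    X y /\ kd X y o <= M.
Proof.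
move=> oX pX cK KX Xo.
pose f y : \bar R := if `[< X y >] then kobayashi X y o else +oo%E.
have [|e e0 [M hM]] := @compact_bounded_nrm _ _ K f cK.
  move=> x Kx; have [d d0 hd] := kd_small pX oX (KX _ Kx) ltr01.
  exists d => //; exists (1 + kd X x o) => y yx.
  have xx : nrm (x - x) < d by rewrite subrr nrm0.
  have [Xy Xx h] := hd y x yx xx.
  rewrite /f asboolT// (kdE pX)// lee_fin.
  by apply: le_trans (kd_tri pX Xy Xx Xo) _; rewrite lerD2r.
exists e => //; exists (Num.max M 0); first by rewrite le_max lexx orbT.
move=> y q Kq yq; have := hM q y Kq yq; rewrite /f.
case: asboolP => [Xy|_]; last by rewrite leye_eq.
by rewrite (kdE pX)// lee_fin => h; split => //; rewrite le_max h.
Qed.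

(** A nearly shortest chain to the outside passes near the compact set, so [o] is not much farther
    from [x] than the outside. The number 3 bounds the constant [1 + 2 * eta] of the polygon, where
    [eta <= 1]. *)
Lemma visible_far X p r lambda o : domain X -> pseudodistance_on X (kobayashi X) ->
  1 <= lambda -> visible_point2 lambda 3 X p -> X o -> 0 < r ->
  exists2 r' : R, 0 < r' /\ r' <= r & exists2 c : R, 0 <= c &
    forall x w, X x -> nrm (x - p) < r' -> X w -> r <= nrm (w - p) ->
      kd X x o <= kd X x w + c.
Proof.
move=> dX pX l1 vis Xo r0; have oX : open X by case: dX.
have [V [K [[oV Vp] _ cK KX hv]]] := vis _ (@nball_open _ _ p r) (nball_center p r0) (@nball_bounded _ _ p r).
have [r1 r10 hV] := open_nrm oV Vp.
have [e0 e00 [M M0 hM]] := kd_compact oX pX cK KX Xo.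
exists (Num.min r1 r); first by rewrite lt_min r10 r0 ge_min lexx orbT.
exists (M + 1); first by rewrite addr_ge0.
move=> x w Xx; rewrite lt_min => /andP[xr1 xr] Xw wr.
pose eta := Num.min 1 (e0 / 2).
have eta0 : 0 < eta by rewrite lt_min ltr01 divr_gt0.
have eta1 : eta <= 1 by rewrite ge_min lexx.
have etae : eta < e0.
  by apply: (@le_lt_trans _ _ (e0 / 2)); [rewrite ge_min lexx orbT|lra].
have [N [z [a [z0 zN nm]]]] := near_min_exists dX pX eta0 ltr01 Xx Xw.
have eps : 1 + 2 * eta <= 3 by lra.
have [|||||i [q [iN Kq zq]]] := visible_chain pX l1 (ltW eta0) eps hv _ _ _ _ nm _.
- by rewrite z0.
- by rewrite z0; exact: hV.
- by rewrite zN.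
- by rewrite zN /nball /= ltNge wr.
- by rewrite z0.
have [Xi kio] := hM _ _ Kq (le_lt_trans zq etae).
have [hs hm] := nm.
have X0 : X (z 0%N) by rewrite z0.
have [Xz kz] := nchain_kd pX X0 hs.
have h1 := kz 0%N i (leq0n _) (ltnW iN).
have h2 := kd_tri pX X0 Xi Xo.
have h3 : 0 <= \sum_(i <= l < N) a l by apply: (@sum_nat_ge0 a i N N) => // l /hs[].
have h4 := hm 0%N N (leq0n _) (leqnn _).
rewrite (big_cat_nat (leq0n _) (ltnW iN))/= z0 zN in h4.
rewrite z0 in h1 h2; lra.
Qed.

(** For [Y], [far_shadow] is used with the domains exchanged: an outside point [w] of [Y] yields an
    outside point [u] of [X] that is not much farther from [x], and visibility of [X] bounds the
    distance to [u]. Both bounds are therefore expressed by [kd X]. *)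
Lemma far_both X Y p r0 c0 lambda o : domain X -> domain Y ->
  pseudodistance_on X (kobayashi X) -> pseudodistance_on Y (kobayashi Y) ->
  0 < c0 -> c0 < 1 -> c0 <= r0 ->
  (forall u, nrm (u - p) < r0 -> X u -> Y u) -> (forall u, nrm (u - p) < r0 -> Y u -> X u) ->
  discs_near Y p r0 c0 -> 1 <= lambda -> visible_point2 lambda 3 X p -> X o ->
  exists2 r : R, 0 < r /\ r <= c0 & exists2 c : R, 0 <= c & forall x, X x -> nrm (x - p) < r ->
    far_by X p r0 x (kd X x o - c) /\ far_by Y p r0 x (kd X x o - c).
Proof.
move=> dX dY pX pY c00 c01 c0r0 XY YX near_Y l1 vis Xo.
have [r [rp rc] [c cp hc]] := visible_far dX pX l1 vis Xo c00.
have [w0 hw0] : exists k : R, k = 3 + 2 / c0 * wsum_bound 1 2 by eexists.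
have wp : 0 <= w0 by rewrite hw0 addr_ge0// mulr_ge0 ?divr_ge0 ?(ltW c00)// wsum_bound_ge0.
exists r => //; exists (c + w0); first by rewrite addr_ge0.
move=> x Xx xr; split => w Xw wr.
  have h := hc x w Xx xr Xw (le_trans c0r0 wr).
  clear -h wp; lra.
have xc : nrm (x - p) < c0 := lt_le_trans xr rc.
have Yx : Y x by apply: XY => //; exact: lt_le_trans c0r0.
have [u [Xu ur hu]] := far_shadow dY pY pX c00 c01 c0r0 YX near_Y (lexx _) Yx xc Xw (le_trans c0r0 wr).
have h := hc x u Xx xr Xu ur.
rewrite -hw0 in hu; clear -h hu; lra.
Qed.

(** * Additive comparison of the two distances near [p] *)

Section Localized.
Variables (X Y : set Cn) (p o : Cn) (r0 c0 r c : R).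
Hypotheses (dX : domain X) (pX : pseudodistance_on X (kobayashi X)).
Hypotheses (pY : pseudodistance_on Y (kobayashi Y)).
Hypotheses (c00 : 0 < c0) (c01 : c0 < 1) (c0r0 : 2 * c0 <= r0).
Hypothesis XY : forall u, nrm (u - p) < r0 -> X u -> Y u.
Hypothesis near_X : discs_near X p r0 c0.
Hypotheses (rc0 : r <= c0) (Xo : X o) (Yo : Y o).
Hypothesis far_X : forall x, X x -> nrm (x - p) < r -> far_by X p r0 x (kd X x o - c).

(** The bound of [wsum2] for [m i = kd X (z i) o - c] and [A = 1]. In [2 * c + 2] the 2 is the
    defect 1 of the chain plus at most 1 for the last step. *)
Definition chain_weight : R := 2 * wsum_bound (2 * 1) (2 * c + 2).

Lemma chain_weight_ge0 : 0 <= chain_weight.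
Proof. by rewrite mulr_ge0// wsum_bound_ge0// mulr_gt0. Qed.

Lemma c0_le_r0 : c0 <= r0.
Proof. by apply: le_trans c0r0; rewrite ler_peMl ?(ltW c00)// ler1n. Qed.

Lemma near_chain_kd T eta N z a : 0 <= T -> eta <= 1 -> eta <= mesh c0 T chain_weight ->
  X (z 0%N) -> near_min X eta 1 N z a -> \sum_(0 <= l < N) a l <= T ->
  (forall i, (i <= N)%N -> nrm (z i - p) < r) ->
  Y (z N) /\ kd Y (z 0%N) (z N) <= \sum_(0 <= l < N) a l + (2 / c0 * chain_weight + 1).
Proof.
move=> T0 eta1 em X0 [hs hm] sT hr.
have [Xz kz] := nchain_kd pX X0 hs.
apply: (kd_chain_mesh pX pY c00 c01 c0_le_r0 XY near_X T0 chain_weight_ge0 em X0 hs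
  (m := fun i => kd X (z i) o - c)) => //.
- move=> i iN; split; first exact: lt_le_trans (hr i (ltnW iN)) rc0.
  by apply: far_X; [apply: Xz|apply: hr]; exact: ltnW.
- exact: lt_le_trans (hr 0%N (leq0n _)) rc0.
apply: wsum2 => //; first by move=> j /hs[].
move=> i j ij jN.
have h := hm i j.+1 (leqW ij) jN.
have Xi := Xz i (leq_trans ij (ltnW jN)); have Xj := Xz j (ltnW jN); have Xj' := Xz j.+1 jN.
have h1 := kd_tri pX Xi Xo Xj'; have h2 := kd_tri pX Xo Xj Xj'.
have h3 := nstep_kd pX (hs j jN); have [_ h4 _ _] := hs j jN.
rewrite (kdC pX Xo Xj) in h2; move: h h1 h2 h3 h4 eta1; lra.
Qed.

Section Exit.
Variables (lambda : R) (V K : set Cn) (e0 M : R).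
Hypotheses (l1 : 1 <= lambda) (e00 : 0 < e0) (M0 : 0 <= M).
Hypothesis visible : forall (b d : R) (g : R -> Cn), geodesic lambda 3 X b d g ->
  (X `&` V) (g b) -> (X `\` nball p r) (g d) -> (g @` `[b, d]%classic) `&` K !=set0.
Hypothesis kd_K : forall y q, K q -> nrm (q - p) <= 3 / 4 * r0 -> nrm (y - q) < e0 ->
  Y y /\ kd Y y o <= M.

Definition exit_const : R := 2 / c0 * chain_weight + 1 + M.

(** Before its first exit the chain has a vertex [i] near [K], and the part up to [i], being inside
    the ball, transfers to [Y]. The point of [K] is within [r0 / 2 + r0 / 4] of [p], where distances
    to [o] in [Y] are controlled by [M]. *)
Lemma exit_kd T eta N k z a : 0 <= T -> 0 <= eta -> eta <= 1 -> eta <= r0 / 4 -> eta < e0 ->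
  eta <= mesh c0 T chain_weight ->
  X (z 0%N) -> V (z 0%N) -> nrm (z 0%N - p) < r -> near_min X eta 1 N z a ->
  \sum_(0 <= l < N) a l <= T -> (k <= N)%N -> r <= nrm (z k - p) ->
  kd Y (z 0%N) o <= \sum_(0 <= l < k) a l + exit_const.
Proof.
move=> T0 eta0 eta1 etar etae em X0 V0 zr nm sT kN hk.
have [j [jk hj lt_j]] := first_exit hk.
have jN := leq_trans jk kN.
have [hs hm] := nm; have [Xz kz] := nchain_kd pX X0 hs.
have nmj := near_min_prefix jN nm.
have eps : 1 + 2 * eta <= 3 by lra.
have [|||i [q [ij Kq zq]]] := visible_chain pX l1 eta0 eps visible X0 V0 _ _ nmj _.
- exact: Xz.
- by rewrite /nball /= ltNge hj.
- exact: zr.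
have iN := leq_trans (ltnW ij) jN.
have qp : nrm (q - p) <= 3 / 4 * r0.
  apply: le_trans (nrmD3 (z i) _ _) _; rewrite (nrmB q).
  apply: le_trans (lerD zq (ltW (lt_le_trans (lt_j i ij) rc0))) _.
  by move: etar c0r0; lra.
have [Yi kio] := kd_K Kq qp (le_lt_trans zq etae).
have a0 l : (l < N)%N -> 0 <= a l by move=> /hs[].
have sk : \sum_(0 <= l < N) a l = \sum_(0 <= l < i) a l + \sum_(i <= l < N) a l.
  by rewrite (big_cat_nat (leq0n _) iN).
have si0 := sum_nat_ge0 i a0 (leqnn N).
have [Yi' h] := @near_chain_kd T eta i z a T0 eta1 em X0 (near_min_prefix iN nm)
  ltac:(move: sk si0 sT; lra) (fun l li => lt_j l (leq_ltn_trans li ij)).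
have Y0 : Y (z 0%N).
  by apply: XY => //; apply: lt_le_trans zr (le_trans rc0 c0_le_r0).
have tri := kd_tri pY Y0 Yi Yo.
have sk' : \sum_(0 <= l < k) a l = \sum_(0 <= l < i) a l + \sum_(i <= l < k) a l.
  by rewrite (big_cat_nat (leq0n _) (leq_trans (ltnW ij) jk)).
have si0' := sum_nat_ge0 i a0 kN.
rewrite /exit_const; move: sk' si0' tri h kio; lra.
Qed.

(** If the chain leaves the ball at vertex [k], [exit_kd] for the chain and for its reversal bounds
    the distances of [x] and [y] to [o] in [Y] by the lengths before and after [k]; the triangle
    inequality through [o] concludes. *)
Lemma kd_comparison x y : X x -> V x -> nrm (x - p) < r -> X y -> V y -> nrm (y - p) < r ->
  kd Y x y <= kd X x y + (1 + 2 * exit_const).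
Proof.
move=> Xx Vx xr Xy Vy yr.
pose T := kd X x y + 1.
have T0 : 0 <= T by rewrite addr_ge0// kd_ge0.
have r0p : 0 < r0 by apply: lt_le_trans c0r0; rewrite mulr_gt0.
(* The mesh depends on the length of the chain, the final constant does not. *)
pose eta := Num.min (Num.min 1 (r0 / 4)) (Num.min (e0 / 2) (mesh c0 T chain_weight)).
have eta0 : 0 < eta by rewrite !lt_min ltr01 (divr_gt0 r0p)// (divr_gt0 e00)// mesh_gt0// chain_weight_ge0.
have eta1 : eta <= 1 by rewrite !ge_min lexx.
have etar : eta <= r0 / 4 by rewrite !ge_min lexx orbT.
have etae : eta < e0.
  by apply: (@le_lt_trans _ _ (e0 / 2)); [rewrite !ge_min lexx !orbT|rewrite ltr_pdivrMr// ltr_pMr// ltr1n].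
have em : eta <= mesh c0 T chain_weight by rewrite !ge_min lexx !orbT.
have [N [z [a [z0 zN nm]]]] := near_min_exists dX pX eta0 ltr01 Xx Xy.
have X0 : X (z 0%N) by rewrite z0.
have [hs hm] := nm; have [Xz kz] := nchain_kd pX X0 hs.
have sT : \sum_(0 <= l < N) a l <= T.
  by have := hm 0%N N (leq0n _) (leqnn _); rewrite z0 zN.
have cw : 0 <= 2 / c0 * chain_weight.
  by rewrite mulr_ge0 ?divr_ge0 ?(ltW c00)// chain_weight_ge0.
have [[k kN hk]|no] := pselect (exists2 k, (k <= N)%N & r <= nrm (z k - p)); last first.
  have hr i : (i <= N)%N -> nrm (z i - p) < r.
    by move=> iN; rewrite ltNge; apply/negP => h; apply: no; exists i.
  have [_] := near_chain_kd T0 eta1 em X0 nm sT hr; rewrite z0 zN.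
  by move: sT cw M0; rewrite /T /exit_const; lra.
have h1 := @exit_kd T eta N k z a T0 (ltW eta0) eta1 etar etae em.
rewrite z0 in h1; have {}h1 := h1 Xx Vx xr nm sT kN hk.
have nm' := near_min_rev pX X0 nm.
have sT' : \sum_(0 <= l < N) a (N - l.+1)%N <= T by rewrite sum_nat_rev// subnn subn0.
have h2 := @exit_kd T eta N (N - k)%N _ _ T0 (ltW eta0) eta1 etar etae em _ _ _ nm' sT' (leq_subr _ _).
rewrite subKn// subn0 zN sum_nat_rev ?leq_subr// subKn// subn0 in h2.
have {}h2 := h2 Xy Vy yr hk.
have in_Y u : X u -> nrm (u - p) < r -> Y u.
  by move=> Xu ur; apply: XY => //; apply: lt_le_trans ur (le_trans rc0 c0_le_r0).
have tri := kd_tri pY (in_Y x Xx xr) Yo (in_Y y Xy yr).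
rewrite (kdC pY Yo (in_Y y Xy yr)) in tri.
rewrite (big_cat_nat (leq0n _) kN)/= in sT.
by move: sT h1 h2 tri; rewrite /T; lra.
Qed.

End Exit.
End Localized.
End LocalComparison.

(** * Geodesics *)

Section Curves.
Context {R : realType} {n : nat}.
Local Notation C := (Cplx R).
Local Notation Cn := 'rV[Cplx R]_n.
Implicit Types (X Y : set Cn) (x y o p : Cn) (g : R -> Cn) (a b u v s t e eta r T W : R).

(** [Q] need not pass to the union of adjacent intervals, but being joined by a chain of
    [Q]-intervals does, so [cousin] is applied to the latter. *)
Lemma fine_partition (Q : R -> R -> Prop) a b : a <= b ->
  (forall u, a <= u -> u <= b -> exists2 d : R, 0 < d &
    forall s t, a <= s -> s <= u -> u <= t -> t <= b -> t - s < d -> Q s t) ->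
  exists (N : nat) (tau : nat -> R), [/\ tau 0%N = a, tau N = b &
    forall i, (i < N)%N -> [/\ tau i <= tau i.+1, a <= tau i, tau i.+1 <= b &
      Q (tau i) (tau i.+1)]].
Proof.
move=> ab h.
pose step s t (_ : R) := [/\ s <= t, a <= s, t <= b & Q s t].
have [L cL] : exists L, chain step a b L.
  apply: (@cousin _ (fun s t => exists L, chain step s t L)) => //.
    by move=> s t u _ _ _ _ [L cL] [L' cL']; exists (L + L'); exact: chain_trans cL cL'.
  move=> u au ub; have [d d0 hd] := h u au ub; exists d => // s t as_ su ut tb td.
  by exists 0; apply: chain1; split => //; [exact: le_trans ut|exact: hd].
by have [N [tau [w [t0 tN _ ht]]]] := chain_seq cL; exists N, tau.
Qed.

Lemma partition_le (tau : nat -> R) N : (forall i, (i < N)%N -> tau i <= tau i.+1) ->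
  forall i j, (i <= j)%N -> (j <= N)%N -> tau i <= tau j.
Proof.
move=> h i; elim=> [|j IH]; first by rewrite leqn0 => /eqP ->.
rewrite leq_eqVlt => /orP[/eqP -> //|ij jN].
by apply: le_trans (h j jN); apply: IH => //; exact: ltnW.
Qed.

Lemma kr_length_sum X g (tau : nat -> R) N : (forall i, (i < N)%N -> tau i <= tau i.+1) ->
  forall i j, (i <= j)%N -> (j <= N)%N ->
  kr_length X g (tau i) (tau j) = (\sum_(i <= l < j) kr_length X g (tau l) (tau l.+1))%E.
Proof.
move=> h i; elim=> [|j IH].
  by rewrite leqn0 => /eqP -> _; rewrite big_geq// /kr_length set_itv1 integral_set1.
rewrite leq_eqVlt => /orP[/eqP -> _|ij jN].
  by rewrite big_geq// /kr_length set_itv1 integral_set1.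
rewrite big_nat_recr//= -IH//; last exact: ltnW.
by apply: kr_length_itvU; [exact: (@partition_le tau N h i j ij (ltnW jN))|exact: h].
Qed.

Lemma ac_continuous a b g u e : absolutely_continuous a b g -> a <= u -> u <= b -> 0 < e ->
  exists2 d : R, 0 < d & forall t, a <= t -> t <= b -> `|t - u| < d -> nrm (g t - g u) < e.
Proof.
move=> ac au ub e0; have [d d0 hd] := ac e e0; exists d => // t at_ tb tu.
have tri : trivIset setT (fun i : 'I_1 => `]Num.min t u, Num.max t u[%classic).
  by move=> i j _ _ _; rewrite (ord1 i) (ord1 j).
have := hd 1%N (fun=> Num.min t u) (fun=> Num.max t u) _ tri.
rewrite !big_ord1 nrm_ltE => h.
have : nrm (g (Num.max t u) - g (Num.min t u)) < e.
  apply: h.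
    by move=> _; rewrite le_min at_ au ge_max tb ub; split => //; rewrite ge_min !le_max lexx.
  by move: tu; case: (leP t u) => ?; [rewrite ler0_norm ?opprB// subr_le0|rewrite gtr0_norm ?subr_gt0].
by case: (leP t u) => // _; rewrite nrmB.
Qed.

Lemma ac_restrict a b s t g : a <= s -> t <= b ->
  absolutely_continuous a b g -> absolutely_continuous s t g.
Proof.
move=> as_ tb ac e e0; have [d d0 hd] := ac e e0; exists d => // m s' t' h.
apply: hd => i; have [h1 h2 h3] := h i.
by split => //; [exact: le_trans h1|exact: le_trans tb].
Qed.

Lemma ac_near a b g u e : absolutely_continuous a b g -> a <= u -> u <= b -> 0 < e ->
  exists2 d : R, 0 < d & forall s t, a <= s -> s <= u -> u <= t -> t <= b -> t - s < d ->
    forall v, s <= v -> v <= t -> nrm (g v - g u) < e.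
Proof.
move=> ac au ub e0; have [d d0 hd] := ac_continuous ac au ub e0.
exists d => // s t as_ su ut tb td v sv vt.
apply: hd; [exact: le_trans sv|exact: le_trans tb|].
by apply: le_lt_trans td; rewrite ler_norml; apply/andP; split; lra.
Qed.

Lemma kd_fine X a b g u : open X -> pseudodistance_on X (kobayashi X) ->
  absolutely_continuous a b g -> a <= u -> u <= b -> X (g u) ->
  exists2 d : R, 0 < d & forall s t, a <= s -> s <= u -> u <= t -> t <= b -> t - s < d ->
    forall v w, s <= v -> v <= t -> s <= w -> w <= t -> kd X (g v) (g w) <= 1.
Proof.
move=> oX pX ac au ub Xu; have [e e0 he] := kd_small pX oX Xu ltr01.
have [d d0 hd] := ac_near ac au ub e0; exists d => // s t h1 h2 h3 h4 h5 v w h6 h7 h8 h9.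
by have [] := he _ _ (hd s t h1 h2 h3 h4 h5 v h6 h7) (hd s t h1 h2 h3 h4 h5 w h8 h9).
Qed.

(** The curve is cut so finely that both distances vary by at most 1 on each piece. There [kr_local]
    applies with a single exponent [m i], so the error is a finite sum to which [wsum2] applies with
    [A = lambda]. *)
Lemma length_comparison X Y p o r0 c0 r c k lambda eps g s t :
  open X -> pseudodistance_on X (kobayashi X) ->
  open Y -> pseudodistance_on Y (kobayashi Y) ->
  0 < c0 -> c0 < 1 -> c0 <= r0 ->
  (forall x, nrm (x - p) < r0 -> X x -> Y x) -> discs_near X p r0 c0 ->
  r <= c0 -> Y o -> 1 <= lambda ->
  (forall x, X x -> nrm (x - p) < r -> far_by X p r0 x (kd Y x o - c)) ->
  (forall x y, X x -> nrm (x - p) < r -> X y -> nrm (y - p) < r -> kd X x y <= kd Y x y + k) ->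
  s <= t -> absolutely_continuous s t g ->
  (forall u, s <= u -> u <= t -> X (g u) /\ nrm (g u - p) < r) ->
  (forall t1 t2, s <= t1 -> t1 <= t2 -> t2 <= t ->
     (kr_length X g t1 t2 <= (lambda * kd X (g t1) (g t2) + eps)%:E)%E) ->
  (kr_length Y g s t <= kr_length X g s t +
    (2 / c0 * (2 * wsum_bound (2 * lambda) (lambda * (2 * c + k + 3) + eps)))%:E)%E.
Proof.
move=> oX pX oY pY c00 c01 c0r0 XY near_X rc0 Yo l1 far cmp st ac gX geo.
have rr0 := le_trans rc0 c0r0.
have inY x : X x -> nrm (x - p) < r -> Y x by move=> Xx xr; apply: XY => //; exact: lt_le_trans rr0.
have l0 : 0 < lambda by exact: lt_le_trans l1.
have [|N [tau [t0 tN ht]]] := @fine_partition (fun s t => forall v w, s <= v -> v <= t -> s <= w -> w <= t ->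
    kd X (g v) (g w) <= 1 /\ kd Y (g v) (g w) <= 1) s t st.
  move=> u su ut; have [Xu ur] := gX u su ut.
  have [d d0 hd] := kd_fine oX pX ac su ut Xu.
  have [d' d'0 hd'] := kd_fine oY pY ac su ut (inY _ Xu ur).
  exists (Num.min d d'); first by rewrite lt_min d0.
  move=> s' t' h1 h2 h3 h4; rewrite lt_min => /andP[h5 h6] v w h7 h8 h9 h10.
  by split; [exact: (hd s' t')|exact: (hd' s' t')].
have mono i : (i < N)%N -> tau i <= tau i.+1 by move=> /ht[].
have tau_s i : (i <= N)%N -> s <= tau i by move=> iN; rewrite -t0; exact: (partition_le mono).
have tau_t i : (i <= N)%N -> tau i <= t by move=> iN; rewrite -tN; exact: (partition_le mono).
pose A i := fine (kr_length X g (tau i) (tau i.+1)).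
have AE i : (i < N)%N -> kr_length X g (tau i) (tau i.+1) = (A i)%:E.
  move=> iN; rewrite /A fineK// ge0_fin_numE ?kr_length_ge0//.
  by apply: le_lt_trans (geo _ _ (tau_s i (ltnW iN)) (mono i iN) (tau_t _ iN)) (ltry _).
have A0 i : (i < N)%N -> 0 <= A i by move=> iN; rewrite -lee_fin -AE// kr_length_ge0.
have AS i j : (i <= j)%N -> (j <= N)%N ->
    kr_length X g (tau i) (tau j) = (\sum_(i <= l < j) A l)%:E.
  move=> ij jN; rewrite (kr_length_sum X g mono ij jN) -sumEFin.
  by apply: eq_big_nat => l /andP[_ lj]; apply: AE; exact: leq_trans jN.
(* The 1 covers the variation of the distance to [o] within a piece. Twice this, and 1 for the last
   piece, make up the 3 in the constant. *)
pose m i := kd Y (g (tau i)) o - 1 - c.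
pose E i := 1 + 2 / c0 * expR (- (2 * m i)).
have Xt i : (i <= N)%N -> X (g (tau i)) /\ nrm (g (tau i) - p) < r.
  by move=> iN; exact: gX (tau_s i iN) (tau_t i iN).
have Yt i : (i <= N)%N -> Y (g (tau i)) by move=> /Xt[]; exact: inY.
have YA i : (i < N)%N -> (kr_length Y g (tau i) (tau i.+1) <= (E i * A i)%:E)%E.
  move=> iN; rewrite EFinM -AE//; apply: kr_length_scale.
    by rewrite addr_gt0// mulr_gt0 ?expR_gt0// divr_gt0.
  move=> u iu ui.
  have [Xu ur] := gX u (le_trans (tau_s i (ltnW iN)) iu) (le_trans ui (tau_t _ iN)).
  have Yu := inY _ Xu ur.
  apply: (kr_local pX c00 c01 XY near_X _ (lt_le_trans ur rc0)).
  move=> w Xw wr; apply: le_trans (far _ Xu ur w Xw wr).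
  have [_ _ _ hQ] := ht i iN.
  have [_ h1] := hQ (tau i) u (lexx _) (mono i iN) iu ui.
  have h2 := kd_tri pY (Yt i (ltnW iN)) Yu Yo.
  rewrite /m; move: h1 h2; clear; lra.
rewrite -t0 -tN AS// (kr_length_sum Y g mono)// -EFinD.
apply: (@le_trans _ _ (\sum_(0 <= i < N) (E i * A i))%:E).
  rewrite -sumEFin big_nat_cond [leRHS]big_nat_cond; apply: lee_sum => i /andP[/andP[_ iN] _].
  exact: YA.
rewrite lee_fin (eq_bigr (fun i => A i + 2 / c0 * (A i * expR (- (2 * m i))))); last first.
  by move=> i _; rewrite /E; ring.
rewrite big_split/= -mulr_sumr lerD2l ler_wpM2l ?divr_ge0 ?(ltW c00)//.
apply: wsum2 => // i j ij jN.
have iN := leq_trans ij (ltnW jN).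
have := geo _ _ (tau_s i iN) (partition_le mono (leqW ij) jN) (tau_t _ jN).
rewrite (AS i j.+1 (leqW ij) jN) lee_fin => /le_trans; apply.
have [Xi ir] := Xt i iN; have [Xj jr] := Xt j (ltnW jN); have [Xj' jr'] := Xt j.+1 jN.
have [_ _ _ hQ] := ht j jN.
have [h1 _] := hQ (tau j) (tau j.+1) (lexx _) (mono j jN) (mono j jN) (lexx _).
have h2 := kd_tri pX Xi Xj Xj'.
have h3 := cmp _ _ Xi ir Xj jr.
have h4 := kd_tri pY (Yt i iN) Yo (Yt j (ltnW jN)).
rewrite (kdC pY Yo (Yt j (ltnW jN))) in h4.
rewrite addrA lerD2r -mulrDr ler_pM2l// /m.
move: h1 h2 h3 h4; clear; lra.
Qed.

Lemma cball_nrm_closed p r : closed [set x : Cn | nrm (x - p) <= r].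
Proof.
rewrite -[X in closed X]setCK; apply: open_closedC; apply: open_nrmP => x /= /negP.
rewrite -ltNge => h; exists (nrm (x - p) - r); first by rewrite subr_gt0.
move=> y yx /=; apply/negP; rewrite -ltNge.
have := nrmD3 y x p; rewrite (nrmB x y); lra.
Qed.

(** Visibility of [X] enters twice: with additive constant 3 to obtain the comparisons, then with
    the larger constant [eps'] that these comparisons produce. *)
Lemma visible_transfer X Y p lambda eps : domain X -> domain Y ->
  pseudodistance_on X (kobayashi X) -> pseudodistance_on Y (kobayashi Y) ->
  hyperbolic_at X p -> hyperbolic_at Y p -> closure X p -> equivalent_at p X Y ->
  1 <= lambda -> 0 <= eps -> visible_point lambda X p -> visible_point2 lambda eps Y p.
Proof.
move=> dX dY pX pY hX hY clX [U0 [oU0 U0p _ UXY]] l1 eps0 vis U oU Up bU.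
have [oX oY] : open X /\ open Y by case: dX; case: dY.
have [r1 r10 hr1] := open_nrm oU0 U0p.
have [r2 r20 hr2] := open_nrm oU Up.
pose r0 := Num.min r1 r2.
have r00 : 0 < r0 by rewrite lt_min r10.
have XY x : nrm (x - p) < r0 -> X x -> Y x.
  rewrite lt_min => /andP[/hr1 xU _] Xx.
  by have [] : (U0 `&` Y) x by rewrite -UXY.
have YX x : nrm (x - p) < r0 -> Y x -> X x.
  rewrite lt_min => /andP[/hr1 xU _] Yx.
  by have [] : (U0 `&` X) x by rewrite UXY.
have [cX cX0 [cX1 nearX]] := disc_stays_near hX r00.
have [cY cY0 [cY1 nearY]] := disc_stays_near hY r00.
pose c0 := Num.min (Num.min cX cY) (r0 / 2).
have c00 : 0 < c0 by rewrite !lt_min cX0 cY0 divr_gt0.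
have c0X : c0 <= cX by rewrite !ge_min lexx.
have c0Y : c0 <= cY by rewrite !ge_min lexx orbT.
have c01 : c0 < 1 by exact: le_lt_trans cX1.
have c0r0 : 2 * c0 <= r0 by rewrite mulrC -ler_pdivlMr// !ge_min lexx orbT.
have c0r0' : c0 <= r0 by apply: le_trans c0r0; rewrite ler_peMl ?(ltW c00)// ler1n.
have {}nearX : discs_near X p r0 c0.
  by move=> phi hphi p0 z zc; apply: nearX hphi _ _ _; [exact: lt_le_trans c0X|exact: lt_le_trans c0X].
have {}nearY : discs_near Y p r0 c0.
  by move=> phi hphi p0 z zc; apply: nearY hphi _ _ _; [exact: lt_le_trans c0Y|exact: lt_le_trans c0Y].
have [ o Xo ho] := (closure_nrm X p).1 clX r0 r00.
have Yo : Y o by exact: XY.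
have vis3 : visible_point2 lambda 3 X p by exact: vis.
have [r [rp rc0] [c cp far]] :=
  far_both dX dY pX pY c00 c01 c0r0' XY YX nearY l1 vis3 Xo.
have [V4 [K4 [[oV4 V4p] _ cK4 K4X hK4]]] :=
  vis3 _ (@nball_open _ _ p r) (nball_center p rp) (@nball_bounded _ _ p r).
(* [K4] is contained in [X]; this part of it lies where the domains coincide, hence in [Y]. *)
pose L := K4 `&` [set x : Cn | nrm (x - p) <= 3 / 4 * r0].
have LY : L `<=` Y.
  by move=> x [/K4X Xx /= xr]; apply: XY => //; apply: le_lt_trans xr _; lra.
have [e0 e00 [M M0 hM]] := kd_compact oY pY (compact_closedI cK4 (@cball_nrm_closed p _)) LY Yo.
have kdK y q : K4 q -> nrm (q - p) <= 3 / 4 * r0 -> nrm (y - q) < e0 -> Y y /\ kd Y y o <= M.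
  by move=> Kq qp; apply: hM.
have [k hk] : exists k : R, k = 1 + 2 * exit_const c0 c M by eexists.
have k0 : 0 <= k.
  rewrite hk addr_ge0// mulr_ge0// !addr_ge0// mulr_ge0 ?divr_ge0 ?(ltW c00)//.
  exact: chain_weight_ge0.
have cmp x y : X x -> V4 x -> nrm (x - p) < r -> X y -> V4 y -> nrm (y - p) < r ->
    kd Y x y <= kd X x y + k.
  rewrite hk.
  have farX (u : Cn) : X u -> nrm (u - p) < r -> far_by X p r0 u (kd X u o - c).
    by move=> Xu ur; have [] := far u Xu ur.
  exact: (kd_comparison dX pX pY c00 c01 c0r0 XY nearX rc0 Xo Yo farX l1 e00 M0 hK4 kdK).
have [r4 r40 hr4] := open_nrm oV4 V4p.
pose r5 := Num.min r r4.
have r50 : 0 < r5 by rewrite lt_min rp.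
have r5r x : nrm (x - p) < r5 -> nrm (x - p) < r /\ V4 x.
  by rewrite lt_min => /andP[h1 /hr4].
have r5c0 : r5 <= c0 by apply: le_trans rc0; rewrite ge_min lexx.
have r5r0 : r5 <= r0 by exact: le_trans c0r0'.
pose k9 : R := 2 / c0 * (2 * wsum_bound (2 * lambda) (lambda * (2 * c + k + 3) + eps)).
have l0 : 0 < lambda by exact: lt_le_trans l1.
have k90 : 0 <= k9.
  by rewrite mulr_ge0 ?divr_ge0 ?(ltW c00)// mulr_ge0// wsum_bound_ge0// mulr_gt0.
(* [k9] is the excess of the length in [X], and [lambda * k] the price of replacing [kd Y] by [kd X]
   on the right-hand side. *)
pose eps' := eps + k9 + lambda * k.
have eps'0 : 0 <= eps' by rewrite !addr_ge0// mulr_ge0// ltW.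
(* The comparisons hold up to radius [r5]; visibility is used at [r5 / 2], leaving room for an
   overshoot of [r5 / 4] past the first exit. *)
have r52 : 0 < r5 / 2 by rewrite divr_gt0.
have [V [K [[oV Vp] [cV VU] cK KX hV]]] :=
  vis eps' eps'0 _ (@nball_open _ _ p (r5 / 2)) (nball_center p r52) (@nball_bounded _ _ p (r5 / 2)).
have ballU x : nrm (x - p) < r5 -> U x.
  move=> xr; apply: hr2; apply: lt_le_trans xr _.
  by apply: le_trans r5r0 _; rewrite ge_min lexx orbT.
have r5h : r5 / 2 < r5 by rewrite ltr_pdivrMr// ltr_pMr// ltr1n.
exists V, (K `&` [set x : Cn | nrm (x - p) <= r5 / 2 + r5 / 4]); split => //.
- by split => // x /VU /= h; apply: ballU; exact: lt_trans r5h.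
- by apply: compact_closedI => //; exact: cball_nrm_closed.
- move=> x [/KX Xx /= xr]; apply: XY => //; apply: lt_le_trans r5r0.
  by apply: le_lt_trans xr _; lra.
move=> a b g [ab ac gY geo] [Yga Vga] [Ygb Ugb].
have r54 : 0 < r5 / 4 by rewrite divr_gt0.
have gY' u : a <= u -> u <= b -> Y (g u).
  by move=> au ub; apply: gY; exists u => //=; rewrite in_itv /= au.
(* The first partition point outside the ball replaces the first exit time. *)
have [|N [tau [t0 tN ht]]] := @fine_partition
    (fun s t => forall v, s <= v -> v <= t -> nrm (g v - g s) < r5 / 4) a b ab.
  move=> u au ub; have r58 : 0 < r5 / 8 by rewrite divr_gt0.
  have [d d0 hd] := ac_near ac au ub r58; exists d => // s t h1 h2 h3 h4 h5 v h6 h7.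
  have st := le_trans h2 h3.
  have h8 := hd s t h1 h2 h3 h4 h5 v h6 h7.
  have h9 := hd s t h1 h2 h3 h4 h5 s (lexx _) st.
  apply: le_lt_trans (nrmD3 (g u) _ _) _; rewrite (nrmB (g u)).
  by apply: lt_le_trans (ltrD h8 h9) _; lra.
have mono i : (i < N)%N -> tau i <= tau i.+1 by move=> /ht[].
have gN : r5 / 2 <= nrm (g (tau N) - p).
  rewrite tN leNgt; apply/negP => h; apply: Ugb; apply: ballU.
  exact: lt_trans r5h.
have [j [jN hj lt_j]] := @first_exit _ _ (g \o tau) p (r5 / 2) N gN.
have aj : a <= tau j by rewrite -t0; exact: (@partition_le tau N mono 0 j (leq0n _) jN).
have jb : tau j <= b by rewrite -tN; exact: (@partition_le tau N mono j N jN (leqnn _)).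
have near u : a <= u -> u <= tau j -> nrm (g u - p) < r5 / 2 + r5 / 4.
  move=> au uj.
  have : forall i, (i <= j)%N -> tau i <= u \/ nrm (g u - p) < r5 / 2 + r5 / 4.
    elim=> [|i IH] ij; first by left; rewrite t0.
    have [iu|] := IH (ltnW ij); last by right.
    have [//|ui] := leP (tau i.+1) u; first by left.
    right; have [_ _ _ h] := ht i (leq_trans ij jN).
    apply: le_lt_trans (nrmD3 (g (tau i)) _ _) _; rewrite addrC.
    by apply: ltrD; [exact: lt_j|apply: h => //; exact: ltW].
  move=> /(_ j (leqnn _))[ju|//]; have uE : u = tau j by apply/eqP; rewrite eq_le uj.
  (* The exit index is not 0, because [g a] lies in [V] and so within [r5 / 2] of [p]. *)
  case: j jN hj lt_j aj jb uj ju uE {au} => [|j] jN hj lt_j aj jb uj ju ->.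
    by move: hj; rewrite /= t0 leNgt => /negP[]; apply: VU; exact: subset_closure.
  have [h1 _ _ h] := ht j jN.
  apply: le_lt_trans (nrmD3 (g (tau j)) _ _) _; rewrite addrC.
  by apply: ltrD; [exact: lt_j|apply: h].
have r534 : r5 / 2 + r5 / 4 < r5 by lra.
have gX u : a <= u -> u <= tau j -> [/\ X (g u), Y (g u) & nrm (g u - p) < r5].
  move=> au uj; have h := lt_trans (near u au uj) r534.
  have Yu := gY' u au (le_trans uj jb).
  by split => //; apply: YX => //; exact: lt_le_trans r5r0.
have geoX : geodesic lambda eps' X a (tau j) g.
  split => //.
  - exact: ac_restrict ac.
  - by move=> _ [u /= uI <-]; move: uI; rewrite in_itv /= => /andP[au uj]; have [] := gX u au uj.
  move=> s t as_ st tj.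
  have sj := le_trans st tj; have at_ := le_trans as_ st.
  have [Xs Ys rs] := gX s as_ sj; have [Xt Yt rt] := gX t at_ tj.
  have geo' t1 t2 : s <= t1 -> t1 <= t2 -> t2 <= t ->
      (kr_length Y g t1 t2 <= (lambda * kd Y (g t1) (g t2) + eps)%:E)%E.
    move=> h1 h2 h3.
    have [a1 t2b] := (le_trans as_ h1, le_trans h3 (le_trans tj jb)).
    have := geo t1 t2 a1 h2 t2b; rewrite (kdE pY) ?EFinD ?EFinM//; apply: gY' => //.
      exact: le_trans h2 t2b.
    exact: le_trans h2.
  have cmpYX x y : Y x -> nrm (x - p) < r5 -> Y y -> nrm (y - p) < r5 ->
      kd Y x y <= kd X x y + k.
    move=> Yx xr Yy yr; have [xr' xV] := r5r x xr; have [yr' yV] := r5r y yr.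
    by apply: cmp => //; apply: YX => //; exact: lt_le_trans r5r0.
  have farY x : Y x -> nrm (x - p) < r5 -> far_by Y p r0 x (kd X x o - c).
    move=> Yx xr; have [xr' _] := r5r x xr.
    have Xx : X x by apply: YX => //; exact: lt_le_trans r5r0.
    by have [] := far x Xx xr'.
  have := length_comparison oY pY oX pX c00 c01 c0r0' YX nearY r5c0 Xo l1 farY cmpYX st
    (ac_restrict as_ (le_trans tj jb) ac) _ geo'.
  rewrite -/k9 => /(_ _)/le_trans; apply.
    move=> u su ut; have [] // := gX u (le_trans as_ su) (le_trans ut tj).
  have := geo' s t (lexx _) st (lexx _) => h.
  apply: le_trans (leeD2r _ h) _.
  rewrite (kdE pX)// -!EFinM -!EFinD lee_fin /eps'.
  have := ler_wpM2l (ltW l0) (cmpYX _ _ Ys rs Yt rt).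
  by rewrite mulrDr; lra.
have [||_ [[t /= tI] <-] Kt] := hV a (tau j) g geoX.
- by split => //; have [] := gX a (lexx _) aj.
- by split; [have [] := gX (tau j) aj (lexx _)|rewrite /nball /= ltNge hj].
move: tI; rewrite in_itv /= => /andP[at_ tj].
exists (g t); split; first by exists t => //=; rewrite in_itv /= at_ (le_trans tj jb).
by split => //=; exact: ltW (near t at_ tj).
Qed.

Lemma local_equiv_class_refl X p : hyperbolic_domain_at X p -> local_equiv_class X p X.
Proof.
move=> hX; split => //; exists (nball p 1); split => //.
- exact: nball_open.
- exact: nball_center.
- exact: nball_bounded.
Qed.

End Curves.

Theorem theorem16 (R : realType) (n : nat) (lambda : R)
    (Omega : set 'rV[Cplx R]_n) (p : 'rV[Cplx R]_n) :
  1 <= lambda ->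
  domain Omega -> hyperbolic Omega -> boundary Omega p ->
  hyperbolic_at Omega p ->
  (visible_point lambda Omega p <->
  (forall D : set 'rV[Cplx R]_n, local_equiv_class Omega p D ->
     visible_point lambda D p)).
Proof.
move=> l1 dO hO bO aO; split => [vis D [[dD hD _ aD] eqD] eps eps0|h].
  exact: visible_transfer dO dD hO.1 hD.1 aO aD bO.1 eqD l1 eps0 vis.
(* The converse is the case [D = Omega]. *)
by apply: h; exact: local_equiv_class_refl.
Qed.
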